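(* Let $c\geq 3$ be a natural number and let $\Phi:\mathscr{C}(\mathbb{E}^{c})\to\mathscr{C}(\mathbb{E}^{c+1})$ be a mapping. Then the following are equivalent: (A) $\Phi$ is a non-trivial lattice homomorphism. (B) There exist a hyperplane $H\subset\mathbb{E}^{c+1}$ and an affine bijection $\phi:\mathbb{E}^{c}\to H$ such that precisely one of the following cases holds: (i) For any $x\in\mathbb{E}^{c}$ and any $C\in\mathscr{C}(\mathbb{E}^{c})$, $\Phi(\{x\})=\{\phi(x)\}$ and $\Phi(C)=\bigcup_{x\in C}\Phi(\{x\})$ (and thus $\Phi(C)=\phi(C)$, the image of $C$ under $\phi$). (ii) $\Phi(\emptyset)=\{o\}$ for some $o\in\mathbb{E}^{c+1}\setminus H$, and for any $x\in\mathbb{E}^{c}$ and any non-empty $C\in\mathscr{C}(\mathbb{E}^{c})$, $\Phi(\{x\})=[\phi(x),o]$ and $\Phi(C)=\bigcup_{x\in C}\Phi(\{x\})$. (iii) There exists a vector $v$ not parallel to $H$ such that for all $x\in\mathbb{E}^{c}$ and all $C\in\mathscr{C}(\mathbb{E}^{c})$, $\Phi(\{x\})=[\phi(x),\phi(x)+v]$ and $\Phi(C)=\bigcup_{x\in C}\Phi(\{x\})$. (iv) There exist $o\in\mathbb{E}^{c+1}\setminus H$ and $\gamma\in(0,1)$ such that for all $x\in\mathbb{E}^{c}$ and all $C\in\mathscr{C}(\mathbb{E}^{c})$, $\Phi(\{x\})=[\phi(x),\gamma\phi(x)+(1-\gamma)o]$ and $\Phi(C)=\bigcup_{x\in C}\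Phi(\{x\})$.
   Context: $\mathbb{E}^{d}$ denotes $d$-dimensional Euclidean space. $\mathscr{C}(\mathbb{E}^{d})$ is the set of all compact convex subsets of $\mathbb{E}^{d}$, including the empty set; it is a lattice with $C\wedge D=C\cap D$ and $C\vee D=\operatorname{conv}(C\cup D)$. A lattice homomorphism $\Phi$ is a map with $\Phi(C\wedge D)=\Phi(C)\wedge\Phi(D)$ and $\Phi(C\vee D)=\Phi(C)\vee\Phi(D)$ for all $C,D$. It is called trivial if it maps all convex compact sets (including $\emptyset$) to one and the same set, and non-trivial otherwise. $[a,b]$ denotes the closed line segment with endpoints $a,b$. *)

(* Defs.v *)
From HB Require Import structures.
From mathcomp Require Import all_boot all_order all_algebra.
From mathcomp Require Import all_classical all_reals all_analysis.
From mathcomp Require Import ring.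

Set Implicit Arguments.
Unset Strict Implicit.
Unset Printing Implicit Defensive.

Import Order.TTheory GRing.Theory Num.Theory.
Import numFieldNormedType.Exports.

Local Open Scope classical_set_scope.
Local Open Scope ring_scope.

(* E^n is 'rV[R]_n for a realType R. Its topology in the library is that of the
   sup norm, which coincides with the Euclidean one. *)

Section convexity.
Context (R : realType) (n : nat).
Local Notation E := 'rV[R]_n.
Implicit Types (A B : set E) (x y : E).

Definition segment x y : set E :=
  [set (1 - t) *: x + t *: y | t in `[0, 1]].

Definition conv_hull A : set E := smallest (@convex_set R E) A.

Lemma convex_setP A : @convex_set R E A <->
  (forall x y (t : R), A x -> A y -> 0 <= t -> t <= 1 ->
    A (t *: x + (1 - t) *: y)).
Proof.
split=> [cA x y t Ax Ay t0 t1|cA x y l].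
- by apply: set_mem; apply: (cA x y (Itv01 t0 t1)); exact: mem_set.
- move=> /set_mem Ax /set_mem Ay; apply: mem_set.
  by apply: cA.
Qed.

Lemma convex_set_setI A B :
  @convex_set R E A -> @convex_set R E B -> @convex_set R E (A `&` B).
Proof.
move=> /convex_setP cA /convex_setP cB; apply/convex_setP => x y t [? ?] [? ?].
by move=> t0 t1; split; [exact: cA|exact: cB].
Qed.

Lemma convex_set0 : @convex_set R E set0.
Proof. by apply/convex_setP. Qed.

Lemma convex_set1 x : @convex_set R E [set x].
Proof.
by apply/convex_setP => _ _ t -> -> _ _ /=; rewrite -scalerDl addrCA subrr addr0 scale1r.
Qed.

Lemma conv_hull_convex A : @convex_set R E (conv_hull A).
Proof.
apply/convex_setP => x y t hx hy t0 t1 B [/[dup] /convex_setP cB cB' AB].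
by apply: cB => //; [exact: hx|exact: hy].
Qed.

Lemma conv_hull_id A : @convex_set R E A -> conv_hull A = A.
Proof. by move=> cA; rewrite /conv_hull smallest_id. Qed.

Lemma conv_hullU_join A B : @convex_set R E A -> @convex_set R E B ->
  A !=set0 -> B !=set0 ->
  conv_hull (A `|` B) =
    [set p.2 *: p.1.1 + (1 - p.2) *: p.1.2 | p in A `*` B `*` `[0, 1]].
Proof.
move=> cA cB [a0 Aa0] [b0 Bb0]; apply/seteqP; split.
- apply: smallest_sub.
  + apply/convex_setP; move: cA cB => /convex_setP cA /convex_setP cB.
    move=> x y t [[[a b] s] /= [[Aa Bb]]]; rewrite in_itv/= => /andP[s0 s1] <-
      [[[a' b'] s'] /= [[Aa' Bb']]]; rewrite in_itv/= => /andP[s'0 s'1] <- t0 t1.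
    have u0 : 0 <= 1 - t by rewrite subr_ge0.
    have comb (C : set E) (cC : forall z w (r : R), C z -> C w ->
        0 <= r -> r <= 1 -> C (r *: z + (1 - r) *: w)) (p q : R) (z w : E) :
        C z -> C w -> 0 <= p -> 0 <= q ->
        exists2 r, C r & p *: z + q *: w = (p + q) *: r.
      move=> Cz Cw p0 q0; have [pq|pq] := eqVneq (p + q) 0.
        exists z => //; move: pq => /eqP; rewrite paddr_eq0// => /andP[/eqP-> /eqP->].
        by rewrite addr0 !scale0r addr0.
      have pq0 : 0 < p + q by rewrite lt_neqAle eq_sym pq addr_ge0.
      exists ((p / (p + q)) *: z + (1 - p / (p + q)) *: w).
        apply: cC => //; first by rewrite divr_ge0// ltW.
        by rewrite ler_pdivrMr// mul1r lerDl.
      rewrite scalerDr !scalerA; congr (_ *: _ + _ *: _); first by field.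
      by field.
    have [|c Ac cE] := comb _ cA (t * s) ((1 - t) * s') _ _ Aa Aa' (mulr_ge0 t0 s0).
      exact: mulr_ge0.
    have [||d Bd dE] := comb _ cB (t * (1 - s)) ((1 - t) * (1 - s')) _ _ Bb Bb'.
      by rewrite mulr_ge0// subr_ge0.
      by rewrite mulr_ge0// subr_ge0.
    exists ((c, d), t * s + (1 - t) * s') => /=.
      split=> //; rewrite in_itv/= addr_ge0 ?mulr_ge0//=.
      rewrite (@le_trans _ _ (t * 1 + (1 - t) * 1))//; last by rewrite !mulr1 addrC subrK.
      by apply: lerD; apply: ler_wpM2l.
    rewrite -cE (_ : 1 - (t * s + (1 - t) * s')
      = t * (1 - s) + (1 - t) * (1 - s')); last by ring.
    by rewrite -dE !scalerDr !scalerA addrACA.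
  + move=> x [Ax|Bx].
      exists ((x, b0), 1) => /=; first by split=> //; rewrite in_itv/= ler01 lexx.
      by rewrite scale1r subrr scale0r addr0.
    exists ((a0, x), 0) => /=; first by split=> //; rewrite in_itv/= ler01 lexx.
    by rewrite scale0r subr0 scale1r add0r.
- move=> x [[[a b] s] /= [[Aa Bb]]]; rewrite in_itv/= => /andP[s0 s1] <-.
  by apply: (convex_setP _).1 => //; [exact: conv_hull_convex
    |by apply: sub_gen_smallest; left|by apply: sub_gen_smallest; right].
Qed.

Lemma conv_hullU_compact A B : compact A -> compact B ->
  @convex_set R E A -> @convex_set R E B -> compact (conv_hull (A `|` B)).
Proof.
move=> kA kB cA cB.
have [->|/set0P A0] := eqVneq A set0; first by rewrite set0U conv_hull_id.
have [->|/set0P B0] := eqVneq B set0; first by rewrite setU0 conv_hull_id.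
rewrite conv_hullU_join//; apply: continuous_compact; last first.
  by apply: compact_setX; [exact: compact_setX|exact: segment_compact].
apply: continuous_subspaceT => -[[a b] s] /=.
apply: (@cvgD _ E); apply: cvgZ.
- exact: cvg_snd.
- exact: (cvg_comp _ _ cvg_fst cvg_fst).
- by apply: cvgB; [exact: cvg_cst|exact: cvg_snd].
- exact: (cvg_comp _ _ cvg_fst cvg_snd).
Qed.

End convexity.

(* The carrier of the lattice C(E^n); the empty set is an element. *)
Record cconvex (R : realType) (n : nat) : Type := CConvex {
  cconvex_set :> set 'rV[R]_n ;
  cconvex_compact : compact cconvex_set ;
  cconvex_convex : @convex_set R 'rV[R]_n cconvex_set }.

Fact cconvex_display : Order.disp_t. Proof. exact: Order.Disp tt tt. Qed.

Section cconvex_lattice.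
Context (R : realType) (n : nat).
Local Notation T := (cconvex R n).
Implicit Types C D : T.

Lemma cconvex_inj : injective (@cconvex_set R n).
Proof.
move=> [A a a'] [B b b'] /= AB; subst B.
by congr CConvex; exact: Prop_irrelevance.
Qed.

HB.instance Definition _ := gen_eqMixin T.
HB.instance Definition _ := gen_choiceMixin T.

Definition cconvex_le C D : bool := `[< C `<=` D >].

Lemma cconvex_le_refl : reflexive cconvex_le.
Proof. by move=> C; apply/asboolP. Qed.

Lemma cconvex_le_anti : antisymmetric cconvex_le.
Proof.
by move=> C D /andP[/asboolP CD /asboolP DC]; apply/cconvex_inj/seteqP.
Qed.

Lemma cconvex_le_trans : transitive cconvex_le.
Proof.
by move=> D C F /asboolP CD /asboolP DF; apply/asboolP; exact: subset_trans DF.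
Qed.

HB.instance Definition _ := Order.Le_isPOrder.Build cconvex_display T
  cconvex_le_refl cconvex_le_anti cconvex_le_trans.

Lemma cconvex_meet_compact C D : compact (C `&` D).
Proof.
apply: (subclosed_compact _ (@cconvex_compact _ _ C)); last exact: subIsetl.
by apply: closedI; apply: compact_closed; try exact: norm_hausdorff;
  exact: cconvex_compact.
Qed.

Definition cconvex_meet C D : T := CConvex (@cconvex_meet_compact C D)
  (convex_set_setI (@cconvex_convex _ _ C) (@cconvex_convex _ _ D)).

Definition cconvex_join C D : T := CConvex
  (conv_hullU_compact (@cconvex_compact _ _ C) (@cconvex_compact _ _ D)
    (@cconvex_convex _ _ C) (@cconvex_convex _ _ D))
  (@conv_hull_convex R n (C `|` D)).

Lemma cconvex_lexI C D F :
  cconvex_le C (cconvex_meet D F) = cconvex_le C D && cconvex_le C F.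
Proof.
apply/asboolP/andP => /= [|[/asboolP CD /asboolP CF]]; last by rewrite subsetI.
by rewrite subsetI => -[CD CF]; split; apply/asboolP.
Qed.

Lemma cconvex_leUx C D F :
  cconvex_le (cconvex_join C D) F = cconvex_le C F && cconvex_le D F.
Proof.
apply/asboolP/andP => /= [CDF|[/asboolP CF /asboolP DF]].
  by split; apply/asboolP => x Cx; apply: CDF; apply: sub_gen_smallest;
    [left|right].
by apply: smallest_sub; [exact: cconvex_convex|rewrite subUset].
Qed.

HB.instance Definition _ := Order.POrder_MeetJoin_isLattice.Build
  cconvex_display T cconvex_lexI cconvex_leUx.

Definition cconvex0 : T := CConvex (@compact0 _) (@convex_set0 R n).

Definition cconvex1 (x : 'rV[R]_n) : T :=
  CConvex (@compact_set1 _ x) (@convex_set1 R n x).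

Lemma cconvex_meetE C D :
  cconvex_set (Order.meet C D) = C `&` D.
Proof. by []. Qed.

Lemma cconvex_joinE C D :
  cconvex_set (Order.join C D) = conv_hull (C `|` D).
Proof. by []. Qed.

End cconvex_lattice.
Arguments cconvex0 {R n}.

Definition lattice_hom d (T : latticeType d) d' (T' : latticeType d')
    (f : T -> T') : Prop :=
  Order.meet_morphism f /\ Order.join_morphism f.

Definition trivial_map (T T' : Type) (f : T -> T') : Prop :=
  exists K, forall x, f x = K.

Section affine.
Context (R : realType).

Definition hyperplane n (H : set 'rV[R]_n) : Prop :=
  exists (u : 'rV[R]_n) (b : R),
    u != 0 /\ H = [set y | \sum_i u 0 i * y 0 i = b].

Definition affine_map m n (f : 'rV[R]_m -> 'rV[R]_n) : Prop :=
  forall (t : R) x y, f ((1 - t) *: x + t *: y) = (1 - t) *: f x + t *: f y.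

Definition affine_bij m n (f : 'rV[R]_m -> 'rV[R]_n) (H : set 'rV[R]_n) : Prop :=
  affine_map f /\ set_bij [set: 'rV[R]_m] H f.

(* A translation by v maps H into H iff v lies in the direction space of H. *)
Definition parallel_to n (v : 'rV[R]_n) (H : set 'rV[R]_n) : Prop :=
  forall y, H y -> H (y + v).

End affine.

Definition exactly_one (P1 P2 P3 P4 : Prop) : Prop :=
  [\/ [/\ P1, ~ P2, ~ P3 & ~ P4], [/\ ~ P1, P2, ~ P3 & ~ P4],
      [/\ ~ P1, ~ P2, P3 & ~ P4] | [/\ ~ P1, ~ P2, ~ P3 & P4]].

Section cases.
Context (R : realType) (c : nat).
Variable Phi : cconvex R c -> cconvex R c.+1.
Variables (H : set 'rV[R]_c.+1) (phi : 'rV[R]_c -> 'rV[R]_c.+1).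

Definition union_of_points (C : cconvex R c) : set 'rV[R]_c.+1 :=
  \bigcup_(x in (C : set _)) (Phi (cconvex1 x) : set _).

(* The third component is a consequence of the first two. *)
Definition case_i : Prop :=
  forall (x : 'rV[R]_c) (C : cconvex R c),
    [/\ Phi (cconvex1 x) = [set phi x] :> set _,
        Phi C = union_of_points C :> set _ &
        Phi C = phi @` C :> set _].

Definition case_ii : Prop :=
  exists o : 'rV[R]_c.+1, [/\ ~ H o,
    Phi cconvex0 = [set o] :> set _ &
    forall (x : 'rV[R]_c) (C : cconvex R c), C !=set0 ->
      Phi (cconvex1 x) = segment (phi x) o :> set _ /\
      Phi C = union_of_points C :> set _].

Definition case_iii : Prop :=
  exists v : 'rV[R]_c.+1, ~ parallel_to v H /\
    forall (x : 'rV[R]_c) (C : cconvex R c),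
      Phi (cconvex1 x) = segment (phi x) (phi x + v) :> set _ /\
      Phi C = union_of_points C :> set _.

Definition case_iv : Prop :=
  exists (o : 'rV[R]_c.+1) (gamma : R), [/\ ~ H o, 0 < gamma < 1 &
    forall (x : 'rV[R]_c) (C : cconvex R c),
      Phi (cconvex1 x) =
        segment (phi x) (gamma *: phi x + (1 - gamma) *: o) :> set _ /\
      Phi C = union_of_points C :> set _].

End cases.

(* Main.v *)
(* Write F x for Phi {x} and S for Phi(empty).  For x <> y the sets F x and F y meet in S, and
   Radon's theorem carries over: an affine dependence among points of the sets F (w i)
   produces a point of the image of the common points of the two hulls of the w i.  Assume
   first that F is upper semicontinuous.  If S lies strictly below a hyperplane of E^(c+1),
   then, applying Radon's theorem to c + 2 points of that hyperplane, the set of the x with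
   F x strictly below it has convex complement.  Hence, for z between x and y, F z meets every
   segment joining F x to F y; and the set of such x, being open with convex complement and
   itself convex, is a half-space (or trivial), which makes F lower semicontinuous.  A general
   Phi is replaced by its upper semicontinuous envelope, and the lower semicontinuity of the
   latter shows that it agrees with Phi on points.

   Radon's theorem in codimension 2 then shows that F x is contained in a line.  If S is not
   empty it is a point o and F x is a segment ending at o.  If S is empty, either all the F x
   are points, or the lines spanned by the F x are distinct and pairwise coplanar, hence, as
   c >= 3, all concurrent or all parallel.  In each case the ends of F x preserve betweenness,
   are continuous and injective, and so are affine in x.  Finally a positive affine function
   is constant, which makes the far and near ends differ by a homothety or a translation. *)
Require Import Defs.
From mathcomp Require Import all_boot all_order all_algebra.
From mathcomp Require Import all_classical all_reals all_analysis.
From mathcomp Require Import ring lra.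

Set Implicit Arguments.
Unset Strict Implicit.
Unset Printing Implicit Defensive.

Import Order.TTheory GRing.Theory Num.Theory.
Import numFieldNormedType.Exports.

Local Open Scope classical_set_scope.
Local Open Scope ring_scope.

(** * Separation of convex sets *)

(** Only finite meets and joins are preserved, so no continuity is given and every topological fact
    comes from a dimension count. The target has one spare dimension: [c + 2] points of a hyperplane
    of E^(c+1) are affinely dependent, and so are [c + 1] points of a subspace of codimension 2. In
    the second case the source points can be chosen affinely independent, so the Radon point falls
    into S. In the first they cannot, and Radon's theorem alone does not tell which point of E^c it
    returns. The directions [config] remove this obstacle: whatever positive lengths are taken along
    them, the Radon point is the starting point z. The lengths must stay arbitrary because they come
    from a supremum ([below_boundary]), and that supremum argument is what requires upper
    semicontinuity, hence the detour through the envelope.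

    Betweenness yields affinity through parallelism: a functional with equal values at the ends of a
    segment has equal values at the ends of its translates. Independent directions then add, and
    real scaling follows by the archimedean property. *)

Ltac vec := apply/rowP=> ?; rewrite !mxE; ring.

(* [lra] fails on hypotheses that are equations between row vectors. *)
Ltac slra := repeat match goal with
  | H : @eq ?T _ _ |- _ => lazymatch eval hnf in T with matrix _ _ _ => clear H end
  | H : ~ @eq ?T _ _ |- _ => lazymatch eval hnf in T with matrix _ _ _ => clear H end
  end; lra.

Section dot.
Context {R : realType} {n : nat}.
Local Notation E := 'rV[R]_n.
Implicit Types u v x y : E.

Definition dot u x : R := \sum_i u 0 i * x 0 i.

Lemma dotC u x : dot u x = dot x u.
Proof. by apply: eq_bigr => i _; rewrite mulrC. Qed.

Lemma dotDr u x y : dot u (x + y) = dot u x + dot u y.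
Proof. by rewrite /dot -big_split; apply: eq_bigr => i _; rewrite mxE mulrDr. Qed.

Lemma dotZr u t x : dot u (t *: x) = t * dot u x.
Proof. by rewrite /dot big_distrr; apply: eq_bigr => i _; rewrite mxE mulrCA. Qed.

Lemma dotNr u x : dot u (- x) = - dot u x.
Proof. by rewrite -scaleN1r dotZr mulN1r. Qed.

Lemma dotBr u x y : dot u (x - y) = dot u x - dot u y.
Proof. by rewrite dotDr dotNr. Qed.

Lemma dot0r u : dot u 0 = 0.
Proof. by rewrite -(scale0r 0) dotZr mul0r. Qed.

Lemma dotDl u v x : dot (u + v) x = dot u x + dot v x.
Proof. by rewrite dotC dotDr !(dotC x). Qed.

Lemma dotZl t u x : dot (t *: u) x = t * dot u x.
Proof. by rewrite dotC dotZr dotC. Qed.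

Lemma dotNl u x : dot (- u) x = - dot u x.
Proof. by rewrite dotC dotNr dotC. Qed.

Lemma dotBl u v x : dot (u - v) x = dot u x - dot v x.
Proof. by rewrite dotDl dotNl. Qed.

Lemma dot_sumr u (I : finType) (P : pred I) (f : I -> E) :
  dot u (\sum_(i | P i) f i) = \sum_(i | P i) dot u (f i).
Proof. by apply: (big_morph _ (dotDr u) (dot0r u)). Qed.

Lemma dot_ge0 x : 0 <= dot x x.
Proof. by apply: sumr_ge0 => i _; rewrite -expr2 sqr_ge0. Qed.

Lemma dot_eq0 x : (dot x x == 0) = (x == 0).
Proof.
apply/idP/eqP => [|->]; last by rewrite dot0r.
rewrite /dot psumr_eq0 => [/allP x0|i _]; last by rewrite -expr2 sqr_ge0.
apply/rowP => i; rewrite mxE; apply/eqP.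
by have := x0 i (mem_index_enum _); rewrite /= -expr2 sqrf_eq0.
Qed.

Lemma dot_gt0 x : x != 0 -> 0 < dot x x.
Proof. by move=> x0; rewrite lt_neqAle eq_sym dot_eq0 x0 dot_ge0. Qed.

Lemma dot_sqrD x y t :
  dot (x + t *: y) (x + t *: y) = dot x x + 2 * t * dot x y + t ^+ 2 * dot y y.
Proof. by rewrite dotDr !dotDl !dotZr !dotZl (dotC y x); ring. Qed.

Lemma coord_le_norm x i : `|x 0 i| <= `|x|.
Proof.
rewrite [leRHS]/Num.norm /= mx_normrE; apply/bigmax_geP; right => /=.
by exists (0, i).
Qed.

Lemma row_norm_le x (r : R) : 0 <= r -> (forall i, `|x 0 i| <= r) -> `|x| <= r.
Proof.
move=> r0 xr; rewrite [leLHS]/Num.norm /= mx_normrE; apply/bigmax_leP; split=> //.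
by move=> [j i] _ /=; rewrite ord1; exact: xr.
Qed.

(** The norm is the sup norm, whence the factor [n]. *)
Lemma dot_le u x : `|dot u x| <= n%:R * `|u| * `|x|.
Proof.
apply: le_trans (ler_norm_sum _ _ _) _.
rewrite -mulrA mulr_natl -[X in _ *+ X]card_ord -sumr_const; apply: ler_sum => i _.
by rewrite normrM ler_pM// coord_le_norm.
Qed.

Lemma norm2_le_dot x : `|x| ^+ 2 <= dot x x.
Proof.
have [->|x0] := eqVneq x 0; first by rewrite normr0 expr0n dot0r.
have : `|x| <= Num.sqrt (dot x x).
  apply: row_norm_le => [|i]; first exact: sqrtr_ge0.
  rewrite -sqrtr_sqr ler_wsqrtr// /dot (bigD1 i)//= -expr2 lerDl.
  by apply: sumr_ge0 => j _; rewrite -expr2 sqr_ge0.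
rewrite -(ler_pXn2r (_ : (0 < 2)%N)) ?nnegrE ?sqrtr_ge0//.
by rewrite sqr_sqrtr ?dot_ge0.
Qed.

Lemma dot_continuous u : continuous (dot u).
Proof.
move=> x; rewrite /continuous_at /dot.
apply: (@cvg_big R 'I_n +%R 0 xpredT (@add_continuous R) E (nbhs x) _ (fun i y => u 0 i * y 0
  i) (fun i => u 0 i * x 0 i)) => i _.
by apply: cvgM; [exact: cvg_cst|exact: coord_continuous].
Qed.

Lemma dot_self_continuous : continuous (fun x => dot x x).
Proof.
move=> x; rewrite /continuous_at /dot.
apply: (@cvg_big R 'I_n +%R 0 xpredT (@add_continuous R) E (nbhs x) _ (fun i y => y 0 i * y 0
  i) (fun i => x 0 i * x 0 i)) => i _.
by apply: cvgM; exact: coord_continuous.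
Qed.

Lemma open_dot_lt u a : open [set x | dot u x < a].
Proof.
rewrite (_ : mkset _ = dot u @^-1` [set t | t < a])//.
by apply: open_comp => [x _|]; [exact: dot_continuous|exact: open_lt].
Qed.

Lemma open_dot_gt u a : open [set x | a < dot u x].
Proof.
rewrite (_ : mkset _ = dot u @^-1` [set t | a < t])//.
by apply: open_comp => [x _|]; [exact: dot_continuous|exact: open_gt].
Qed.

(** The component of [w] orthogonal to [v], rescaled. It turns non-collinearity into a functional
    that is constant on a line and differs at a point off it. *)
Lemma dual_vector v w : (forall k, w <> k *: v) ->
  exists u, dot u v = 0 /\ dot u w = 1.
Proof.
move=> vw; pose u := w - (dot w v / dot v v) *: v.
have uv : dot u v = 0.
  rewrite dotBl dotZl; have [->|v0] := eqVneq v 0; first by rewrite !dot0r; ring.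
  by rewrite divfK ?dot_eq0// subrr.
have u0 : u != 0 by apply/eqP => /eqP; rewrite subr_eq0 => /eqP; exact: vw.
have uw : dot u w = dot u u by rewrite [in RHS]/u dotBr dotZr uv mulr0 subr0.
exists ((dot u u)^-1 *: u); rewrite !dotZl uv uw mulr0.
by rewrite mulVf ?dot_eq0.
Qed.

End dot.

Section convex.
Context {R : realType} {n : nat}.
Local Notation E := 'rV[R]_n.
Implicit Types (A B K : set E) (u x y : E).

Definition conv_closed A := forall x y (t : R), A x -> A y -> 0 <= t -> t <= 1 ->
  A (t *: x + (1 - t) *: y).

Lemma convP A : convex_set A <-> conv_closed A.
Proof. exact: convex_setP. Qed.

Lemma conv_dot_lt u a : conv_closed [set x | dot u x < a].
Proof.
move=> x y t /= xa ya t0 t1; rewrite dotDr !dotZr.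
have [->|t'] := eqVneq t 0; first by rewrite mul0r add0r subr0 mul1r.
have : t * dot u x < t * a by rewrite ltr_pM2l// lt_neqAle eq_sym t' t0.
have : (1 - t) * dot u y <= (1 - t) * a by rewrite ler_wpM2l ?subr_ge0// ltW.
by lra.
Qed.

Lemma conv_dot_gt u a : conv_closed [set x | a < dot u x].
Proof.
move=> x y t /= xa ya t0 t1.
have := @conv_dot_lt (- u) (- a) x y t; rewrite /= !dotNl !ltrN2; exact.
Qed.

Lemma conv_comb (I : finType) (P : pred I) K (l : I -> R) (p : I -> E) :
  conv_closed K -> (forall i, P i -> 0 <= l i) -> \sum_(i | P i) l i = 1 ->
  (forall i, P i -> K (p i)) -> K (\sum_(i | P i) l i *: p i).
Proof.
move=> cK l0 l1 Kp.
(* Normalised partial sums make the claim inductive over lists; a tail of total weight zero cannot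
   be normalised and is treated apart. *)
suff H s : (forall i, i \in s -> P i) -> 0 < \sum_(i <- s) l i ->
    K ((\sum_(i <- s) l i)^-1 *: \sum_(i <- s) l i *: p i).
  have := H (enum P); rewrite !big_enum l1 invr1 scale1r; apply => //.
  by move=> i; rewrite mem_enum.
elim: s => [|i s IH] Ps; first by rewrite big_nil ltxx.
rewrite !big_cons; set L := \sum_(_ <- s) _; set V := \sum_(_ <- s) _ => L0.
have Pi : P i by apply: Ps; rewrite inE eqxx.
have {}Ps j : j \in s -> P j by move=> js; apply: Ps; rewrite inE js orbT.
have Lge0 : 0 <= L by rewrite /L big_seq sumr_ge0// => j /Ps/l0.
have [L0'|L0'] := eqVneq L 0.
  have V0 : V = 0.
    rewrite /V big_seq big1 // => j js; move/eqP: L0'.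
    rewrite /L big_seq psumr_eq0 => [|k /Ps/l0//].
    move=> /allP /(_ j js); rewrite js/= => /eqP ->; by rewrite scale0r.
  rewrite L0' V0 !addr0 scalerA mulVf ?scale1r; first exact: Kp.
  by move: L0; rewrite L0' addr0 => /gt_eqF ->.
have Lp : 0 < L by rewrite lt_neqAle eq_sym L0' Lge0.
have := cK _ _ (l i / (l i + L)) (Kp i Pi) (IH Ps Lp).
have -> : (l i / (l i + L)) *: p i + (1 - l i / (l i + L)) *: (L^-1 *: V) =
   (l i + L)^-1 *: (l i *: p i + V).
  have ? : l i + L != 0 by rewrite gt_eqF.
  by apply/rowP => k; rewrite !mxE; field; apply/andP.
apply; first by rewrite divr_ge0 ?l0 // ltW.
by rewrite ler_pdivrMr// mul1r lerDl.
Qed.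

Lemma conv_dot_eq u a x y (t : R) : dot u x = a -> dot u y = a ->
  dot u (t *: x + (1 - t) *: y) = a.
Proof. by move=> xa ya; rewrite dotDr !dotZr xa ya; ring. Qed.

(* The nearest point of [A] to [q]. *)
Lemma closed_convex_proj A q : closed A -> conv_closed A -> A !=set0 ->
  exists2 y, A y & forall x, A x -> 0 <= dot (y - q) (x - y).
Proof.
move=> clA cA [a0 Aa0]; pose d x := dot (x - q) (x - q).
have dc : continuous d.
  move=> x; apply: (@continuous_comp _ _ _ (fun x => x - q) (fun x => dot x x) x).
    by apply: continuousB => //; exact: cst_continuous.
  exact: dot_self_continuous.
(* [A] may be unbounded; this sublevel set is compact and contains every candidate for the
   minimum. *)
pose B := A `&` [set x | d x <= d a0].
have cB : compact B.
  apply: bounded_closed_compact; last first.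
    apply: closedI => //; rewrite (_ : mkset _ = d @^-1` [set t | t <= d a0])//.
    by apply: closed_comp => [x _|]; [exact: dc|exact: closed_le].
  exists (1 + d a0 + `|q|); split; first exact: num_real.
  move=> M hM x [_ /= hx]; apply: le_trans (ltW hM).
  have : `|x - q| <= 1 + d a0.
    have := norm2_le_dot (x - q); rewrite -/(d x) => h1.
    have [h|h] := leP `|x - q| 1; first by have := dot_ge0 (a0 - q); rewrite -/(d a0); lra.
    have : `|x - q| <= `|x - q| ^+ 2 by rewrite expr2 ler_peMl// ltW.
    by lra.
  have := ler_normD (x - q) q; rewrite subrK; lra.
have [||y /set_mem[Ay yd] miny] := @compact_EVT_min _ _ d B _ cB.
- by exists a0; split => /=.
- exact: continuous_subspaceT.
exists y => // x Ax.
rewrite leNgt; apply/negP => neg.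
set D := x - y; set e := y - q in neg *.
(* The gain in squared distance when moving from [y] towards [x]. A negative linear coefficient is
   refuted at the vertex [- b / a] of this parabola, or at [t = 1] when the vertex is not inside. *)
have h t : 0 <= t -> t <= 1 -> 0 <= 2 * t * dot e D + t ^+ 2 * dot D D.
  move=> t0 t1; have Az : A (t *: x + (1 - t) *: y) by exact: cA.
  have : d y <= d (t *: x + (1 - t) *: y).
    have [zd|zd] := leP (d (t *: x + (1 - t) *: y)) (d a0).
      by apply: miny; apply/mem_set; split.
    by move: yd => /=; lra.
  rewrite /d (_ : t *: x + (1 - t) *: y - q = e + t *: D); last by rewrite /e /D; vec.
  by rewrite -/e dot_sqrD; lra.
have D0 := dot_ge0 D.
set b := dot e D in neg h; set a := dot D D in D0 h.
have [ab|ab] := leP a (- b).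
  by have := h 1 ler01 (lexx _); rewrite expr1n; lra.
have ap : 0 < a by lra.
have := h (- b / a); rewrite divr_ge0 ?ler_pdivrMr ?mul1r; try lra.
move=> /(_ isT) /(_ (ltW ab)).
have -> : 2 * (- b / a) * b + (- b / a) ^+ 2 * a = - (b ^+ 2 / a) by field; lra.
have : 0 < b ^+ 2 / a by rewrite divr_gt0// exprn_even_gt0//=; lra.
lra.
Qed.

(** For nonempty [A] the hyperplane is the perpendicular bisector of [q] and its nearest point in
    [A]. *)
Lemma sep_point A q : closed A -> conv_closed A -> ~ A q ->
  exists u a, (forall x, A x -> dot u x < a) /\ a < dot u q.
Proof.
move=> clA cA nAq; have [A0|/set0P A0] := eqVneq A set0.
  exists 0, (-1); split; first by rewrite A0.
  by rewrite dotC dot0r; lra.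
have [y Ay hy] := closed_convex_proj q clA cA A0.
have yq : 0 < dot (q - y) (q - y).
  by apply: dot_gt0; rewrite subr_eq0; apply/eqP => qy; apply: nAq; rewrite qy.
exists (q - y), (dot (q - y) y + dot (q - y) (q - y) / 2); split => [x /hy|].
  rewrite -opprB dotNl dotBr; lra.
have : dot (q - y) q = dot (q - y) y + dot (q - y) (q - y).
  by rewrite -dotDr addrCA subrr addr0.
lra.
Qed.

Lemma compact_dot_max A u : compact A -> A !=set0 ->
  exists2 a, A a & forall x, A x -> dot u x <= dot u a.
Proof.
move=> kA A0; have [|a /set_mem Aa ha] := @compact_EVT_max _ _ (dot u) A A0 kA.
  by apply: continuous_subspaceT; exact: dot_continuous.
by exists a => // x Ax; apply: ha; exact: mem_set.
Qed.

(** Separating 0 from the difference set [A - B] leaves a gap [- al] between the values on [A] and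
    on [B]; the threshold sits half a gap above the maximum over [A]. *)
Lemma sep_sets A B : compact A -> compact B -> conv_closed A -> conv_closed B ->
  A `&` B = set0 ->
  exists u a, (forall x, A x -> dot u x < a) /\ (forall x, B x -> a < dot u x).
Proof.
move=> kA kB cA cB AB.
have [A0|/set0P A0] := eqVneq A set0.
  have [B0|/set0P B0] := eqVneq B set0; first by exists 0, 0; split; rewrite ?A0 ?B0.
  have [b Bb hb] := compact_dot_max 0 kB B0.
  by exists 0, (-1); split=> [x|x _]; [rewrite A0|rewrite dotC dot0r ltrN10].
pose D := [set p.1 - p.2 | p in A `*` B].
have kD : compact D.
  apply: continuous_compact; last exact: compact_setX.
  apply: continuous_subspaceT => p; apply: (@cvgB _ E); [exact: cvg_fst|exact: cvg_snd].
have cD : conv_closed D.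
  move=> _ _ t [[a b] /= [Aa Bb] <-] [[a' b'] /= [Aa' Bb'] <-] t0 t1.
  exists (t *: a + (1 - t) *: a', t *: b + (1 - t) *: b') => /=.
    by split; [exact: cA|exact: cB].
  vec.
have nD : ~ D 0.
  move=> [[a b] /= [Aa Bb] /eqP]; rewrite subr_eq0 => /eqP ab.
  suff: (A `&` B) a by rewrite AB.
  by split=> //; rewrite ab.
have [u [al [h1 h2]]] := sep_point (compact_closed (@norm_hausdorff _ _) kD) cD nD.
rewrite dot0r in h2.
have [a Aa ha] := compact_dot_max u kA A0.
exists u, (dot u a - al / 2); split => [x /ha|x Bx]; first lra.
have /h1 : D (a - x) by exists (a, x).
rewrite dotBr; lra.
Qed.

End convex.

Section halfspace.
Context {R : realType} {n : nat}.
Local Notation E := 'rV[R]_n.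

Lemma ball_nbhs (x : E) (P : set E) :
  (\forall y \near x, P y) <-> (exists2 e : R, 0 < e & forall y, `|y - x| < e -> P y).
Proof.
split.
  move=> /nbhs_ballP[e /= e0 h]; exists e => // y xy; apply: h.
  by rewrite -ball_normE /= distrC.
move=> [e e0 h]; apply/nbhs_ballP; exists e => // y.
by rewrite -ball_normE /= distrC; exact: h.
Qed.

Lemma open_ball_sub (Q : set E) x : open Q -> Q x ->
  exists2 e : R, 0 < e & forall y, `|y - x| < e -> Q y.
Proof. by move=> oQ Qx; apply/ball_nbhs; exact: open_nbhs_nbhs. Qed.

(** Let [y] be the point of the complement nearest to [q]. The open half-space on the side of [q]
    through [y] lies in [Q]. A point [w] of [Q] not in it could be pushed to a point [w'] of [Q]
    strictly beyond [y]; its reflection in [y] also lies in [Q], hence so does the midpoint [y]. *)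
Lemma open_convex_halfspace (Q : set E) : open Q -> conv_closed Q ->
  conv_closed (~` Q) -> Q !=set0 -> ~` Q !=set0 ->
  exists l b, l != 0 /\ Q = [set x | dot l x < b].
Proof.
move=> oQ cQ cQ' [q Qq] Q0'.
have [y Qy hy] := closed_convex_proj q (open_closedC oQ) cQ' Q0'.
set l := y - q in hy.
have l0 : l != 0 by rewrite subr_eq0; apply/eqP => yq; apply: Qy; rewrite yq.
have lt_in x : dot l x < dot l y -> Q x.
  by move=> xy; apply: contrapT => /hy; rewrite dotBr; lra.
exists l, (dot l y); split=> //; apply/seteqP; split=> [w Qw|]; last exact: lt_in.
rewrite /= ltNge; apply/negP => yw.
have [e e0 he] := open_ball_sub oQ Qw.
pose s := e / (2 * `|l|).
have nl : 0 < `|l| by rewrite normr_gt0.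
have s0 : 0 < s by rewrite divr_gt0// mulr_gt0.
have Qw' : Q (w + s *: l).
  apply: he; rewrite addrC addKr normrZ gtr0_norm// /s.
  have -> : e / (2 * `|l|) * `|l| = e / 2 by field; lra.
  lra.
set w' := w + s *: l in Qw'.
have Qv : Q (2 *: y - w').
  apply: lt_in; rewrite dotBr dotZr /w' dotDr dotZr.
  by have := dot_gt0 l0; rewrite -(pmulr_rgt0 _ s0); lra.
apply: Qy; have := cQ _ _ (1/2) Qw' Qv; rewrite (_ : _ + _ = y); last by apply/rowP => i;
  rewrite !mxE; field.
by apply; lra.
Qed.

End halfspace.

(** * Affine dependence by rank counting *)

Section linear_dependence.
Context {R : realType}.

Definition indep k (v w : 'rV[R]_k) := forall a b : R,
  a *: v + b *: w = 0 -> a = 0 /\ b = 0.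

Lemma indepC k (v w : 'rV[R]_k) : indep v w -> indep w v.
Proof. by move=> vw a b; rewrite addrC => /vw[]. Qed.

Lemma indepP k (v w : 'rV[R]_k) : v != 0 -> (forall a, w <> a *: v) -> indep v w.
Proof.
move=> v0 vw a b; have [->|b0] := eqVneq b 0.
  by rewrite scale0r addr0 => /eqP; rewrite scaler_eq0 (negbTE v0) orbF => /eqP.
move=> ab; exfalso; apply: (vw (- (a / b))).
apply/(scalerI b0)/eqP; rewrite -subr_eq0 scalerA mulrN mulrCA divff// mulr1.
by rewrite scaleNr opprK addrC ab.
Qed.

Lemma dot_mx d (u x : 'rV[R]_d) : x *m u^T = (dot u x)%:M.
Proof.
apply/rowP => i; rewrite !mxE ord1 eqxx mulr1n; apply: eq_bigr => j _.
by rewrite mxE mulrC.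
Qed.

(** With a leading coordinate 1 the points become the rows of [A], annihilated by [B] of rank at
    least [k]. So [A] has rank at most [d + 1 - k], less than its number of rows, and a left kernel
    vector is the dependence. *)
Lemma affine_dep d k (I : finType) (p : I -> 'rV[R]_d) (U : 'M[R]_(k, d))
    (a : 'rV[R]_k) :
  row_free U -> (forall i, p i *m U^T = a) -> (d.+1 < #|I| + k)%N ->
  exists m : I -> R,
    [/\ exists i, m i != 0, \sum_i m i = 0 & \sum_i m i *: p i = 0].
Proof.
move=> fU pU lt_d.
pose A := \matrix_(i < #|I|) row_mx (1 : 'M[R]_1) (p (enum_val i)).
pose B := col_mx (- a) U^T.
have AB : A *m B = 0.
  apply/row_matrixP => i; rewrite row_mul rowK row0 mul_row_col mul1mx pU.
  by rewrite addNr.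
have rB : (k <= \rank B)%N.
  move: fU; rewrite /row_free => /eqP {1}<-; rewrite -mxrank_tr.
  by have := submx_refl B; rewrite {1}/B col_mx_sub => /andP[_ /mxrankS].
have : kermx A != 0.
  rewrite kermx_eq0 /row_free; apply/negP => /eqP rA.
  have := mulmx0_rank_max AB; rewrite rA => h.
  have := leq_trans (leq_add (leqnn #|I|) rB) h.
  by rewrite leqNgt lt_d.
move=> /rowV0Pn[v /sub_kermxP vA v0].
exists (fun i => v 0 (enum_rank i)).
have reidx (T : zmodType) (f : 'I_#|I| -> T) : \sum_i f (enum_rank i) = \sum_j f j.
  rewrite [RHS](reindex (@enum_rank I)) //.
  by exists (@enum_val I I) => i _; [exact: enum_rankK|exact: enum_valK].
have entry j : \sum_i v 0 i * A i j = 0.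
  by move/rowP: vA => /(_ j); rewrite !mxE.
split.
- have /rV0Pn[j vj] := v0; exists (enum_val j); by rewrite enum_valK.
- rewrite (reidx R (fun j => v 0 j)) -[RHS](entry (lshift d 0)).
  by apply: eq_bigr => i _; rewrite mxE row_mxEl mxE eqxx mulr1.
- rewrite (eq_bigr (fun i => v 0 (enum_rank i) *: p (enum_val (enum_rank i)))).
    rewrite (reidx _ (fun j => v 0 j *: p (enum_val j))).
    apply/rowP => j; rewrite summxE mxE -[RHS](entry (rshift 1 j)).
    by apply: eq_bigr => i _; rewrite [in LHS]mxE [in RHS]mxE row_mxEr.
  by move=> i _; rewrite enum_rankK.
Qed.

Lemma kernel_vector n k (U : 'M[R]_(k, n)) : (k < n)%N ->
  exists2 e : 'rV[R]_n, e != 0 & e *m U^T = 0.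
Proof.
move=> kn; have : kermx U^T != 0.
  rewrite kermx_eq0 /row_free neq_ltn; apply/orP; left.
  by rewrite (leq_ltn_trans _ kn)// rank_leq_col.
by move=> /rowV0Pn[e /sub_kermxP eU e0]; exists e.
Qed.

Lemma orthogonal_vector2 n (l m : 'rV[R]_n) : (2 < n)%N ->
  exists e : 'rV[R]_n, [/\ e != 0, dot l e = 0 & dot m e = 0].
Proof.
move=> n2; have [|e e0] := @kernel_vector n (1 + 1) (col_mx l m); first by [].
rewrite tr_col_mx mul_mx_row !dot_mx => /eqP; rewrite row_mx_eq0 => /andP[].
have inj0 (x : R) : (x%:M == (0 : 'M[R]_1)) -> x = 0.
  by move=> /eqP/rowP/(_ 0); rewrite !mxE eqxx.
by move=> /inj0 h1 /inj0 h2; exists e.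
Qed.

Lemma orthogonal_vector n (l : 'rV[R]_n) : (1 < n)%N -> exists2 e, e != 0 & dot l e = 0.
Proof.
move=> n1; have [e e0] := kernel_vector l n1; rewrite dot_mx => /rowP/(_ 0).
by rewrite !mxE eqxx mulr1n => le; exists e.
Qed.

Lemma hyperplane_dep d (I : finType) (p : I -> 'rV[R]_d) u a : u != 0 ->
  (forall i, dot u (p i) = a) -> (d < #|I|)%N ->
  exists m : I -> R,
    [/\ exists i, m i != 0, \sum_i m i = 0 & \sum_i m i *: p i = 0].
Proof.
move=> u0 pu dI; apply: (@affine_dep _ 1 _ _ u a%:M).
- by rewrite /row_free rank_rV u0.
- by move=> i; rewrite dot_mx pu.
- by rewrite addn1.
Qed.

Lemma codim2_dep d (I : finType) (p : I -> 'rV[R]_d) u v a b :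
  (forall s t, s *: u + t *: v = 0 -> s = 0 /\ t = 0) ->
  (forall i, dot u (p i) = a /\ dot v (p i) = b) -> (d <= #|I|)%N ->
  exists m : I -> R,
    [/\ exists i, m i != 0, \sum_i m i = 0 & \sum_i m i *: p i = 0].
Proof.
move=> uv puv dI; apply: (@affine_dep _ (1 + 1) _ _ (col_mx u v) (row_mx a%:M b%:M)).
- apply: inj_row_free => w; rewrite -[w]hsubmxK mul_row_col.
  rewrite [lsubmx w]mx11_scalar [rsubmx w]mx11_scalar !mul_scalar_mx.
  by move=> /uv[-> ->]; rewrite raddf0 row_mx0.
- by move=> i; rewrite tr_col_mx mul_mx_row !dot_mx; have [-> ->] := puv i.
- by rewrite addn2 ltnS.
Qed.

Lemma plane_dep d (I : finType) (p : I -> 'rV[R]_d) o v w (s t : I -> R) :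
  (forall i, p i = o + s i *: v + t i *: w) -> (3 < #|I|)%N ->
  exists m : I -> R,
    [/\ exists i, m i != 0, \sum_i m i = 0 & \sum_i m i *: p i = 0].
Proof.
move=> pE I3.
have [|||m [m0 m1 m2]] := @affine_dep (1 + 1) 0 I (fun i => row_mx (s i)%:M (t i)%:M) 0 0.
- by rewrite /row_free mxrank0.
- by move=> i; apply/rowP => -[].
- by rewrite addn0.
exists m; split=> //.
have ms : \sum_i m i * s i = 0.
  move/rowP: m2 => /(_ (lshift 1 (0 : 'I_1))); rewrite summxE mxE => h; rewrite -[RHS]h.
  by apply: eq_bigr => i _; rewrite mxE row_mxEl mxE eqxx.
have mt : \sum_i m i * t i = 0.
  move/rowP: m2 => /(_ (rshift 1 (0 : 'I_1))); rewrite summxE mxE => h; rewrite -[RHS]h.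
  by apply: eq_bigr => i _; rewrite mxE row_mxEr mxE eqxx.
rewrite (eq_bigr (fun i => m i *: o + (m i * s i) *: v + (m i * t i) *: w)).
  by rewrite !big_split /= -!scaler_suml m1 ms mt !scale0r !addr0.
by move=> i _; rewrite pE !scalerDr !scalerA.
Qed.
End linear_dependence.

(** * Consequences of the homomorphism property *)

Lemma sum_unit (T : zmodType) (I : finType) (f : I + unit -> T) :
  \sum_o f o = \sum_i f (inl i) + f (inr tt).
Proof.
rewrite big_sumType /=; congr (_ + _).
by rewrite (bigD1 tt)//= big1 ?addr0// => -[].
Qed.

Section finite_hulls.
Context {R : realType} {n : nat}.
Local Notation E := 'rV[R]_n.
Implicit Types (C D : cconvex R n) (K : set E).

Lemma cconvex_conv C : conv_closed C.
Proof. by apply/convP; exact: cconvex_convex. Qed.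

Lemma cconvex_closed C : closed C.
Proof. by apply: compact_closed; [exact: norm_hausdorff|exact: cconvex_compact]. Qed.

Lemma cconvex_bounded C : exists2 M : R, 0 < M & forall x, cconvex_set C x -> `|x| <= M.
Proof.
have [M [_ hM]] := compact_bounded (@cconvex_compact _ _ C).
exists (`|M| + 1) => [|x Cx]; first by rewrite ltr_wpDl.
by apply: hM => //; rewrite (le_lt_trans (ler_norm _))// ltrDl.
Qed.

Lemma join_subl C D : C `<=` (Order.join C D : cconvex R n).
Proof. by move=> x Cx; apply: sub_gen_smallest; left. Qed.

Lemma join_subr C D : D `<=` (Order.join C D : cconvex R n).
Proof. by move=> x Cx; apply: sub_gen_smallest; right. Qed.

Lemma join_sub C D K : conv_closed K -> C `<=` K -> D `<=` K ->
  (Order.join C D : cconvex R n) `<=` K.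
Proof.
by move=> cK CK DK; apply: smallest_sub; [exact/convP|rewrite subUset].
Qed.

(** Built from joins of points, so that a homomorphism can be pushed through it one point at a
    time. *)
Definition fhull (I : finType) (P : pred I) (w : I -> E) : cconvex R n :=
  foldr (fun i C => Order.join (cconvex1 (w i)) C) cconvex0 (enum P).

Lemma fhull_mem (I : finType) (P : pred I) (w : I -> E) i : P i -> cconvex_set (fhull P w) (w i).
Proof.
rewrite /fhull => Pi; have : i \in enum P by rewrite mem_enum.
elim: (enum P) => // j s IH; rewrite inE => /orP[/eqP <-|/IH h].
  exact: (@join_subl (cconvex1 _) _ _ erefl).
exact: (@join_subr (cconvex1 _) (foldr _ _ _)).
Qed.

Lemma fhull_sub (I : finType) (P : pred I) (w : I -> E) K : conv_closed K ->
  (forall i, P i -> K (w i)) -> fhull P w `<=` K.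
Proof.
move=> cK Kw; rewrite /fhull.
have : forall i, i \in enum P -> P i by move=> i; rewrite mem_enum.
elim: (enum P) => [|j s IH Ps]; first by move=> _ x; case.
apply: (@join_sub (cconvex1 (w j)) (foldr _ _ s)) => //.
  by move=> _ ->; apply/Kw/Ps; rewrite inE eqxx.
by apply: IH => i si; apply: Ps; rewrite inE si orbT.
Qed.

Lemma fhull_comb (I : finType) (P : pred I) (w : I -> E) v :
  cconvex_set (fhull P w) v ->
  exists l : I -> R, [/\ forall i, 0 <= l i, forall i, ~~ P i -> l i = 0,
    \sum_i l i = 1 & v = \sum_i l i *: w i].
Proof.
suff: fhull P w `<=` [set v | exists l : I -> R,
  [/\ forall i, 0 <= l i, forall i, ~~ P i -> l i = 0,
    \sum_i l i = 1 & v = \sum_i l i *: w i]] by exact.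
apply: fhull_sub => [x y t [l [l0 lP l1 ->]] [m [m0 mP m1 ->]] t0 t1|i Pi].
  exists (fun i => t * l i + (1 - t) * m i); split=> [i|i Pi||].
  - by rewrite addr_ge0// mulr_ge0// subr_ge0.
  - by rewrite lP// mP// !mulr0 addr0.
  - by rewrite big_split /= -!mulr_sumr l1 m1; ring.
  - rewrite !scaler_sumr -big_split; apply: eq_bigr => i _ /=.
    by rewrite !scalerA -scalerDl.
exists (fun j => (j == i)%:R); split=> [j|j Pj||].
- by rewrite ler0n.
- by have [ji|//] := eqVneq j i; rewrite ji Pi in Pj.
- by (rewrite (bigD1 i)//= eqxx big1 ?addr0// => j /negbTE ->).
- by rewrite (bigD1 i)//= eqxx scale1r big1 ?addr0// => j /negbTE ->; rewrite scale0r.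
Qed.

(* The hull of the [2 n + 1] points [0] and [+- (n + 1) M e_j] contains the cube
   of radius [M]. *)
Lemma compact_sub_fhull C : exists (I : finType) (w : I -> E), C `<=` fhull xpredT w.
Proof.
have [M M0 CM] := cconvex_bounded C.
pose w (o : 'I_n * bool + unit) : E :=
  if o is inl (j, b) then ((-1) ^+ b * (n.+1%:R * M)) *: delta_mx 0 j else 0.
exists ('I_n * bool + unit)%type, w => x /CM xM.
(* Each pair of opposite points and the origin get total weight [1 / (n + 1)]; the split within the
   [j]-th pair produces the coordinate [x 0 j], and is nonnegative because that coordinate is at
   most [M] in absolute value. *)
pose l (o : 'I_n * bool + unit) : R := if o is inl (j, b)
  then n.+1%:R^-1 * (1 + (-1) ^+ b * x 0 j / M) / 2 else n.+1%:R^-1.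
have n0 : n.+1%:R != 0 :> R by rewrite pnatr_eq0.
have M0' : M != 0 by rewrite gt_eqF.
have l0 o : 0 <= l o.
  case: o => [[j b]|_] /=; last by rewrite invr_ge0.
  rewrite mulr_ge0 ?invr_ge0// mulr_ge0 ?invr_ge0//.
  have : `|(-1) ^+ b * x 0 j / M| <= 1.
    rewrite normrM normrM normrX normrN1 expr1n mul1r normfV (gtr0_norm M0).
    by rewrite ler_pdivrMr// mul1r (le_trans (coord_le_norm _ _)).
  by rewrite ler_norml => /andP[]; lra.
have sumE (T : zmodType) (f : 'I_n * bool + unit -> T) :
    \sum_o f o = f (inr tt) + \sum_j (f (inl (j, false)) + f (inl (j, true))).
  rewrite sum_unit addrC; congr (_ + _).
  rewrite (eq_bigr (fun q => f (inl (q.1, q.2)))) => [|[]//].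
  rewrite -(pair_bigA _ (fun j b => f (inl (j, b)))) /=.
  by apply: eq_bigr => j _; rewrite big_bool /= addrC.
have l1 : \sum_o l o = 1.
  rewrite sumE (eq_bigr (fun=> n.+1%:R^-1)) => [|j _]; last first.
    by rewrite /l /= expr0 expr1; field; apply/andP.
  rewrite sumr_const card_ord /= -[X in X + _]mulr1n -mulrnDr add1n.
  by rewrite -[LHS]mulr_natr mulVf.
have -> : x = \sum_o l o *: w o.
  rewrite sumE /= scaler0 add0r [LHS]row_sum_delta; apply: eq_bigr => j _.
  rewrite !scalerA -scalerDl; congr (_ *: _).
  by rewrite expr0 expr1; field; apply/andP.
apply: conv_comb => //; first exact: cconvex_conv.
by move=> i _; exact: fhull_mem.
Qed.

End finite_hulls.

Section homomorphism.
Context {R : realType} {m n : nat}.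
Variable Phi : cconvex R m -> cconvex R n.
Hypothesis hom : lattice_hom Phi.
Implicit Types (C D : cconvex R m) (x y z : 'rV[R]_m).

Local Notation F x := (Phi (cconvex1 x) : set _).
Local Notation S := (Phi cconvex0 : set _).

Lemma hom_meet C D p : 
  cconvex_set (Phi C) p -> cconvex_set (Phi D) p ->
  cconvex_set (Phi (Order.meet C D)) p.
Proof. by move=> Cp Dp; rewrite hom.1. Qed.

Lemma hom_mono C D : C `<=` D -> Phi C `<=` Phi D.
Proof.
move=> CD; have : Order.meet C D = C.
  by apply/cconvex_inj; rewrite cconvex_meetE; apply/setIidPl.
by move=> <-; rewrite hom.1 => p [].
Qed.

Lemma hom_core_sub C : S `<=` Phi C.
Proof. by apply: hom_mono => x []. Qed.

Lemma hom_join_sub C D (K : set 'rV[R]_n) : conv_closed K ->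
  Phi C `<=` K -> Phi D `<=` K -> Phi (Order.join C D) `<=` K.
Proof. by rewrite hom.2; exact: join_sub. Qed.

Lemma hom_fhull_sub (I : finType) (P : pred I) w (K : set 'rV[R]_n) :
  conv_closed K -> S `<=` K -> (forall i, P i -> F (w i) `<=` K) ->
  Phi (fhull P w) `<=` K.
Proof.
move=> cK SK FK; rewrite /fhull.
have : forall i, i \in enum P -> P i by move=> i; rewrite mem_enum.
elim: (enum P) => [//|j s IH Ps].
apply: (@hom_join_sub (cconvex1 (w j)) (foldr _ _ s)) => //.
  by apply/FK/Ps; rewrite inE eqxx.
by apply: IH => i si; apply: Ps; rewrite inE si orbT.
Qed.

Lemma hom_point_disj x y p : x <> y -> F x p -> F y p -> S p.
Proof.
move=> xy Fx Fy; have := hom_meet Fx Fy.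
by apply: hom_mono => z [/= -> /xy].
Qed.

Lemma hom_point_in C x : cconvex_set C x -> F x `<=` Phi C.
Proof. by move=> Cx; apply: hom_mono => y ->. Qed.

Lemma hom_segment_sub x y (t : R) K : conv_closed K -> 0 <= t -> t <= 1 ->
  F x `<=` K -> F y `<=` K -> F (t *: x + (1 - t) *: y) `<=` K.
Proof.
move=> cK t0 t1 FxK FyK.
apply: subset_trans (hom_join_sub (C := cconvex1 x) (D := cconvex1 y) cK FxK FyK).
by apply: hom_point_in; apply: cconvex_conv => //; [exact: join_subl|exact: join_subr].
Qed.

(* If [F x] is contained in [S], then [F] collapses on every segment through [x],
   hence everywhere. *)
Lemma nontrivial_point x : ~ trivial_map Phi -> ~ F x `<=` S.
Proof.
move=> ntr FxS; apply: ntr; exists (Phi cconvex0) => C.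
have FS y : F y `<=` S.
  have [->//|yx] := eqVneq y x.
  move=> p Fyp.
  (* [y] is the midpoint of [x] and its reflection [z]. As [F x] is in [S], hence in [F z], so is
     [F y]; and the distinct points [y] and [z] share only points of [S]. *)
  have : F (2 *: y - x) p.
    pose z := 2 *: y - x.
    have := @hom_segment_sub x z (1/2) (F z) (@cconvex_conv _ _ _).
    rewrite (_ : _ + _ = y); last by apply/rowP => i; rewrite !mxE; field.
    apply=> //; try lra.
    exact: subset_trans FxS (hom_core_sub _).
  move: Fyp; apply: hom_point_disj => /eqP.
  by rewrite -subr_eq0 (_ : _ - _ = x - y) ?subr_eq0; [rewrite eq_sym (negbTE yx)|vec].
have [I [w Cw]] := compact_sub_fhull C.
apply/cconvex_inj/seteqP; split; last exact: hom_core_sub.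
apply: subset_trans (hom_mono Cw) _.
by apply: hom_fhull_sub => //; exact: cconvex_conv.
Qed.

(* Radon's theorem transported by [Phi]: an affine dependence among points
   [p i] of the sets [F (w i)] splits them into two parts with intersecting
   convex hulls, and [Phi] sends the common points of the two corresponding
   hulls of the [w i] into [Phi C]. *)
Lemma hom_radon (I : finType) (w : I -> 'rV[R]_m) (p : I -> 'rV[R]_n)
    (a : I -> R) C :
  (forall i, F (w i) (p i)) -> (exists i, a i != 0) -> \sum_i a i = 0 ->
  \sum_i a i *: p i = 0 ->
  (forall b : I -> R, \sum_i b i = 0 -> \sum_i b i *: w i = 0 ->
    \sum_i Num.max (b i) 0 = 1 -> cconvex_set C (\sum_i Num.max (b i) 0 *: w i)) ->
  exists l : I -> R, [/\ forall i, 0 <= l i, \sum_i l i = 1 &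
    cconvex_set (Phi C) (\sum_i l i *: p i)].
Proof.
move=> Fp [i0 ai0] a1 ap hC.
pose M := \sum_(i | 0 < a i) a i.
have MN : M = \sum_(i | ~~ (0 < a i)) - a i.
  move: a1; rewrite (bigID (fun i => 0 < a i)) /= => /eqP; rewrite addr_eq0.
  by move=> /eqP; rewrite -/M => ->; rewrite sumrN.
have M0 : 0 < M.
  have [ai|ai] := ltP 0 (a i0).
    rewrite /M (bigD1 i0)//= ltr_pwDl// sumr_ge0// => i /andP[/ltW//].
  rewrite MN (bigD1 i0) -?leNgt//= ltr_pwDl//; first by rewrite oppr_gt0 lt_neqAle ai0.
  by apply: sumr_ge0 => i /andP[]; rewrite -leNgt oppr_ge0.
have Mn0 : M != 0 by rewrite gt_eqF.
exists (fun i => if 0 < a i then a i / M else 0).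
have rE : \sum_i (if 0 < a i then a i / M else 0) *: p i =
    \sum_(i | 0 < a i) (a i / M) *: p i.
  rewrite [RHS]big_mkcond; apply: eq_bigr => i _.
  by case: ifP => //; rewrite scale0r.
split=> [i||].
- by case: ifP => // /ltW ?; rewrite divr_ge0// ltW.
- by rewrite -big_mkcond -mulr_suml divff.
rewrite rE.
have P1 : cconvex_set (Phi (fhull (fun i => 0 < a i) w)) (\sum_(i | 0 < a i) (a i / M) *: p i).
  apply: conv_comb => [|i /ltW ?||i ai]; first exact: cconvex_conv.
  - by rewrite divr_ge0// ltW.
  - by rewrite -mulr_suml divff.
  - by apply: hom_point_in (Fp i); exact: fhull_mem.
have P2 : cconvex_set (Phi (fhull (fun i => ~~ (0 < a i)) w)) (\sum_(i | 0 < a i) (a i / M) *: p i).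
  have -> : \sum_(i | 0 < a i) (a i / M) *: p i =
      \sum_(i | ~~ (0 < a i)) (- a i / M) *: p i.
    have : \sum_i (a i / M) *: p i = 0.
      under eq_bigr do rewrite mulrC -scalerA.
      by rewrite -scaler_sumr ap scaler0.
    rewrite (bigID (fun i => 0 < a i)) /= => /eqP; rewrite addr_eq0 => /eqP ->.
    by rewrite -sumrN; apply: eq_bigr => i _; rewrite mulNr scaleNr.
  apply: conv_comb => [|i ?||i ai]; first exact: cconvex_conv.
  - by rewrite divr_ge0 ?(ltW M0)// oppr_ge0 leNgt.
  - by rewrite -mulr_suml -MN divff.
  - by apply: hom_point_in (Fp i); exact: fhull_mem.
move: (hom_meet P1 P2); apply: hom_mono => v [/= /fhull_comb[l [l0 lP l1 lv]]].
move=> /fhull_comb[k [k0 kP k1 kv]].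
(* [l] and [k] live on complementary index sets, so the common point of the two hulls is the
   positive part of the dependence [l - k], the form in which [hC] is stated. *)
have lk i : Num.max (l i - k i) 0 = l i.
  have [ai|ai] := boolP (0 < a i).
    by rewrite kP ?ai// subr0 max_l.
  by rewrite lP// sub0r max_r// oppr_le0.
rewrite lv (eq_bigr (fun i => Num.max (l i - k i) 0 *: w i)) => [|i _]; last by rewrite lk.
apply: hC.
- by rewrite sumrB l1 k1 subrr.
- under eq_bigr do rewrite scalerBl.
  by rewrite sumrB -lv -kv subrr.
- by under eq_bigr do rewrite lk.
Qed.

End homomorphism.

Section cubes.
Context {R : realType} {n : nat}.
Local Notation E := 'rV[R]_n.

Lemma cube_compact (z : E) (r : R) : compact [set y : E | `|y - z| <= r].
Proof.
apply: bounded_closed_compact.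
  exists (r + `|z|); split; first exact: num_real.
  move=> M hM y /= yz; apply: le_trans (ltW hM).
  by have := ler_normD (y - z) z; rewrite subrK; lra.
rewrite (_ : mkset _ = (fun y => `|y - z|) @^-1` [set t | t <= r])//.
apply: closed_comp => [y _|]; last exact: closed_le.
have h : {for y, continuous (fun y : E => y - z)}.
  by apply: continuousB => //; exact: cst_continuous.
exact: (cvg_norm h).
Qed.

Lemma cube_convex (z : E) (r : R) : convex_set [set y : E | `|y - z| <= r].
Proof.
apply/convP => x y t /= xr yr t0 t1.
rewrite (_ : _ - z = t *: (x - z) + (1 - t) *: (y - z)); last by vec.
apply: le_trans (ler_normD _ _) _; rewrite !normrZ ger0_norm// ger0_norm ?subr_ge0//.
have := ler_wpM2l t0 xr; have : (1 - t) * `|y - z| <= (1 - t) * r.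
  by rewrite ler_wpM2l ?subr_ge0.
lra.
Qed.

Definition cube (z : E) (r : R) : cconvex R n :=
  CConvex (@cube_compact z r) (@cube_convex z r).

Lemma conv_level (K : set E) u a p q : conv_closed K -> K p -> K q ->
  dot u p <= a -> a <= dot u q -> exists2 r, K r & dot u r = a.
Proof.
move=> cK Kp Kq pa aq; have [pq|pq] := eqVneq (dot u p) (dot u q).
  by exists p => //; lra.
have pq' : 0 < dot u q - dot u p by rewrite subr_gt0 lt_neqAle pq; lra.
pose t := (a - dot u p) / (dot u q - dot u p).
exists (t *: q + (1 - t) *: p).
  apply: cK => //; first by rewrite divr_ge0 ?(ltW pq')// subr_ge0.
  by rewrite ler_pdivrMr// mul1r lerB.
by rewrite dotDr !dotZr /t; field; rewrite gt_eqF.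
Qed.

Lemma join_point_seg (p q v : E) :
  cconvex_set (Order.join (cconvex1 p) (cconvex1 q)) v ->
  exists s : R, [/\ 0 <= s, s <= 1 & v = s *: p + (1 - s) *: q].
Proof.
rewrite cconvex_joinE conv_hullU_join; try exact: convex_set1; last 2 first.
- by exists p.
- by exists q.
move=> [[[_ _] s] /= [[-> ->]]]; rewrite in_itv /= => /andP[s0 s1] <-.
by exists s.
Qed.

End cubes.

(** * Directions with a prescribed Radon point *)

Section configuration.
Context {R : realType} {c : nat}.
Variables (e : 'rV[R]_c) (i0 : 'I_c) (k h : R).
Hypotheses (c2 : (1 < c)%N) (ei0 : e 0 i0 != 0) (k0 : 0 < k) (h0 : 0 < h).

(* [c + 2] directions, close to [2 e] or [- 2 k e], whose only linear
   dependences combine [k * inr true + inr false] with a positive relation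
   among the [inl] directions. *)
Definition config (i : 'I_c + bool) : 'rV[R]_c :=
  match i with
  | inl j => if j == i0
      then - k *: (2 *: e + (h / c.-1%:R) *: \sum_(j | j != i0) delta_mx 0 j)
      else 2 *: e + h *: delta_mx 0 j
  | inr b => if b then 2 *: e else (- (2 * k)) *: e
  end.

Let N : R := c.-1%:R.

Let N0 : 0 < N. Proof. by rewrite ltr0n -ltnS prednK// ltnW. Qed.

(** The coefficient of [e] in the combination with weights [a]. The rest is spanned by the unit
    vectors other than the [i0]-th, which together with [e] form a basis since [e 0 i0] is
    nonzero. *)
Let B (a : 'I_c + bool -> R) : R := 2 * (\sum_(j | j != i0) a (inl j) -
  k * a (inl i0) + a (inr true) - k * a (inr false)).

Let config_coord a j : (\sum_i a i *: config i) 0 j =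
  B a * e 0 j + if j == i0 then 0 else h * (a (inl j) - k * a (inl i0) / N).
Proof.
have dE i : (\sum_(j | j != i0) delta_mx 0 j : 'rV[R]_c) 0 i = (i != i0)%:R.
  rewrite summxE; have [->|ii0] := eqVneq i i0.
    by rewrite big1// => j' /negbTE j'i; rewrite mxE eq_sym j'i andbF.
  rewrite (bigD1 i)//= mxE !eqxx big1 ?addr0// => j' /andP[_ /negbTE j'i].
  by rewrite mxE eq_sym j'i andbF.
rewrite summxE big_sumType /= big_bool /= (bigD1 i0)//= eqxx.
have -> : \sum_(i < c | i != i0) (a (inl i) *: (if i == i0
    then - k *: (2 *: e + (h / c.-1%:R) *: \sum_(j | j != i0) delta_mx 0 j)
    else 2 *: e + h *: delta_mx 0 i)) 0 j =
   (\sum_(j | j != i0) a (inl j)) * (2 * e 0 j) +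
     (if j == i0 then 0 else h * a (inl j)).
  rewrite mulr_suml.
  have -> : (if j == i0 then 0 else h * a (inl j)) =
      \sum_(i < c | i != i0) (if i == j then h * a (inl j) else 0).
    have [->|ji0] := eqVneq j i0; first by rewrite big1// => i /negbTE ->.
    by rewrite (bigD1 j)//= eqxx big1 ?addr0// => i /andP[_ /negbTE ->].
  rewrite -big_split; apply: eq_bigr => i /negbTE ii0 /=.
  rewrite ii0 !mxE eqxx /= eq_sym; case: eqP => [->|_] /=; ring.
rewrite 6!mxE dE !mxE /B /N.
have ? : c.-1%:R != 0 :> R by rewrite gt_eqF.
by case: eqP => _ /=; field.
Qed.

(** Comparing coordinates, the coefficients of a dependence on the [inl] indices are positive
    multiples of one number, and so are those on the [inr] indices. Taking positive parts therefore
    preserves all the relations. *)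
Lemma config_dep a : \sum_i a i *: config i = 0 ->
  \sum_i Num.max (a i) 0 *: config i = 0.
Proof.
move=> /rowP h1.
have Ba : B a = 0.
  by have := h1 i0; rewrite config_coord eqxx mxE addr0 => /eqP;
    rewrite mulf_eq0 (negbTE ei0) orbF => /eqP.
have aj j : j != i0 -> a (inl j) = k / N * a (inl i0).
  move=> /negbTE ji0; have := h1 j; rewrite config_coord Ba ji0 mxE mul0r add0r.
  by move=> /eqP; rewrite mulf_eq0 gt_eqF//= subr_eq0 => /eqP ->; rewrite mulrAC.
have maxZ s x : 0 <= s -> Num.max (s * x) 0 = s * Num.max x 0.
  by move=> s0; rewrite maxr_pMr// mulr0.
have kN : 0 <= k / N by rewrite divr_ge0// ltW.
have sumE x : \sum_(j < c | j != i0) k / N * x = k * x.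
  rewrite sumr_const cardC1 card_ord -[RHS]mulr1.
  rewrite -[in LHS]mulr_natr -/N; field; exact: lt0r_neq0.
have at_f : a (inr true) = k * a (inr false).
  move: Ba; rewrite /B (eq_bigr (fun=> k / N * a (inl i0))) => [|j /aj //].
  by rewrite sumE; lra.
apply/rowP => j; rewrite config_coord mxE.
have -> : B (fun i => Num.max (a i) 0) = 0.
  rewrite /B (eq_bigr (fun=> k / N * Num.max (a (inl i0)) 0)) => [|i /aj ->]; last exact: maxZ.
  by rewrite sumE at_f maxZ ?(ltW k0)//; lra.
rewrite mul0r add0r; case: ifPn => // /aj ->.
by rewrite maxZ// mulrAC subrr mulr0.
Qed.

Lemma config_near i : `|config i - 2 *: e| <= h \/ `|config i + (2 * k) *: e| <= k * h.
Proof.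
have d1 j : `|delta_mx 0 j : 'rV[R]_c| <= 1.
  by apply: row_norm_le => // i'; rewrite mxE; case: (_ && _); rewrite ?normr1 ?normr0.
have kh : 0 <= k * h by rewrite mulr_ge0// ltW.
case: i => [j|[]] /=; last 2 first.
- by left; rewrite subrr normr0 ltW.
- by right; rewrite scaleNr addNr normr0.
have [_|_] := eqVneq j i0.
  right; set D := \sum_(_ | _) _.
  rewrite (_ : _ + _ = (- (k * h / N)) *: D); last by apply/rowP => i'; rewrite !mxE -/N;
    field; exact: lt0r_neq0.
  rewrite normrZ normrN ger0_norm ?divr_ge0 ?(ltW N0)//.
  have D1 : `|D| <= N.
    apply: le_trans (ler_norm_sum _ _ _) _.
    apply: le_trans (ler_sum _ (fun i _ => d1 i)) _.
    by rewrite sumr_const cardC1 card_ord.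
  by rewrite mulrAC ler_pdivrMr// ler_wpM2l.
left; rewrite addrC addKr normrZ gtr0_norm//.
by rewrite -[leRHS]mulr1 ler_wpM2l// ltW.
Qed.

End configuration.

(** * Semicontinuity *)

Section upper_semicontinuous.
Context {R : realType} {c : nat}.
Variable Phi : cconvex R c -> cconvex R c.+1.
Implicit Types (x y z : 'rV[R]_c) (u p q : 'rV[R]_c.+1).

Local Notation F x := (Phi (cconvex1 x) : set _).
Local Notation S := (Phi cconvex0 : set _).

Definition usc_at_points := forall x (O : set 'rV[R]_c.+1), open O ->
  F x `<=` O -> \forall y \near x, F y `<=` O.

Hypothesis hom : lattice_hom Phi.
Hypothesis ntr : forall x, ~ F x `<=` S.
Hypothesis usc : usc_at_points.
Hypothesis c2 : (1 < c)%N.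

Lemma hom_point_nonempty x : F x !=set0.
Proof. by apply: contrapT => /nonemptyPn F0; apply: (@ntr x); rewrite F0. Qed.

Definition below u (a : R) : set 'rV[R]_c :=
  [set x | F x `<=` [set p | dot u p < a]].

Lemma below_open u a : open (below u a).
Proof. by rewrite openE => x /(usc (@open_dot_lt _ _ u a)). Qed.

Lemma below_conv u a : conv_closed (below u a).
Proof.
by move=> x y t xu yu t0 t1; apply: hom_segment_sub => //; exact: conv_dot_lt.
Qed.

Lemma not_below u a x : ~ below u a x -> exists2 p, F x p & a <= dot u p.
Proof.
move=> /existsNP[p /not_implyP[Fp /negP]]; rewrite -leNgt => ap.
by exists p.
Qed.

(** At the supremum of the parameters whose point is in [below u a], the set [F] is not below, since
    being below is an open condition, and not entirely above, since it is approached by sets that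
    are below. Being convex, it meets the hyperplane. *)
Lemma below_boundary u a z w : below u a z -> ~ below u a w ->
  exists t p, [/\ 0 < t, t <= 1, F (z + t *: (w - z)) p & dot u p = a].
Proof.
move=> Qz Qw; pose g (t : R) := z + t *: (w - z).
pose T := [set t | 0 <= t <= 1 /\ below u a (g t)].
have T0 : T 0 by split; rewrite ?lexx ?ler01// /g scale0r addr0.
have supT : has_sup T by split; [exists 0|exists 1 => t [/andP[]]].
pose s := sup T.
have s0 : 0 <= s by apply: sup_upper_bound.
have s1 : s <= 1 by apply: sup_le_ub; [exists 0|move=> t [/andP[]]].
have near_g (P : set _) : (\forall y \near g s, P y) ->
    exists2 d, 0 < d & forall t, `|t - s| < d -> P (g t).
  move=> /ball_nbhs[d d0 hd]; exists (d / (`|w - z| + 1)).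
    by rewrite divr_gt0// ltr_wpDl.
  move=> t ts; apply: hd; rewrite /g (_ : _ - _ = (t - s) *: (w - z)); last by vec.
  rewrite normrZ; move: ts; rewrite ltr_pdivlMr ?ltr_wpDl//; apply: le_lt_trans.
  by rewrite ler_wpM2l// lerDl.
have Qs : ~ below u a (g s).
  move=> Qs.
  have [d d0 hd] := near_g _ (usc (@open_dot_lt _ _ u a) Qs).
  have [s1'|s1'] := ltP s 1; last first.
    have se : s = 1 by apply/eqP; rewrite eq_le s1 s1'.
    by apply: Qw; move: Qs; rewrite /g se scale1r addrC subrK.
  pose t := Num.min 1 (s + d / 2).
  have ts : s < t by rewrite lt_min s1' ltrDl divr_gt0.
  have : T t.
    split; first by rewrite (le_trans s0 (ltW ts))//= ge_min lexx.
    apply: hd; rewrite gtr0_norm ?subr_gt0// ltrBlDl gt_min; apply/orP; right; lra.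
  by move=> /(sup_upper_bound supT); rewrite -/s leNgt ts.
have sp : 0 < s.
  rewrite lt_neqAle s0 andbT; apply/eqP => s0'; apply: Qs.
  by rewrite -s0' /g scale0r addr0.
have [q Fq aq] := not_below Qs.
have [p Fp pa] : exists2 p, F (g s) p & dot u p <= a.
  apply: contrapT => /forall2NP h.
  have Fs : F (g s) `<=` [set p | a < dot u p].
    by move=> p Fp /=; have [//|/negP] := h p; rewrite -ltNge.
  have [d d0 hd] := near_g _ (usc (@open_dot_gt _ _ u a) Fs).
  have [t [t01 Qt] ts] := sup_adherent d0 supT.
  have [r Fr] := hom_point_nonempty (g t).
  have /hd /(_ r Fr) /= : `|t - s| < d.
    by rewrite ler0_norm ?subr_le0 ?(sup_upper_bound supT)// opprB; move: ts; rewrite -/s; lra.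
  by have := Qt _ Fr; rewrite /=; lra.
have [r Fr ra] := conv_level (@cconvex_conv _ _ _) Fp Fq pa aq.
by exists s, r.
Qed.

(* If [z] between [x] and [y] lies below the hyperplane [dot u p = a] while [x]
   and [y] do not, then [c + 2] segments issued from [z], placed as in
   [config], yield as many points of the hyperplane, whose Radon point belongs
   to [F z]. *)
Lemma below_compl_conv u a : S `<=` [set p | dot u p < a] ->
  conv_closed (~` below u a).
Proof.
move=> Sa x y t Qx Qy t0 t1 /=; set z := _ + _ => Qz.
have xy : x - y != 0.
  rewrite subr_eq0; apply/eqP => xy; apply: Qx; move: Qz.
  by rewrite /z xy -scalerDl addrC subrK scale1r.
have tn0 : 0 < t.
  rewrite lt_neqAle t0 andbT; apply/eqP => t0'; apply: Qy; move: Qz.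
  by rewrite /z -t0' scale0r add0r subr0 scale1r.
have tn1 : t < 1.
  rewrite lt_neqAle t1 andbT; apply/eqP => t1'; apply: Qx; move: Qz.
  by rewrite /z t1' subrr scale0r addr0 scale1r.
have t1n : 1 - t != 0 by rewrite subr_eq0 gt_eqF.
(* Seen from [z], the points [x] and [y] are [e] and [- k e]; the configuration overshoots them by a
   factor 2. *)
pose e := x - z; pose k := t / (1 - t).
have k0 : 0 < k by rewrite divr_gt0// subr_gt0.
have eE : e = (1 - t) *: (x - y) by rewrite /e /z; vec.
have eN0 : e != 0 by rewrite eE scaler_eq0 (negbTE t1n) (negbTE xy).
have yE : y = z - k *: e.
  by apply/rowP => i; rewrite eE /z /k !mxE; field.
have /rV0Pn[i0 ei0] := eN0.
have u0 : u != 0.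
  apply/eqP => u0; have [p Fp] := hom_point_nonempty z.
  have := Qz _ Fp; rewrite /= u0 dotC dot0r => a0.
  by apply: Qx => q _; rewrite /= u0 dotC dot0r.
have [d d0 hd] := open_ball_sub (@below_open u a) Qz.
have half (w v : 'rV[R]_c) : below u a w -> below u a v ->
    below u a ((1/2) *: w + (1 - 1/2) *: v) by move=> *; apply: below_conv => //; lra.
(* [x] is the midpoint of [z + w] and a point within [d] of [z], which is below; were [z + w] below
   as well, [x] would be. *)
have out1 w : `|w - 2 *: e| < d -> ~ below u a (z + w).
  move=> wd Qw; apply: Qx.
  have -> : x = (1/2) *: (z + w) + (1 - 1/2) *: (z + (2 *: e - w)).
    by apply/rowP => i; rewrite /e !mxE; field.
  by apply: half => //; apply: hd; rewrite addrC addKr distrC.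
have out2 w : `|w + (2 * k) *: e| < d -> ~ below u a (z + w).
  move=> wd Qw; apply: Qy.
  have -> : y = (1/2) *: (z + w) + (1 - 1/2) *: (z - (w + (2 * k) *: e)).
    by rewrite yE; apply/rowP => i; rewrite !mxE; field.
  by apply: half => //; apply: hd; rewrite addrC addKr normrN.
pose h := d / (2 * (1 + k)).
have h0 : 0 < h by rewrite divr_gt0// mulr_gt0//; lra.
have hE : h + k * h = d / 2 by rewrite /h; field; lra.
have kh : 0 < k * h by rewrite mulr_gt0.
pose w := @config R c e i0 k h.
have Qw i : ~ below u a (z + w i).
  by have [le|le] := config_near e i0 c2 k0 h0 i; [apply: out1|apply: out2];
    rewrite (le_lt_trans le)//; lra.
have /choice[f hf] : forall i, exists tp : R * 'rV[R]_c.+1,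
    [/\ 0 < tp.1, F (z + tp.1 *: w i) tp.2 & dot u tp.2 = a].
  move=> i; have [s [p [s0 _ Fp pa]]] := below_boundary Qz (Qw i).
  by exists (s, p); split => //=; move: Fp; rewrite [z + w i]addrC addrK.
have fa i : dot u (f i).2 = a by case: (hf i).
have Ff i : F (z + (f i).1 *: w i) (f i).2 by case: (hf i).
have [|m [m0 m1 m2]] := hyperplane_dep u0 fa.
  by rewrite card_sum card_ord card_bool addn2.
have [|l [l0 l1]] := hom_radon hom (C := cconvex1 z) Ff m0 m1 m2.
  move=> b b1 b2 b3 /=.
  (* The lengths [(f i).1] are absorbed into the weights: being positive, they commute with taking
     positive parts. *)
  have : \sum_i (b i * (f i).1) *: config e i0 k h i = 0.
    move: b2; under eq_bigr do rewrite scalerDr scalerA.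
    by rewrite big_split /= -scaler_suml b1 scale0r add0r.
  move=> /(config_dep c2 ei0 k0 h0) b4.
  under eq_bigr do rewrite scalerDr scalerA.
  rewrite big_split /= -scaler_suml b3 scale1r.
  rewrite (eq_bigr (fun i => Num.max (b i * (f i).1) 0 *: config e i0 k h i)).
    by rewrite b4 addr0.
  move=> i _; have [/ltW f0 _ _] := hf i.
  by rewrite maxr_pMl// mul0r.
move=> /Qz /=; rewrite dot_sumr (eq_bigr (fun i => l i * a)) => [|i _].
  by rewrite -mulr_suml l1 mul1r ltxx.
by rewrite dotZr fa.
Qed.

(** Were [F z] disjoint from the segment, a hyperplane would have [F z], and [S] with it, strictly
    below and both [p] and [q] above, against [below_compl_conv]. *)
Lemma between_points x y p q (t : R) : F x p -> F y q -> 0 <= t -> t <= 1 ->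
  exists s : R, [/\ 0 <= s, s <= 1 &
    F (t *: x + (1 - t) *: y) (s *: p + (1 - s) *: q)].
Proof.
move=> Fp Fq t0 t1; set z := _ + _.
pose B := Order.join (cconvex1 p) (cconvex1 q).
have [FB|/set0P[v [Fv /join_point_seg[s [s0 s1 vE]]]]] := eqVneq (F z `&` cconvex_set B) set0.
  have [u [a [h1 h2]]] := sep_sets (@cconvex_compact _ _ _) (@cconvex_compact _ _ B)
    (@cconvex_conv _ _ _) (@cconvex_conv _ _ _) FB.
  exfalso; apply: (@below_compl_conv u a _ x y t) => //.
  - by move=> r Sr; apply: h1; exact: hom_core_sub.
  - move=> /(_ _ Fp) /=; have := h2 p (@join_subl _ _ (cconvex1 p) _ _ erefl); lra.
  - move=> /(_ _ Fq) /=; have := h2 q (@join_subr _ _ _ (cconvex1 q) _ erefl); lra.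
by exists s; rewrite -vE.
Qed.

Lemma locally_bounded z (r : R) : exists2 M : R, 0 < M &
  forall y p, `|y - z| <= r -> F y p -> `|p| <= M.
Proof.
have [M M0 hM] := cconvex_bounded (Phi (cube z r)).
by exists M => // y p yz Fp; apply: hM; exact: hom_point_in Fp.
Qed.

(* A jump of [F] across the hyperplane bounding [below u a] occurs at both [z1]
   and [z2], and persists when [u] is perturbed. *)
Lemma jump_transfer u v (a b : R) l z1 z2 p :
  below u a = [set x | dot l x < b] -> l != 0 ->
  dot l z1 = b -> dot l z2 = b -> F z1 p -> a < dot u p ->
  exists2 e0 : R, 0 < e0 & forall e, 0 <= e -> e < e0 ->
    exists2 q, F z2 q & dot (u + e *: v) p <= dot (u + e *: v) q.
Proof.
move=> Qe l0 z1b z2b Fp ap.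
have nl : 0 < `|l| by rewrite normr_gt0.
have [M M0 hM] := locally_bounded z1 (`|z1 - z2| + `|l|).
(* Bounds the variation of [dot v] between [p] and the values of [F] around [z1]; for [e] below the
   chosen threshold, the tilt [e *: v] cannot close the gap between [a] and [dot u p]. *)
pose K := c.+1%:R * `|v| * (M + `|p|).
have K0 : 0 <= K by rewrite !mulr_ge0// addr_ge0// ltW.
exists ((dot u p - a) / (K + 1)).
  by rewrite divr_gt0 ?subr_gt0//; lra.
move=> e e0 ee; apply: contrapT => /forall2NP h.
pose O := [set q | dot (u + e *: v) q < dot (u + e *: v) p].
have FO : F z2 `<=` O by move=> q Fq; have [//|/negP] := h q; rewrite -ltNge.
have /ball_nbhs[d d0 hd] := usc (@open_dot_lt _ _ _ _) FO.
pose s := Num.min 1 (d / (2 * `|l|)).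
have s0 : 0 < s by rewrite lt_min ltr01 divr_gt0// mulr_gt0.
have s1 : s <= 1 by rewrite ge_min lexx.
have Fx : F (z2 + s *: l) `<=` O.
  apply: hd; rewrite addrC addKr normrZ gtr0_norm//.
  have : s * `|l| <= d / 2.
    by rewrite -ler_pdivlMr// ge_min; apply/orP; right; rewrite invfM mulrA.
  lra.
(* [z1] is the midpoint of [z2 + s *: l], controlled by upper semicontinuity at [z2], and of [y],
   which is in [below u a]. Both values of [F] lie in [O], hence so would [F z1], although [p] is
   not in [O]. *)
pose y := 2 *: z1 - (z2 + s *: l).
have Qy : below u a y.
  rewrite Qe /= /y dotBr dotDr !dotZr z1b z2b.
  by have := mulr_gt0 s0 (dot_gt0 l0); lra.
have Fy : F y `<=` O.
  move=> q Fq; have := Qy _ Fq; rewrite /O /= !dotDl !dotZl => qa.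
  have : `|q| <= M.
    apply: hM Fq; rewrite /y (_ : _ - _ = (z1 - z2) - s *: l); last by vec.
    apply: le_trans (ler_normB _ _) _; rewrite lerD2l normrZ gtr0_norm//.
    by rewrite ger_pMl.
  move=> qM; have : `|dot v (q - p)| <= K.
    apply: le_trans (dot_le _ _) _; rewrite ler_wpM2l// ?mulr_ge0//.
    by apply: le_trans (ler_normB _ _) _; rewrite lerD2r.
  rewrite dotBr => /ler_normlP[_ hK].
  move: ee; rewrite ltr_pdivlMr; last lra.
  have := ler_wpM2l e0 hK; lra.
have /(_ _ Fp) : F z1 `<=` O.
  have -> : z1 = (1/2) *: (z2 + s *: l) + (1 - 1/2) *: y.
    by apply/rowP => i; rewrite /y !mxE; field.
  have cO : conv_closed O by exact: conv_dot_lt.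
  by apply: (@hom_segment_sub _ _ _ _ hom _ _ _ O) => //; lra.
by rewrite /O /= ltxx.
Qed.

(** Otherwise, for a level [b] above [a], [below u b] is an open half-space with [z] on its
    boundary. Let [q] be highest in [F z], and move along the boundary to [z'], where [q] is absent.
    Tilting [u] slightly towards a functional that is larger at [q] than on [F z'] transfers the
    jump to a point of [F z'] strictly higher than [q]; transferring it back without tilt gives a
    point of [F z] above the highest one. *)
Lemma hom_lsc_dot u (a : R) z p : F z p -> a < dot u p ->
  \forall y \near z, exists2 q, F y q & a < dot u q.
Proof.
move=> Fp ap.
have [[q Sq aq]|nS] := pselect (exists2 q, S q & a < dot u q).
  by near=> y; exists q => //; exact: hom_core_sub.
apply: contrapT => nn.
pose b := (a + dot u p) / 2.
have bp : b < dot u p by rewrite /b; lra.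
have ab : a < b by rewrite /b; lra.
have Sb : S `<=` [set q | dot u q < b].
  move=> q Sq /=; rewrite ltNge; apply/negP => bq; apply: nS; exists q => //; lra.
have close d : 0 < d -> exists2 y, `|y - z| < d & below u b y.
  move=> d0; apply: contrapT => /forall2NP h; apply: nn.
  apply/ball_nbhs; exists d => // y yd.
  have [//|/not_below[q Fq bq]] := h y.
  by exists q => //; lra.
have nz : ~ below u b z by move=> /(_ _ Fp) /=; lra.
have [||l [g [l0 Qe]]] := open_convex_halfspace (@below_open u b) (@below_conv u b)
  (below_compl_conv Sb).
- by have [y _ Qy] := close 1 ltr01; exists y.
- by exists z.
have zg : dot l z = g.
  apply/eqP; rewrite eq_le; apply/andP; split; last first.
    by move: nz; rewrite Qe /= leNgt => /negP.
  rewrite leNgt; apply/negP => gz.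
  have /open_nbhs_nbhs/ball_nbhs[d d0 hd] : open_nbhs z [set x | g < dot l x].
    by split => //; exact: open_dot_gt.
  have [y yd] := close d d0; rewrite Qe /= => yg.
  by have /= := hd _ yd; lra.
have [e e0 le] := orthogonal_vector l c2.
pose z' := z + e.
have zg' : dot l z' = g by rewrite dotDr le addr0.
have [q Fq qmax] := compact_dot_max u (@cconvex_compact _ _ (Phi (cconvex1 z)))
  (hom_point_nonempty z).
have bq : b < dot u q by have := qmax _ Fp; lra.
have nFq : ~ F z' q.
  move=> Fq'; have : S q.
    apply: hom_point_disj Fq Fq' => // /eqP.
    by rewrite /z' -subr_eq0 opprD addrA subrr add0r oppr_eq0 (negbTE e0).
  by move=> /Sb /=; lra.
have [v [m [h1 h2]]] := sep_point (@cconvex_closed _ _ _) (@cconvex_conv _ _ _) nFq.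
have [d d0 hd] := jump_transfer v Qe l0 zg zg' Fq bq.
have [||q' Fq' hq'] := hd (d / 2); try lra.
have vq' := h1 _ Fq'.
have uq' : dot u q < dot u q'.
  move: hq'; rewrite !dotDl !dotZl.
  have : d / 2 * dot v q' < d / 2 * dot v q by rewrite ltr_pM2l; lra.
  lra.
have bq' : b < dot u q' by lra.
have [d' d'0 hd'] := jump_transfer 0 Qe l0 zg' zg Fq' bq'.
have [q'' Fq''] := hd' 0 (lexx _) d'0.
by rewrite scaler0 addr0 => ?; have := qmax _ Fq''; lra.
Unshelve. all: by end_near. Qed.

(** Compactness of the unit sphere makes [hom_lsc_dot] uniform in the direction. If [F y] stayed
    away from [p], the direction from its nearest point towards [p] would violate this. *)
Lemma hom_lsc x p (e : R) : F x p -> 0 < e ->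
  \forall y \near x, exists2 q, F y q & `|q - p| < e.
Proof.
move=> Fp e0.
pose K := [set u : 'rV[R]_c.+1 | `|u| = 1].
have kK : compact K.
  apply: bounded_closed_compact.
    by exists 1; split=> [|M M1 u /= ->]; [exact: num_real|exact: ltW].
  rewrite (_ : K = Num.norm @^-1` [set t | t = 1])//.
  apply: closed_comp => [y _|]; last exact: closed_eq.
  exact: norm_continuous.
pose P y u := exists2 q, F y q & dot u p - e < dot u q.
have : \forall y \near x, K `<=` P y.
  apply: ((compact_near_coveringP K).1 kK _ (nbhs x) P) => u _.
  have : dot u p - e / 2 < dot u p by lra.
  move=> /(hom_lsc_dot Fp)/ball_nbhs[d d0 hd].
  have [M M0 hM] := locally_bounded x d.
  pose C := c.+1%:R * (M + `|p|) + 1.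
  have C0 : 0 < C by rewrite ltr_wpDl// mulr_ge0// addr_ge0// ltW.
  near=> u' y.
  have yd : `|y - x| < d.
    by near: y; apply/ball_nbhs; exists d.
  have uu : `|u' - u| < e / (2 * C).
    by near: u'; apply/ball_nbhs; exists (e / (2 * C)) => //; rewrite divr_gt0// mulr_gt0.
  have [q Fq hq] := hd _ yd.
  exists q => //.
  have qM := hM _ _ (ltW yd) Fq.
  have h1 : dot u' p - dot u' q = dot u p - dot u q + dot (u' - u) (p - q).
    rewrite dotBl !dotBr; ring.
  have h2 : dot (u' - u) (p - q) <= c.+1%:R * `|u' - u| * (M + `|p|).
    apply: le_trans (ler_norm _) _; apply: le_trans (dot_le _ _) _.
    rewrite ler_wpM2l ?mulr_ge0//.
    by apply: le_trans (ler_normB _ _) _; rewrite addrC lerD2r.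
  have h3 : `|u' - u| * C < e / 2.
    by move: uu; rewrite invfM mulrA ltr_pdivlMr.
  have h4 : c.+1%:R * `|u' - u| * (M + `|p|) <= `|u' - u| * C.
    by rewrite mulrAC mulrC ler_wpM2l// lerDl.
  lra.
apply: filterS => y KP; apply: contrapT => /forall2NP h.
have [q Fq hq] := closed_convex_proj p (@cconvex_closed _ _ _) (@cconvex_conv _ _ _)
  (hom_point_nonempty y).
have qe : e <= `|q - p| by have [//|/negP] := h q; rewrite -leNgt.
have n0 : 0 < `|q - p| by lra.
have [|r Fr] := KP (`|q - p|^-1 *: (p - q)).
  by rewrite /K /= normrZ [`|p - q|]distrC normfV normr_id mulVf// gt_eqF.
rewrite !dotZl.
have h1 := hq _ Fr.
have h2 : `|q - p|^-1 * dot (p - q) p - `|q - p|^-1 * dot (p - q) q >= `|q - p|.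
  rewrite -mulrBr -dotBr ler_pdivlMl// -expr2 distrC; exact: norm2_le_dot.
have h3 : `|q - p|^-1 * dot (p - q) r <= `|q - p|^-1 * dot (p - q) q.
  rewrite ler_wpM2l ?invr_ge0//; move: h1; rewrite -opprB dotNl dotBr; lra.
lra.
Unshelve. all: by end_near. Qed.

End upper_semicontinuous.

(** * Closed neighbourhoods of convex bodies *)

Section neighbourhoods.
Context {R : realType} {n : nat}.
Local Notation E := 'rV[R]_n.
Implicit Types (C D : cconvex R n) (K : nat -> set E).

Lemma compact_nested K (O : set E) : (forall k, compact (K k)) ->
  (forall k l, (k <= l)%N -> K l `<=` K k) -> open O ->
  (forall x, (forall k, K k x) -> O x) -> exists k, K k `<=` O.
Proof.
move=> kK dK oO KO.
have clK k : closed (K k) by apply: compact_closed; [exact: norm_hausdorff|exact: kK].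
have kB : compact (K 0%N `\` O).
  apply: subclosed_compact (kK 0%N) _; last exact: subDsetl.
  by apply: closedI => //; exact: open_closedC.
have : \forall k \near \oo, K 0%N `\` O `<=` ~` K k.
  apply: ((compact_near_coveringP _).1 kB _ \oo (fun k y => ~ K k y)) => x [_ nOx].
  have /existsNP[k0 nKx] : ~ forall k, K k x by move=> /KO.
  have nx : \forall y \near x, ~ K k0 y.
    by apply: open_nbhs_nbhs; split => //; exact/closed_openC.
  near=> y k.
  have k0k : (k0 <= k)%N by near: k; exact: nbhs_infty_ge.
  by move=> /(dK _ _ k0k); apply: (near nx y).
move=> /filter_ex[k hk]; exists k => x Kx; apply: contrapT => nOx.
by apply: (hk x) => //; split=> //; exact: dK Kx.
Unshelve. all: by end_near. Qed.

Lemma thicken_compact C (r : R) :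
  compact [set x : E | exists2 y, cconvex_set C y & `|x - y| <= r].
Proof.
rewrite (_ : mkset _ = [set p.1 + p.2 | p in C `*` cube 0 r]).
  apply: continuous_compact.
    apply: continuous_subspaceT => p.
    by apply: (@cvgD _ E); [exact: cvg_fst|exact: cvg_snd].
  by apply: compact_setX; exact: cconvex_compact.
apply/seteqP; split=> [x [y Cy xy]|x [[y z] /= [Cy]]].
  by exists (y, x - y) => /=; [rewrite subr0|rewrite addrC subrK].
by rewrite subr0 => zr <-; exists y => //; rewrite addrC addKr.
Qed.

Lemma thicken_convex C (r : R) :
  convex_set [set x : E | exists2 y, cconvex_set C y & `|x - y| <= r].
Proof.
apply/convP => x y t [x' Cx' xx'] [y' Cy' yy'] t0 t1.
exists (t *: x' + (1 - t) *: y'); first exact: cconvex_conv.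
rewrite opprD addrACA -!scalerBr.
by have /convP/(_ (x - x') (y - y') t) /= := @cube_convex R n 0 r; rewrite !subr0; apply.
Qed.

Definition thicken C (r : R) : cconvex R n :=
  CConvex (@thicken_compact C r) (@thicken_convex C r).

Definition step (k : nat) : R := k.+1%:R^-1.

Lemma step_gt0 k : 0 < step k. Proof. by rewrite invr_gt0. Qed.

Lemma step_le k l : (k <= l)%N -> step l <= step k.
Proof. by move=> kl; rewrite lef_pV2 ?posrE// ler_nat ltnS. Qed.

Lemma step_small (e : R) : 0 < e -> exists k, step k < e.
Proof.
move=> e0; have [k _ hk] := near_infty_natSinv_lt (PosNum e0).
by exists k; apply: hk => /=.
Qed.

Lemma thicken_sub C D (r s : R) : C `<=` D -> r <= s -> thicken C r `<=` thicken D s.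
Proof. by move=> CD rs x [y Cy xy]; exists y; [exact: CD|exact: le_trans rs]. Qed.

Lemma thicken_cap C x : (forall k, cconvex_set (thicken C (step k)) x) -> cconvex_set C x.
Proof.
move=> h; apply: contrapT => nCx.
have : open_nbhs x (~` (C : set E)).
  by split=> //; apply: closed_openC; exact: cconvex_closed.
move=> /open_nbhs_nbhs/ball_nbhs[d d0 hd].
have [k kd] := step_small d0.
have [y Cy xy] := h k.
by apply: (hd y) => //; rewrite distrC; exact: le_lt_trans kd.
Qed.

(** The points whose whole cube of radius [r] lies in the right-hand side form a convex set
    containing [C] and [D]. *)
Lemma thicken_join C D (r : R) :
  thicken (Order.join C D) r `<=` (Order.join (thicken C r) (thicken D r) : cconvex R n).
Proof.
move=> x [y CDy xy].
pose K := [set y : E | forall z, `|z| <= r ->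
   cconvex_set (Order.join (thicken C r) (thicken D r)) (y + z)].
have : K y.
  move: CDy; apply: join_sub.
  - move=> a b t Ka Kb t0 t1 z zr.
    have -> : t *: a + (1 - t) *: b + z = t *: (a + z) + (1 - t) *: (b + z) by vec.
    by apply: cconvex_conv => //; [exact: Ka|exact: Kb].
  - by move=> a Ca z zr; apply: (@join_subl _ _ (thicken C r)); exists a => //; rewrite addrC addKr.
  - by move=> a Da z zr; apply: (@join_subr _ _ (thicken C r)); exists a => //; rewrite addrC addKr.
by move=> /(_ _ xy); rewrite addrC subrK.
Qed.

(** The sets for [l] and [- l] meet only in [x], which is how a point is squeezed between two
    opposite cones. *)
Lemma conv_point_halfspace (l x : E) : conv_closed [set v | v = x \/ dot l x < dot l v].
Proof.
move=> v w t [->|vx] [->|wx] t0 t1 /=.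
- by left; rewrite -scalerDl addrC subrK scale1r.
- have [->|t1'] := eqVneq t 1; first by left; rewrite subrr scale1r scale0r addr0.
  right; rewrite dotDr !dotZr.
  have : 0 < (1 - t) * (dot l w - dot l x) by rewrite mulr_gt0 ?subr_gt0// lt_neqAle t1'.
  lra.
- have [->|t0'] := eqVneq t 0; first by left; rewrite subr0 scale1r scale0r add0r.
  right; rewrite dotDr !dotZr.
  have : 0 < t * (dot l v - dot l x) by rewrite mulr_gt0 ?subr_gt0// lt_neqAle eq_sym t0'.
  lra.
- by right; apply: conv_dot_gt.
Qed.

End neighbourhoods.

(** * The upper semicontinuous envelope is a homomorphism *)

Section regularization.
Context {R : realType} {m n : nat}.
Variable Phi : cconvex R m -> cconvex R n.
Hypothesis hom : lattice_hom Phi.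
Implicit Types (C D : cconvex R m) (x y : 'rV[R]_m).

Let thick C k := Phi (thicken C (step k)).

Let thick_anti C k l : (k <= l)%N -> thick C l `<=` thick C k.
Proof. by move=> kl; apply: hom_mono => //; apply: thicken_sub => //; exact: step_le. Qed.

Lemma regularize_compact C : compact [set p | forall k, cconvex_set (thick C k) p].
Proof.
apply: subclosed_compact (@cconvex_compact _ _ (thick C 0)) _; last by move=> p /=.
rewrite (_ : mkset _ = \bigcap_k cconvex_set (thick C k)).
  by apply: closed_bigI => k _; exact: cconvex_closed.
by apply/seteqP; split=> [p h k _|p h k]; apply: h.
Qed.

Lemma regularize_convex C : convex_set [set p | forall k, cconvex_set (thick C k) p].
Proof. by apply/convP => p q t hp hq t0 t1 k; apply: cconvex_conv. Qed.

(* The upper semicontinuous envelope of [Phi]. *)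
Definition regularize C : cconvex R n :=
  CConvex (@regularize_compact C) (@regularize_convex C).

Lemma regularize_nested C (O : set 'rV[R]_n) : open O -> regularize C `<=` O ->
  exists k, thick C k `<=` O.
Proof.
move=> oO CO.
apply: (@compact_nested _ _ (fun k => cconvex_set (thick C k))) => //.
- by move=> k; exact: cconvex_compact.
- by move=> k l; exact: thick_anti.
Qed.

Lemma regularize_mono C D : C `<=` D -> regularize C `<=` regularize D.
Proof.
by move=> CD p h k; apply: (hom_mono hom _ (h k)); apply: thicken_sub.
Qed.

Lemma sub_regularize C : Phi C `<=` regularize C.
Proof.
move=> p Cp k; apply: (hom_mono hom _ Cp) => x Cx.
by exists x => //; rewrite subrr normr0 ltW// step_gt0.
Qed.

Lemma regularize_core : regularize cconvex0 `<=` Phi cconvex0.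
Proof. by move=> p /(_ 0); apply: (hom_mono hom) => x [y []]. Qed.

(** Meets: by compactness, fine thickenings of [C] and [D] intersect inside a given neighbourhood of
    their meet. Joins: a point outside the join of the envelopes is cut off by a hyperplane; for a
    fine step the images of both thickenings lie on the other side of it, hence so does the image of
    their join, which contains the thickened join. *)
Lemma regularize_hom : lattice_hom regularize.
Proof.
split=> C D; apply/cconvex_inj/seteqP; split.
- by move=> p h; split; move: p h; apply: regularize_mono => x [].
- move=> p [/= hC hD] k.
  pose O := [set x | exists2 y, cconvex_set (Order.meet C D) y & `|x - y| < step k].
  have oO : open O.
    rewrite openE => x [y CDy xy]; apply/ball_nbhs.
    exists (step k - `|x - y|) => [|z zx]; first by rewrite subr_gt0.
    exists y => //; rewrite (_ : z - y = (z - x) + (x - y)); last by vec.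
    by apply: le_lt_trans (ler_normD _ _) _; rewrite -ltrBrDr.
  have [l hl] : exists l, cconvex_set (Order.meet (thicken C (step l)) (thicken D (step l))) `<=` O.
    apply: (@compact_nested _ _ (fun l => cconvex_set (Order.meet (thicken C (step l)) (thicken
      D (step l))))) => //.
    - by move=> l; exact: cconvex_compact.
    - by move=> i j /step_le ij x [xC xD]; split; [move: xC|move: xD]; apply: thicken_sub.
    - move=> x h; exists x; last by rewrite subrr normr0 step_gt0.
      by split; apply: thicken_cap => l; have [] := h l.
  have := hom_meet hom (hC l) (hD l); apply: hom_mono => // x /hl[y CDy xy].
  by exists y => //; exact: ltW.
- move=> p hp; apply: contrapT => nJp.
  have [u [a [hJ pa]]] := sep_point (@cconvex_closed _ _ _) (@cconvex_conv _ _ _) nJp.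
  have [k hk] := @regularize_nested C _ (@open_dot_lt _ _ u a)
    (fun q h => hJ q (@join_subl _ _ (regularize C) _ q h)).
  have [l hl] := @regularize_nested D _ (@open_dot_lt _ _ u a)
    (fun q h => hJ q (@join_subr _ _ (regularize C) _ q h)).
  have := hp (maxn k l).
  move=> /(hom_mono hom (@thicken_join _ _ _ _ _)).
  suff H : Phi (Order.join (thicken C (step (maxn k l))) (thicken D (step (maxn k l))))
      `<=` [set p | dot u p < a] by move=> /H /=; lra.
  apply: hom_join_sub => //; first exact: conv_dot_lt.
  - by apply: subset_trans hk; apply: thick_anti; exact: leq_maxl.
  - by apply: subset_trans hl; apply: thick_anti; exact: leq_maxr.
- apply: join_sub; first exact: cconvex_conv.
  + by apply: regularize_mono; exact: join_subl.
  + by apply: regularize_mono; exact: join_subr.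
Qed.

Lemma regularize_usc x (O : set 'rV[R]_n) : open O ->
  regularize (cconvex1 x) `<=` O ->
  \forall y \near x, regularize (cconvex1 y) `<=` O.
Proof.
move=> oO /(regularize_nested oO)[k hk]; apply/ball_nbhs.
have s2 : 0 < step k / 2 :> R by rewrite divr_gt0// step_gt0.
have [l hl] := step_small s2.
exists (step k / 2) => // y yx p /(_ l) hp; apply: hk; move: hp.
apply: hom_mono => // z [_ -> zy]; exists x => //.
rewrite (_ : z - x = (z - y) + (y - x)); last by vec.
by apply: le_trans (ler_normD _ _) _; lra.
Qed.

End regularization.

(* The value of [Phi] at [x] is squeezed between two opposite cones with
   apex [x], whose images contain limits of the regularization at points
   tending to [x] by lower semicontinuity. *)
Lemma hom_usc {R : realType} {c : nat} (Phi : cconvex R c -> cconvex R c.+1) :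
  lattice_hom Phi -> ~ trivial_map Phi -> (1 < c)%N -> usc_at_points Phi.
Proof.
move=> hom ntr c2.
pose Psi := regularize Phi.
have Phom : lattice_hom Psi := regularize_hom hom.
have Pntr x : ~ (Psi (cconvex1 x) : set _) `<=` (Psi cconvex0 : set _).
  move=> h; apply: (nontrivial_point hom (x := x) ntr).
  apply: subset_trans (regularize_core hom).
  by apply: subset_trans h; exact: sub_regularize.
have Pusc : usc_at_points Psi by move=> x O; exact: regularize_usc.
have i0 : 'I_c by exists 0; exact: ltnW.
pose e : 'rV[R]_c := delta_mx 0 i0.
have dote x : dot e x = x 0 i0.
  rewrite /dot (bigD1 i0)//= mxE !eqxx mul1r big1 ?addr0// => i /negbTE ii0.
  by rewrite mxE ii0 andbF mul0r.
(* Lower semicontinuity of the envelope approximates [p] by values at [x + (t * s) *: e]. A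
   neighbourhood of that point, of radius [t / 2], is the cube of radius [1 / 2] shrunk towards [x],
   so these values lie in the closed set [Phi C]. *)
have cone x s : s = 1 \/ s = -1 ->
  Psi (cconvex1 x) `<=` Phi (Order.join (cconvex1 x) (cube (x + s *: e) (1/2))).
  move=> s1 p Fp; set C := Order.join _ _.
  apply: contrapT => nCp.
  have : open_nbhs p (~` (Phi C : set _)).
    by split=> //; apply: closed_openC; exact: cconvex_closed.
  move=> /open_nbhs_nbhs/ball_nbhs[d d0 hd].
  have /ball_nbhs[d' d'0 hd'] := hom_lsc Phom Pntr Pusc c2 Fp d0.
  pose t := Num.min 1 (d' / (2 * (`|e| + 1))).
  have ne : 0 < `|e| + 1 by rewrite ltr_wpDl.
  have t0 : 0 < t by rewrite lt_min ltr01 divr_gt0// mulr_gt0.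
  have t1 : t <= 1 by rewrite ge_min lexx.
  have ns : `|s| = 1 by case: s1 => ->; rewrite ?normrN normr1.
  have [|q Fq qp] := hd' (x + (t * s) *: e).
    rewrite addrC addKr normrZ normrM ns mulr1 gtr0_norm//.
    have : t * (`|e| + 1) <= d' / 2.
      by rewrite -ler_pdivlMr// ge_min; apply/orP; right; rewrite invfM mulrA.
    by have := ltr_pM2l t0; have := normr_ge0 e; lra.
  apply: (hd _ qp).
  have t2 : 0 < t / 2 by rewrite divr_gt0.
  have [k hk] := step_small t2.
  move: (Fq k); apply: hom_mono => // z [_ -> zy].
  have -> : z = t *: (x + s *: e + t^-1 *: (z - (x + (t * s) *: e))) + (1 - t) *: x.
    by apply/rowP => i; rewrite !mxE; field; rewrite gt_eqF.
  apply: cconvex_conv => //; last first; [exact: ltW|by apply: (@join_subl _ _ (cconvex1 x))|].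
  apply: (@join_subr _ _ (cconvex1 x)) => /=.
  rewrite addrC addKr normrZ gtr0_norm ?invr_gt0// ler_pdivrMl//.
  apply: le_trans zy _; lra.
have PsiE x : Psi (cconvex1 x) `<=` Phi (cconvex1 x).
  move=> p Fp.
  have h1 := cone x 1 (or_introl erefl) _ Fp.
  have h2 := cone x (-1) (or_intror erefl) _ Fp.
  move: (hom_meet hom h1 h2); apply: hom_mono => // v [/= hv hv'].
  (* The radius [1 / 2] is less than the displacement 1, so the cube stays strictly on one side of
     [x] in the [i0]-th coordinate. *)
  have half s : `|s| = 1 -> cube (x + s *: e) (1/2) `<=`
      [set v | v = x \/ dot (s *: e) x < dot (s *: e) v].
    move=> s1 w /= wx; right; rewrite !dotZl !dote.
    have := coord_le_norm (w - (x + s *: e)) i0; rewrite !mxE !eqxx /= mulr1 => h.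
    have : `|s * (w 0 i0 - (x 0 i0 + s))| <= 1/2.
      by rewrite normrM s1; lra.
    move=> /ler_normlP[]; have : s * s = 1 by rewrite -expr2 -real_normK ?num_real// s1 expr1n.
    by rewrite !mulrBr mulrDr; lra.
  have K1 := join_sub (@conv_point_halfspace _ _ (1 *: e) x) (fun w (wx : cconvex_set (cconvex1
    x) w) => or_introl wx) (half 1 (normr1 _)).
  have N1 : `|(-1 : R)| = 1 by rewrite normrN normr1.
  have K2 := join_sub (@conv_point_halfspace _ _ (-1 *: e) x) (fun w (wx : cconvex_set
    (cconvex1 x) w) => or_introl wx) (half (-1) N1).
  have [//|v1] := K1 _ hv; have [//|v2] := K2 _ hv'.
  by exfalso; move: v1 v2; rewrite !dotZl; lra.
move=> x O oO xO.
have : Psi (cconvex1 x) `<=` O by apply: subset_trans (PsiE x) xO.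
move=> /(Pusc x O oO); apply: filterS => y; apply: subset_trans.
exact: sub_regularize.
Qed.

(** * Maps preserving betweenness *)

Section betweenness.
Context {R : realType} {c n : nat}.
Variable phi : 'rV[R]_c -> 'rV[R]_n.
Implicit Types (x y v w : 'rV[R]_c) (u : 'rV[R]_n).

Hypothesis c2 : (1 < c)%N.
Hypothesis phi_between : forall x y (t : R), 0 <= t -> t <= 1 ->
  exists s : R, [/\ 0 <= s, s <= 1 &
    phi (t *: x + (1 - t) *: y) = s *: phi x + (1 - s) *: phi y].
Hypothesis phi_reflect : forall x y z (s : R), 0 <= s -> s <= 1 ->
  phi z = s *: phi x + (1 - s) *: phi y ->
  exists t : R, [/\ 0 <= t, t <= 1 & z = t *: x + (1 - t) *: y].
Hypothesis phi_cont : forall u x (a : R), dot u (phi x) < a ->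
  \forall y \near x, dot u (phi y) < a.

Lemma between_inj : injective phi.
Proof.
move=> x y xy; have [|t [_ _ ->]] := @phi_reflect y y x 1 ler01 (lexx _).
  by rewrite subrr scale0r scale1r addr0.
by rewrite -scalerDl addrC subrK scale1r.
Qed.

(** If the three images were collinear, one of them would lie between the other two, and
    [phi_reflect] would make the three points collinear. The position of [k] relative to 0 and 1
    tells which one is in the middle. *)
Lemma between_indep x v w : indep v w -> indep (phi (x + v) - phi x) (phi (x + w) - phi x).
Proof.
move=> vw.
have v0 : v != 0.
  apply/eqP => v0; have [|/eqP] := vw 1 0; last by rewrite oner_eq0.
  by rewrite v0 scaler0 scale0r addr0.
apply: indepP.
  rewrite subr_eq0; apply/eqP => /between_inj/eqP.
  by rewrite -subr_eq0 addrC addKr (negbTE v0).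
move=> k kE.
have {kE}kE : phi (x + w) = phi x + k *: (phi (x + v) - phi x) by rewrite -kE addrCA subrr addr0.
have [k0|k0] := ltP k 0.
  have [|||t [t0 t1 xE]] := @phi_reflect (x + v) (x + w) x (- k / (1 - k)).
  - by rewrite divr_ge0//; slra.
  - by rewrite ler_pdivrMr; slra.
  - by rewrite kE; apply/rowP => i; rewrite !mxE; field; slra.
  have [|] := vw t (1 - t); last slra.
  by rewrite -[RHS](subrr x) {1}xE; vec.
have [k1|k1] := leP k 1.
  have [|||t [t0 t1 xE]] := @phi_reflect (x + v) x (x + w) k => //.
    by rewrite kE; vec.
  have [|_ /eqP] := vw t (-1); last by rewrite oppr_eq0 oner_eq0.
  by rewrite -[RHS](subrr (x + w)) {1}xE; vec.
have [|||t [t0 t1 xE]] := @phi_reflect (x + w) x (x + v) (k^-1).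
- by rewrite invr_ge0; slra.
- by rewrite invf_le1; slra.
- by rewrite kE; apply/rowP => i; rewrite !mxE; field; slra.
have [|/eqP] := vw (-1) t; last by rewrite oppr_eq0 oner_eq0.
by rewrite -[RHS](subrr (x + v)) {1}xE; vec.
Qed.

(** Among [x], [x + v] and [x + t *: v] one is between the other two. If [x + t *: v] is an outer
    point, injectivity gives it a nonzero weight, so the equation can be solved for its level. *)
Lemma level_line u x v (t : R) : dot u (phi (x + v) - phi x) = 0 ->
  dot u (phi (x + t *: v)) = dot u (phi x).
Proof.
rewrite dotBr => /eqP; rewrite subr_eq0 => /eqP uv.
have [->|v0] := eqVneq v 0; first by rewrite scaler0 addr0.
have [t0|t0] := ltP t 0.
  have [||s [s0 s1]] := @phi_between (x + v) (x + t *: v) (- t / (1 - t)).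
  - by rewrite divr_ge0//; slra.
  - by rewrite ler_pdivrMr; slra.
  have -> : (- t / (1 - t)) *: (x + v) + (1 - - t / (1 - t)) *: (x + t *: v) = x.
    by apply/rowP => i; rewrite !mxE; field; slra.
  move=> xE; have := congr1 (dot u) xE; rewrite dotDr !dotZr uv => uE.
  have s1' : 1 - s != 0.
    apply/eqP => s1'; have : phi x = phi (x + v).
      by rewrite {1}xE s1' scale0r addr0 (_ : s = 1) ?scale1r//; slra.
    move=> /between_inj/eqP; rewrite -subr_eq0 opprD addNKr oppr_eq0.
    by rewrite (negbTE v0).
  apply: (mulfI s1'); slra.
have [t1|t1] := leP t 1.
  have [//|//|s [s0 s1]] := @phi_between (x + v) x t.
  have -> : t *: (x + v) + (1 - t) *: x = x + t *: v by vec.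
  by move=> ->; rewrite dotDr !dotZr uv; ring.
have [||s [s0 s1]] := @phi_between (x + t *: v) x t^-1.
- by rewrite invr_ge0; slra.
- by rewrite invf_le1; slra.
have -> : t^-1 *: (x + t *: v) + (1 - t^-1) *: x = x + v.
  by apply/rowP => i; rewrite !mxE; field; slra.
move=> xE; have := congr1 (dot u) xE; rewrite dotDr !dotZr uv => uE.
have s0' : s != 0.
  apply/eqP => s0'; have : phi (x + v) = phi x.
    by rewrite xE s0' scale0r add0r subr0 scale1r.
  by move=> /between_inj/eqP; rewrite -subr_eq0 addrC addKr (negbTE v0).
apply: (mulfI s0'); slra.
Qed.

(* If [dot u (phi _)] decreased from [x + w] to [x + w + v], then by continuity it
   would also be smaller at [x + w + v + h w] for small [h]; but [x + w] lies
   between that point and the line [x + R v]. *)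
Lemma level_monotone u x v w (a : R) :
  (forall t, dot u (phi (x + t *: v)) = a) -> a < dot u (phi (x + w)) ->
  dot u (phi (x + w)) <= dot u (phi (x + w + v)).
Proof.
move=> ua aw; rewrite leNgt; apply/negP => /phi_cont/ball_nbhs[d d0 hd].
have n0 : 0 < `|w| + 1 by rewrite ltr_wpDl.
pose h := d / (2 * (`|w| + 1)).
have h0 : 0 < h by rewrite divr_gt0// mulr_gt0.
have hw : `|h *: w| < d.
  rewrite normrZ gtr0_norm//; have : h * (`|w| + 1) = d / 2 by rewrite /h; field; slra.
  slra.
have yw := hd (x + w + v + h *: w) _.
have [||s [s0 s1]] := @phi_between (x + w + v + h *: w) (x - h^-1 *: v) (1 + h)^-1.
- by rewrite invr_ge0; slra.
- by rewrite invf_le1; slra.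
have -> : (1 + h)^-1 *: (x + w + v + h *: w) + (1 - (1 + h)^-1) *: (x - h^-1 *: v) = x + w.
  by apply/rowP => i; rewrite !mxE; field; apply/andP; split; slra.
move=> E; suff: dot u (phi (x + w)) < dot u (phi (x + w)) by rewrite ltxx.
rewrite {1}E; apply: conv_dot_lt => //=.
  by apply: yw; rewrite addrC addKr.
by rewrite -scaleNr ua.
Qed.

(** [level_monotone] is used for [u] and [- u], and in both directions along [v]; a change of level
    would contradict one of the four inequalities. *)
Lemma level_translate u x v w : dot u (phi (x + v) - phi x) = 0 ->
  dot u (phi (x + w + v)) = dot u (phi (x + w)).
Proof.
have main u' : dot u' (phi (x + v) - phi x) = 0 ->
    dot u' (phi x) < dot u' (phi (x + w)) -> 
    dot u' (phi (x + w)) <= dot u' (phi (x + w + v)).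
  by move=> uv; apply: level_monotone => t; exact: level_line.
have main' u' : dot u' (phi (x + v) - phi x) = 0 ->
    dot u' (phi x) < dot u' (phi (x + w + v)) -> 
    dot u' (phi (x + w + v)) <= dot u' (phi (x + w)).
  move=> uv; have := @level_monotone u' x (- v) (w + v) (dot u' (phi x)).
  rewrite !addrA addrK; apply => t.
  by rewrite scalerN -scaleNr level_line.
move=> uv; have Nuv : dot (- u) (phi (x + v) - phi x) = 0 by rewrite dotNl uv oppr0.
have := main u uv; have := main' u uv; have := main _ Nuv; have := main' _ Nuv.
rewrite !dotNl !ltrN2 !lerN2.
case: (ltgtP (dot u (phi x)) (dot u (phi (x + w)))) => h1;
  case: (ltgtP (dot u (phi x)) (dot u (phi (x + w + v)))) => h2 a1 a2 a3 a4; try slra.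
all: try (have := a1 isT; slra); try (have := a2 isT; slra);
  try (have := a3 isT; slra); try (have := a4 isT; slra).
all: have := a1 isT; have := a2 isT; have := a3 isT; have := a4 isT; slra.
Qed.

Lemma between_parallel x v w : exists k,
  phi (x + w + v) - phi (x + w) = k *: (phi (x + v) - phi x).
Proof.
apply: contrapT => /forallNP h; have [u [u0 u1]] := dual_vector h.
by move: u1; rewrite dotBr (level_translate _ u0) subrr => /esym/eqP; rewrite oner_eq0.
Qed.

(** Opposite sides have proportional images. The two sides at a vertex have independent images,
    which forces both ratios to be 1. *)
Lemma between_parallelogram x v w : indep v w ->
  phi (x + v + w) = phi (x + v) + phi (x + w) - phi x.
Proof.
move=> vw; have [k kE] := between_parallel x v w; have [l lE] := between_parallel x w v.
have [] := @between_indep x _ _ vw (1 - k) (l - 1).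
  rewrite scalerBl scalerBl !scale1r -kE -lE (addrAC x); vec.
move=> /eqP; rewrite subr_eq0 => /eqP k1 _; move: kE; rewrite -k1 scale1r (addrAC x).
by move=> /eqP; rewrite subr_eq => /eqP ->; vec.
Qed.

Let f v := phi v - phi 0.

Let f0 : f 0 = 0. Proof. exact: subrr. Qed.

Let f_add_indep v w : indep v w -> f (v + w) = f v + f w.
Proof.
by move=> /(between_parallelogram 0); rewrite !add0r /f => ->; vec.
Qed.

(** For proportional arguments an auxiliary direction [t], orthogonal to [v], is added so that every
    sum involved has independent terms, and is cancelled at the end. *)
Let f_add v w : f (v + w) = f v + f w.
Proof.
have [->|v0] := eqVneq v 0; first by rewrite f0 !add0r.
have [[k ->]|nk] := pselect (exists k, w = k *: v); last first.
  by apply: f_add_indep; apply: indepP => // k kE; apply: nk; exists k.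
have [t t0 vt] := orthogonal_vector v c2.
have vti : indep v t.
  apply: indepP => // a ta; move/eqP: t0; apply; move: vt; rewrite ta dotZr.
  by move=> /eqP; rewrite mulf_eq0 dot_eq0 (negbTE v0) orbF => /eqP ->; rewrite scale0r.
have f_t a : f (a *: v + t) = f (a *: v) + f t.
  have [->|a0] := eqVneq a 0; first by rewrite scale0r f0 !add0r.
  apply: f_add_indep => p q; rewrite scalerA => /vti[/eqP].
  by rewrite mulf_eq0 (negbTE a0) orbF => /eqP -> ->.
apply: (addIr (f t)); rewrite -[RHS]addrA -(f_t k) -(@f_add_indep v); last first.
  move=> p q pq; have [|h1 h2] := vti (p + q * k) q.
    by rewrite -[RHS]pq; vec.
  by split => //; move: h1; rewrite h2 mul0r addr0.
have -> : v + k *: v = (1 + k) *: v by vec.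
by rewrite -f_t; congr f; vec.
Qed.

Let f_natmul k v : f (k%:R *: v) = k%:R *: f v.
Proof.
elim: k => [|k IH]; first by rewrite !scale0r f0.
by rewrite -natr1 !scalerDl !scale1r f_add IH.
Qed.

Let f_approx (t : R) v : 0 <= t -> exists2 s, `|s - t| <= 1 & f (t *: v) = s *: f v.
Proof.
move=> t0; have /andP[kt tk] := truncn_itv t0.
set k := Num.truncn t in kt tk.
have [||s [s0 s1 sE]] := @phi_between v 0 (t - k%:R).
- lra.
- by rewrite -natr1 in tk; lra.
exists (k%:R + s).
  by rewrite -natr1 in tk; rewrite ler_norml; apply/andP; split; lra.
have -> : f (t *: v) = k%:R *: f v + f ((t - k%:R) *: v).
  by rewrite -f_natmul -f_add; congr f; vec.
have : f ((t - k%:R) *: v) = phi ((t - k%:R) *: v + (1 - (t - k%:R)) *: 0) - phi 0.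
  by rewrite scaler0 addr0.
by move=> ->; rewrite sE /f; vec.
Qed.

(** [f_approx] bounds the error by 1 for every multiple [k%:R * t] too, hence the error for [t] by
    [1 / k] for all [k]. *)
Let f_scale_ge0 (t : R) v : 0 <= t -> f (t *: v) = t *: f v.
Proof.
move=> t0; have [->|v0] := eqVneq v 0; first by rewrite scaler0 f0 scaler0.
have fv : f v != 0 by rewrite subr_eq0; apply: contra v0 => /eqP/between_inj ->.
have [s _ sE] := f_approx v t0; rewrite sE; congr (_ *: _).
have bound k : k%:R * `|s - t| <= 1.
  have kt : 0 <= k%:R * t by rewrite mulr_ge0.
  have [r rt rE] := f_approx v kt.
  have : r = k%:R * s.
    apply/eqP; rewrite -subr_eq0; move: fv; apply: contraNT => rs.
    apply/eqP/(scalerI rs); rewrite scaler0 scalerBl -rE -!scalerA -sE f_natmul subrr //.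
  by move=> rE'; move: rt; rewrite rE' -mulrBr normrM normr_nat.
apply/eqP; rewrite -subr_eq0 -normr_le0 leNgt; apply/negP => st.
have := bound (Num.truncn `|s - t|^-1).+1.
have := truncnS_gt `|s - t|^-1.
have st' : 0 <= `|s - t|^-1 by rewrite invr_ge0 ltW.
move=> h; have : `|s - t|^-1 * `|s - t| < (Num.truncn `|s - t|^-1).+1%:R * `|s - t|.
  by rewrite ltr_pM2r.
rewrite mulVf ?gt_eqF//; slra.
Qed.

Lemma between_affine : affine_map phi.
Proof.
have f_scale (t : R) v : f (t *: v) = t *: f v.
  have [t0|t0] := leP 0 t; first exact: f_scale_ge0.
  have Nt : 0 <= - t by lra.
  apply/eqP; rewrite -subr_eq0; apply/eqP.
  have fN : f (t *: v) + f ((- t) *: v) = 0 by rewrite -f_add -scalerDl subrr scale0r f0.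
  by rewrite -[RHS]fN (f_scale_ge0 _ Nt) scaleNr.
move=> t x y; apply: (addIr (- phi 0)).
rewrite -/(f _) f_add !f_scale /f; vec.
Qed.

End betweenness.

(** * The images of the points *)

Section structure.
Context {R : realType} {c : nat}.
Variable Phi : cconvex R c -> cconvex R c.+1.
Implicit Types (x y z w : 'rV[R]_c) (u p q a b o : 'rV[R]_c.+1).

Local Notation F x := (Phi (cconvex1 x) : set _).
Local Notation S := (Phi cconvex0 : set _).

Hypothesis hom : lattice_hom Phi.
Hypothesis ntr : forall x, ~ F x `<=` S.
Hypothesis usc : usc_at_points Phi.
Hypothesis c3 : (2 < c)%N.

Let c2 : (1 < c)%N. Proof. exact: ltnW. Qed.

Let F_conv x p q (t : R) : F x p -> F x q -> 0 <= t -> t <= 1 ->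
  F x (t *: p + (1 - t) *: q).
Proof. exact: cconvex_conv. Qed.

Lemma hom_outside_core x : exists2 a, F x a & ~ S a.
Proof. by apply: contrapT => /forall2NP h; apply: (@ntr x) => a Fa; have [//|/contrapT] := h a. Qed.

Lemma hom_lsc_open (O : set 'rV[R]_c.+1) x p : open O -> F x p -> O p ->
  \forall y \near x, exists2 q, F y q & O q.
Proof.
move=> oO Fp /(open_ball_sub oO)[d d0 hd].
apply: filterS (hom_lsc hom ntr usc c2 Fp d0) => y [q Fq qp].
by exists q => //; exact: hd.
Qed.

(** For affinely independent [w i] the condition of [hom_radon] on their dependences is vacuous, so
    the empty set can serve as [C]. *)
Lemma hom_dependence (I : finType) (w : I -> 'rV[R]_c) (p : I -> 'rV[R]_c.+1)
    (m : I -> R) :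
  (forall k : I -> R, \sum_i k i = 0 -> \sum_i k i *: w i = 0 -> forall i, k i = 0) ->
  (forall i, F (w i) (p i)) ->
  (exists i, m i != 0) -> \sum_i m i = 0 -> \sum_i m i *: p i = 0 ->
  exists l : I -> R, \sum_i l i = 1 /\ S (\sum_i l i *: p i).
Proof.
move=> wi Fp m0 m1 m2.
have [|l [_ l1 Sl]] := hom_radon hom (C := cconvex0) Fp m0 m1 m2; last by exists l.
move=> k k1 k2; under eq_bigr do rewrite wi// maxxx.
by rewrite big1// => /esym/eqP; rewrite oner_eq0.
Qed.

(* Four points of [F x] on the four sides of a subspace of codimension 2 force
   all the [F y] with [y] near [x] to meet that subspace, which has no room for
   the images of [c + 1] affinely independent points. *)
Lemma no_crossing x u v (g h : R) p1 p2 p3 p4 :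
  (forall s t : R, s *: u + t *: v = 0 -> s = 0 /\ t = 0) ->
  (forall q, S q -> dot v q < h) ->
  F x p1 -> dot u p1 < g -> h < dot v p1 ->
  F x p2 -> dot u p2 < g -> dot v p2 < h ->
  F x p3 -> g < dot u p3 -> h < dot v p3 ->
  F x p4 -> g < dot u p4 -> dot v p4 < h -> False.
Proof.
move=> uv Sh F1 u1 v1 F2 u2 v2 F3 u3 v3 F4 u4 v4.
have near1 p (P Q : set _) : F x p -> open P -> open Q -> P p -> Q p ->
    \forall y \near x, exists2 q, F y q & P q /\ Q q.
  by move=> Fp oP oQ Pp Qp; apply: (@hom_lsc_open (P `&` Q) _ p) => //; exact: openI.
have [d d0 hd] : exists2 d : R, 0 < d & forall y, `|y - x| < d ->
    exists2 q, F y q & dot u q = g /\ dot v q = h.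
  apply/ball_nbhs.
  have n1 := near1 _ _ _ F1 (@open_dot_lt _ _ u g) (@open_dot_gt _ _ v h) u1 v1.
  have n2 := near1 _ _ _ F2 (@open_dot_lt _ _ u g) (@open_dot_lt _ _ v h) u2 v2.
  have n3 := near1 _ _ _ F3 (@open_dot_gt _ _ u g) (@open_dot_gt _ _ v h) u3 v3.
  have n4 := near1 _ _ _ F4 (@open_dot_gt _ _ u g) (@open_dot_lt _ _ v h) u4 v4.
  apply: filterS (filterI (filterI n1 n2) (filterI n3 n4)) => y.
  move=> [[[q1 G1 [/ltW U1 V1]] [q2 G2 [/ltW U2 V2]]]].
  move=> [[q3 G3 [/ltW U3 V3]] [q4 G4 [/ltW U4 V4]]].
  (* Three intermediate values: [r1] has level [g] for [u] above [h], [r2] has level [g] below [h],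
     and between them some [r] has level [h] for [v]. *)
  have [r1 [H1 W1] e1] := conv_level (u := u) (a := g)
    (K := F y `&` [set p | h < dot v p])
    (fun p q t Kp Kq t0 t1 => conj (F_conv Kp.1 Kq.1 t0 t1) (@conv_dot_gt _ _ v h _ _ _ Kp.2
      Kq.2 t0 t1))
    (conj G1 V1) (conj G3 V3) U1 U3.
  have [r2 [H2 W2] e2] := conv_level (u := u) (a := g)
    (K := F y `&` [set p | dot v p < h])
    (fun p q t Kp Kq t0 t1 => conj (F_conv Kp.1 Kq.1 t0 t1) (@conv_dot_lt _ _ v h _ _ _ Kp.2
      Kq.2 t0 t1))
    (conj G2 V2) (conj G4 V4) U2 U4.
  have [r [Hr er] ev] := conv_level (u := v) (a := h)
    (K := F y `&` [set p | dot u p = g])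
    (fun p q t Kp Kq t0 t1 => conj (F_conv Kp.1 Kq.1 t0 t1) (conv_dot_eq t Kp.2 Kq.2))
    (conj H2 e2) (conj H1 e1) (ltW W2) (ltW W1).
  by exists r.
pose w (i : 'I_c + unit) := if i is inl j then x + (d / 2) *: delta_mx 0 j else x.
have /choice[p hp] i : exists q, F (w i) q /\ (dot u q = g /\ dot v q = h).
  have [|q Fq [qu qv]] := hd (w i); last by exists q.
  case: i => [j|[]] /=; last by rewrite subrr normr0.
  rewrite addrC addKr normrZ gtr0_norm ?divr_gt0//.
  have : `|delta_mx 0 j : 'rV[R]_c| <= 1.
    by apply: row_norm_le => // i'; rewrite mxE; case: (_ && _); rewrite ?normr1 ?normr0.
  have d2 : 0 < d / 2 by rewrite divr_gt0.
  by rewrite -(ler_pM2l d2); slra.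
have [|m [m0 m1 m2]] := codim2_dep uv (fun i => (hp i).2).
  by rewrite card_sum card_ord card_unit addn1.
have [||l [l1 /Sh]] := @hom_dependence _ w p m _ _ m0 m1 m2.
- move=> k; rewrite !sum_unit => k1.
  rewrite (eq_bigr (fun j => k (inl j) *: x + (k (inl j) * (d / 2)) *: delta_mx 0 j)) => [|j
    _]; last first.
    by rewrite scalerDr scalerA.
  rewrite big_split /= -scaler_suml addrAC -scalerDl k1 scale0r add0r => k2.
  have kj j : k (inl j) = 0.
    move/rowP: k2 => /(_ j); rewrite summxE mxE (bigD1 j)//= big1 => [|i /negbTE ij].
      rewrite !mxE !eqxx mulr1 addr0 => /eqP; rewrite mulf_eq0 => /orP[/eqP//|].
      by rewrite gt_eqF ?divr_gt0.
    by rewrite !mxE eq_sym ij andbF mulr0.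
  case=> [j|[]]; first exact: kj.
  by move: k1; rewrite big1 ?add0r.
- by move=> i; case: (hp i).
rewrite dot_sumr (eq_bigr (fun i => l i * h)) => [|i _].
  by rewrite -mulr_suml l1 mul1r ltxx.
by rewrite dotZr; have [_ [_ ->]] := hp i.
Qed.

(** Were [b] off the line, take [v] constant on the line and larger at [b]. Moving [a] and [o]
    slightly towards [b] gives four points of [F x] around a subspace of codimension 2, cut out by
    [v] and by a level of [u] above [S]. *)
Lemma hom_collinear x a o b u (al : R) : F x a -> F x o -> F x b ->
  dot u o < dot u a -> (forall q, S q -> dot u q <= al) -> al < dot u a ->
  exists k : R, b = a + k *: (o - a).
Proof.
move=> Fa Fo Fb uoa Sal ala.
suff [k kE] : exists k, b - a = k *: (o - a) by exists k; rewrite -kE addrC subrK.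
apply: contrapT => /forallNP h; have [v [vo vb]] := dual_vector h.
set M := Num.max (dot u o) al.
have oM : dot u o <= M by rewrite le_max lexx.
have alM : al <= M by rewrite le_max lexx orbT.
have Ma : M < dot u a by rewrite gt_max uoa ala.
pose g := (M + dot u a) / 2.
have go : dot u o < g by rewrite /g; slra.
have gal : al < g by rewrite /g; slra.
have ga : g < dot u a by rewrite /g; slra.
pose eta := Num.min (dot u a - g) (g - dot u o).
have eta0 : 0 < eta by rewrite lt_min !subr_gt0 ga go.
have etal : eta <= dot u a - g by rewrite ge_min lexx.
have etar : eta <= g - dot u o by rewrite ge_min lexx orbT.
pose D := `|dot u b - dot u a| + `|dot u b - dot u o| + eta.
have D0 : 0 < D by rewrite ltr_wpDl// addr_ge0.
pose t := eta / (2 * D).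
have t0 : 0 < t by rewrite divr_gt0// mulr_gt0.
have tD : t * D = eta / 2 by rewrite /t; field; slra.
have t1 : t <= 1 / 2.
  have : t * eta <= eta / 2.
    rewrite -tD ler_wpM2l ?(ltW t0)// /D lerDr addr_ge0//.
  by rewrite mulrC -[in X in _ <= X -> _](mul1r eta) => ?; rewrite -(ler_pM2l eta0); slra.
have tbound r : `|r| <= D -> `|t * r| < eta.
  by move=> rD; rewrite normrM (gtr0_norm t0); have := ler_wpM2l (ltW t0) rD; slra.
have /ltr_normlP[b1 b2] : `|t * (dot u b - dot u a)| < eta.
  by apply: tbound; rewrite /D -addrA lerDl addr_ge0// ltW.
have /ltr_normlP[b3 b4] : `|t * (dot u b - dot u o)| < eta.
  by apply: tbound; rewrite /D addrAC lerDr addr_ge0// ltW.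
have vo' : dot v o = dot v a by move: vo; rewrite dotBr; slra.
have vb' : dot v b = dot v a + 1 by move: vb; rewrite dotBr; slra.
apply: (@no_crossing x v u (dot v a + t / 2) g a o
  (t *: b + (1 - t) *: a) (t *: b + (1 - t) *: o)) => //.
- move=> r s rs.
  have := congr1 (fun e => dot e (o - a)) rs; rewrite /= dotDl !dotZl vo mulr0 add0r.
  rewrite [RHS]dotC dot0r => /eqP; rewrite mulf_eq0 dotBr subr_eq0 (lt_eqF uoa) orbF => /eqP s0.
  have := congr1 (fun e => dot e (b - a)) rs; rewrite /= dotDl !dotZl vb s0 mul0r addr0 mulr1.
  by rewrite [RHS]dotC dot0r.
- by move=> q /Sal; slra.
- slra.
- slra.
- by apply: F_conv => //; slra.
- by rewrite dotDr !dotZr vb' ?vo'; slra.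
- by rewrite dotDr !dotZr; slra.
- by apply: F_conv => //; slra.
- by rewrite dotDr !dotZr vb' ?vo'; slra.
- by rewrite dotDr !dotZr; slra.
Qed.

(** By convexity the point lies in the image of the segment from [x] to [y]; if [w] were off that
    segment, it would lie in the image of an empty meet. *)
Lemma hom_reflect x y w p q (s : R) : F x p -> F y q -> 0 <= s -> s <= 1 ->
  F w (s *: p + (1 - s) *: q) -> ~ S (s *: p + (1 - s) *: q) ->
  exists t : R, [/\ 0 <= t, t <= 1 & w = t *: x + (1 - t) *: y].
Proof.
move=> Fp Fq s0 s1 Fw nS; apply: join_point_seg; apply: contrapT => nw; apply: nS.
pose J := Order.join (cconvex1 x) (cconvex1 y).
have Jr : cconvex_set (Phi J) (s *: p + (1 - s) *: q).
  apply: cconvex_conv => //.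
    by apply: hom_point_in Fp => //; apply: (@join_subl _ _ (cconvex1 x)).
  by apply: hom_point_in Fq => //; apply: (@join_subr _ _ _ (cconvex1 y)).
by have := hom_meet hom Jr Fw; apply: hom_mono => // v [Jv vw]; apply: nw; rewrite -vw.
Qed.

(** [v] singles out the end of [F x]. For [y] near [x], lower semicontinuity gives a point of [F y]
    beyond [th], so [phi y] is beyond [th] too, and upper semicontinuity then bounds
    [dot u (phi y)]. *)
Lemma end_continuous (phi : 'rV[R]_c -> 'rV[R]_c.+1) u v x (th al : R) :
  (forall y, F y (phi y)) ->
  (forall p, F x p -> dot v p < th \/ dot u p < al) ->
  th < dot v (phi x) ->
  (forall y p, F y p -> th < dot v p -> th < dot v (phi y)) ->
  \forall y \near x, dot u (phi y) < al.
Proof.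
move=> Fphi Fx wx wy.
have := usc (openU (@open_dot_lt _ _ v th) (@open_dot_lt _ _ u al)) Fx.
apply: filterS2 (hom_lsc_dot hom ntr usc c2 (Fphi x) wx) => y [q Fq wq].
by move=> /(_ _ (Fphi y))[/=|//]; have := wy _ _ Fq wq; slra.
Qed.

Lemma end_affine (phi : 'rV[R]_c -> 'rV[R]_c.+1) :
  (forall x, F x (phi x)) -> (forall x, ~ S (phi x)) ->
  (forall x y (t : R), x <> y -> 0 <= t -> t <= 1 -> exists s : R, [/\ 0 <= s, s <= 1 &
    phi (t *: x + (1 - t) *: y) = s *: phi x + (1 - s) *: phi y]) ->
  (forall u x (al : R), dot u (phi x) < al -> \forall y \near x, dot u (phi y) < al) ->
  affine_map phi.
Proof.
move=> Fphi nS betw cont; apply: between_affine => // [x y t t0 t1|x y z s s0 s1 zE].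
  have [->|/eqP xy] := eqVneq x y; last exact: betw.
  exists 1; split=> //; rewrite subrr scale1r scale0r addr0; congr phi.
  by rewrite -scalerDl addrC subrK scale1r.
have Fz := Fphi z; have nSz := nS z; rewrite zE in Fz nSz.
exact: (hom_reflect (Fphi x) (Fphi y) s0 s1 Fz nSz).
Qed.

(* [F x] is the segment from [o + s x (phi x - o)] to [phi x], and distinct points
   lie on distinct lines through [o]. *)
Definition cone_form o (phi : 'rV[R]_c -> 'rV[R]_c.+1) (s : 'rV[R]_c -> R) :=
  [/\ forall x, 0 <= s x < 1,
      forall x p, F x p <-> exists t, [/\ s x <= t, t <= 1 & p = o + t *: (phi x - o)],
      forall x, ~ S (phi x) &
      forall x y, x <> y -> indep (phi x - o) (phi y - o)].

(** * Nonempty [S]: segments issued from one point *)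

Section core_nonempty.
Variable o : 'rV[R]_c.+1.
Hypothesis So : S o.

Let Fo x : F x o. Proof. exact: hom_core_sub. Qed.

Let core_line x a b : F x a -> ~ S a -> F x b -> exists k, b = o + k *: (a - o).
Proof.
move=> Fa nSa Fb.
have [u [al [h1 h2]]] := sep_point (@cconvex_closed _ _ _) (@cconvex_conv _ _ _) nSa.
have [||k kE] := @hom_collinear x a o b u al Fa (Fo x) Fb _ _ h2.
- by have := h1 _ So; slra.
- by move=> q /h1/ltW.
by exists (1 - k); rewrite kE; vec.
Qed.

(** If [a] and [b] were on one ray from [o], the nearer one would belong to both [F x] and [F y],
    hence to [S]. *)
Let core_ray x y a b k : x <> y -> F x a -> ~ S a -> F y b -> ~ S b ->
  0 < k -> b <> o + k *: (a - o).
Proof.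
move=> xy Fa nSa Fb nSb k0 bE.
have [k1|k1] := leP k 1.
  apply/nSb/(hom_point_disj hom xy _ Fb).
  rewrite bE (_ : _ + _ = k *: a + (1 - k) *: o); last by vec.
  by apply: F_conv => //; exact: ltW.
apply/nSa/(hom_point_disj hom xy Fa).
have -> : a = k^-1 *: b + (1 - k^-1) *: o.
  by rewrite bE; apply/rowP => i; rewrite !mxE; field; rewrite gt_eqF.
by apply: F_conv => //; rewrite ?invr_ge0 ?invf_le1 ?ltW.
Qed.

Let nonzero_vector : exists e : 'rV[R]_c, e != 0.
Proof. by have [e e0 _] := orthogonal_vector (0 : 'rV[R]_c) c2; exists e. Qed.

(** A second point of [S] would put all the sets [F x] on one line. Of three points outside [S],
    taken from [F 0], [F e] and [F (- e)], two would then be on the same side of [o], against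
    [core_ray]. *)
Let core_singleton q : S q -> q = o.
Proof.
move=> Sq; apply: contrapT => qo.
have [e e0] := nonzero_vector.
have [a1 F1 n1] := hom_outside_core 0.
have [a2 F2 n2] := hom_outside_core e.
have [a3 F3 n3] := hom_outside_core (- e).
have coef x a : F x a -> ~ S a -> exists2 k, k != 0 & a = o + k *: (q - o).
  move=> Fa nSa; have [k kE] := core_line Fa nSa (hom_core_sub hom _ Sq).
  have k0 : k != 0 by apply/eqP => k0; apply: qo; rewrite kE k0 scale0r addr0.
  exists k^-1; rewrite ?invr_eq0// kE; apply/rowP => i; rewrite !mxE; field.
  by [].
have [k1 k10 E1] := coef _ _ F1 n1; have [k2 k20 E2] := coef _ _ F2 n2.
have [k3 k30 E3] := coef _ _ F3 n3.
have opp x y a b k l : x <> y -> F x a -> ~ S a -> F y b -> ~ S b ->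
   k != 0 -> a = o + k *: (q - o) -> b = o + l *: (q - o) -> l / k <= 0.
  move=> xy Fa na Fb nb k0 aE bE; rewrite leNgt; apply/negP => lk.
  apply: (core_ray xy Fa na Fb nb lk); rewrite aE bE.
  by apply/rowP => i; rewrite !mxE; field.
have h12 : k2 / k1 <= 0.
  by apply: opp F1 n1 F2 n2 k10 E1 E2 => /esym/eqP; rewrite (negbTE e0).
have h13 : k3 / k1 <= 0.
  by apply: opp F1 n1 F3 n3 k10 E1 E3 => /esym/eqP; rewrite oppr_eq0 (negbTE e0).
have h23 : k3 / k2 <= 0.
  apply: opp F2 n2 F3 n3 k20 E2 E3 => /eqP; rewrite -addr_eq0 -mulr2n -scaler_nat.
  by rewrite scaler_eq0 pnatr_eq0 (negbTE e0).
have : 0 <= (k2 / k1) * (k3 / k1) by rewrite mulr_le0.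
have -> : (k2 / k1) * (k3 / k1) = (k2 / k1) ^+ 2 * (k3 / k2) by field; apply/andP.
rewrite pmulr_rge0; last by rewrite exprn_even_gt0//= mulf_neq0 ?invr_eq0.
move=> h; have /eqP : k3 / k2 = 0 by apply/eqP; rewrite eq_le h23 h.
by rewrite mulf_eq0 invr_eq0 (negbTE k30) (negbTE k20).
Qed.

(** Suppose [a] and [b] are on opposite sides of [o], and take [q] in another set [F y], off their
    line. For the midpoint [z], [F z] meets the segments from [a] and from [b] to [q] in points of
    one line through [o]; the signs force such a point to be [a] or [q], hence in [S]. *)
Let core_one_sided x a b k : F x a -> ~ S a -> F x b -> b = o + k *: (a - o) -> 0 <= k.
Proof.
move=> Fa nSa Fb bE; rewrite leNgt; apply/negP => k0.
have kn0 : k != 0 by rewrite lt_eqF.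
have ao : a - o != 0 by rewrite subr_eq0; apply/eqP => ao; apply: nSa; rewrite ao.
have nSb : ~ S b.
  move=> /core_singleton/eqP; rewrite bE -subr_eq0 addrC addKr scaler_eq0.
  by rewrite (negbTE kn0) (negbTE ao).
have [e e0] := nonzero_vector.
pose y := x + e.
have xy : x <> y by move=> /eqP; rewrite -subr_eq0 /y opprD addNKr oppr_eq0 (negbTE e0).
have [q Fq nSq] := hom_outside_core y.
have aq : indep (a - o) (q - o).
  apply: indepP => // j jE.
  have qE : q = o + j *: (a - o) by rewrite -jE addrC subrK.
  have [j0|j0|j0] := ltgtP j 0.
  - have jk : 0 < j / k by rewrite nmulr_rgt0// invr_lt0.
    apply: (core_ray xy Fb nSb Fq nSq jk); rewrite qE bE.
    by apply/rowP => i; rewrite !mxE; field.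
  - exact: (core_ray xy Fa nSa Fq nSq j0).
  - by apply: nSq; rewrite qE j0 scale0r addr0.
have h0 : 0 <= 1/2 :> R by slra.
have h1 : 1/2 <= 1 :> R by slra.
pose z := (1/2) *: x + (1 - 1/2) *: y.
have xz : x <> z.
  move=> xz; apply: xy; apply/rowP => i; move/rowP: xz => /(_ i).
  by rewrite /z !mxE; slra.
have yz : y <> z.
  move=> yz; apply: xy; apply/rowP => i; move/rowP: yz => /(_ i).
  by rewrite /z !mxE; slra.
have [s [s0 s1 Fr]] := between_points hom ntr usc c2 Fa Fq h0 h1.
have [s' [s'0 s'1 Fr']] := between_points hom ntr usc c2 Fb Fq h0 h1.
rewrite -/z in Fr Fr'.
set r := s *: a + _ in Fr; set r' := s' *: b + _ in Fr'.
have rE : r - o = s *: (a - o) + (1 - s) *: (q - o) by rewrite /r; vec.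
have r'E : r' - o = (s' * k) *: (a - o) + (1 - s') *: (q - o) by rewrite /r' bE; vec.
have nSr : ~ S r.
  move=> /core_singleton ro; have [|] := aq s (1 - s); last slra.
  by rewrite -rE ro subrr.
have [m mE] := core_line Fr nSr Fr'.
have [|e1 e2] := aq (m * s - s' * k) (m * (1 - s) - (1 - s')).
  transitivity (m *: (r - o) - (r' - o)); first by rewrite rE r'E; vec.
  by rewrite mE (addrC o) addrK subrr.
have [s1'|s1'] := eqVneq s 1.
  apply: nSr; apply: (hom_point_disj hom xz _ Fr).
  by rewrite /r s1' scale1r subrr scale0r addr0.
have sk : s' * k <= 0 := mulr_ge0_le0 s'0 (ltW k0).
have m0 : 0 <= m.
  rewrite -(pmulr_lge0 _ (_ : 0 < 1 - s)); first by slra.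
  by rewrite subr_gt0 lt_neqAle s1' s1.
have ms : 0 <= m * s by rewrite mulr_ge0.
have /eqP : s' * k = 0 by slra.
rewrite mulf_eq0 (negbTE kn0) orbF => /eqP s'0'.
have /eqP : m * s = 0 by move: e1; rewrite s'0'; slra.
rewrite mulf_eq0 => /orP[/eqP m0'|/eqP s0'].
  by move: e2; rewrite m0' s'0'; slra.
apply: nSr; apply: (hom_point_disj hom yz _ Fr).
by rewrite /r s0' scale0r add0r subr0 scale1r.
Qed.

Lemma core_cone_form : exists phi, cone_form o phi (fun=> 0).
Proof.
have h x : exists a, [/\ F x a, ~ S a & forall b, F x b ->
    exists t, [/\ 0 <= t, t <= 1 & b = o + t *: (a - o)]].
  have [a0 Fa0 nSa0] := hom_outside_core x.
  pose u := a0 - o.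
  have u0 : 0 < dot u u.
    apply: dot_gt0; rewrite subr_eq0; apply/eqP => ao.
    by apply: nSa0; rewrite ao.
  have [a Fa amax] := compact_dot_max u (@cconvex_compact _ _ (Phi (cconvex1 x))) (ex_intro _ o
    (Fo x)).
  have [k kE] := core_line Fa0 nSa0 Fa.
  have k1 : 1 <= k.
    have ua0 : dot u a0 = dot u o + dot u u by rewrite -dotDr addrCA subrr addr0.
    have := amax _ Fa0; rewrite ua0 kE dotDr dotZr -/u lerD2l.
    by rewrite ler_pMl.
  exists a; split=> // [/core_singleton ao|b Fb].
    move: kE; rewrite ao -[LHS]addr0 => /addrI/esym/eqP.
    by rewrite scaler_eq0 -(dot_eq0 u) (gt_eqF u0) orbF => /eqP; slra.
  have [j jE] := core_line Fa0 nSa0 Fb.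
  have j0 := core_one_sided Fa0 nSa0 Fb jE.
  have jk : j <= k.
    by have := amax _ Fb; rewrite kE jE !dotDr !dotZr -/u lerD2l ler_pM2r.
  have kp : 0 < k by slra.
  exists (j / k); split; first by rewrite divr_ge0// ltW.
    by rewrite ler_pdivrMr// mul1r.
  by rewrite kE jE; apply/rowP => i; rewrite !mxE; field; rewrite gt_eqF.
have /choice[phi hphi] := h.
have Fphi x : F x (phi x) by have [] := hphi x.
have nSphi x : ~ S (phi x) by have [] := hphi x.
have phi0 x : phi x - o != 0.
  by rewrite subr_eq0; apply/eqP => po; apply: (nSphi x); rewrite po.
exists phi; split=> // [x|x p|x y xy]; first by rewrite lexx ltr01.
  have [_ _ hx] := hphi x; split=> [/hx//|[t [t0 t1 ->]]].
  rewrite (_ : _ + _ = t *: phi x + (1 - t) *: o); last by vec.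
  by apply: F_conv.
apply: indepP => // k kE.
have yE : phi y = o + k *: (phi x - o) by rewrite -kE addrC subrK.
have [k0|k0|k0] := ltgtP k 0; last 2 first.
- exact: (core_ray xy (Fphi x) (nSphi x) (Fphi y) (nSphi y) k0).
- by move/eqP: (phi0 y); rewrite kE k0 scale0r.
(* If [phi x] and [phi y] were on opposite rays, [F z] would lie on their common line, so [phi z]
   would share a ray with one of them. *)
pose z := (1/2) *: x + (1 - 1/2) *: y.
have xz : x <> z.
  move=> xz; apply: xy; apply/rowP => i; move/rowP: xz => /(_ i).
  by rewrite /z !mxE; slra.
have yz : y <> z.
  move=> yz; apply: xy; apply/rowP => i; move/rowP: yz => /(_ i).
  by rewrite /z !mxE; slra.
pose K := [set p | exists t, p = o + t *: (phi x - o)].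
have cK : conv_closed K.
  move=> _ _ s [t ->] [t' ->] _ _; exists (s * t + (1 - s) * t'); vec.
have [||||t tE] := @hom_segment_sub _ _ _ _ hom x y (1/2) K cK _ _ _ _ _ (Fphi z).
- slra.
- slra.
- by move=> p; have [_ _ hx] := hphi x => /hx[t [_ _ ->]]; exists t.
- move=> p; have [_ _ hy] := hphi y => /hy[t [_ _ ->]]; exists (t * k).
  by rewrite yE; vec.
have [t0|t0|t0] := ltgtP t 0.
- have tk : 0 < t / k by rewrite nmulr_rgt0// invr_lt0.
  apply: (core_ray yz (Fphi y) (nSphi y) (Fphi z) (nSphi z) tk); rewrite yE tE.
  by apply/rowP => i; rewrite !mxE; field; rewrite lt_eqF.
- exact: (core_ray xz (Fphi x) (nSphi x) (Fphi z) (nSphi z) t0).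
- by apply: (nSphi z); rewrite tE t0 scale0r addr0.
Qed.

End core_nonempty.
End structure.

(** * Empty [S]: points, concurrent segments or parallel segments *)

Section core_empty.
Context {R : realType} {c : nat}.
Variable Phi : cconvex R c -> cconvex R c.+1.
Implicit Types (x y z w : 'rV[R]_c) (u p q a b o : 'rV[R]_c.+1).

Local Notation F x := (Phi (cconvex1 x) : set _).
Local Notation S := (Phi cconvex0 : set _).

Hypothesis hom : lattice_hom Phi.
Hypothesis ntr : forall x, ~ F x `<=` S.
Hypothesis usc : usc_at_points Phi.
Hypothesis c3 : (2 < c)%N.
Hypothesis S0 : forall q, ~ S q.

Let c2 : (1 < c)%N. Proof. exact: ltnW. Qed.

Let F_conv x p q (t : R) : F x p -> F x q -> 0 <= t -> t <= 1 ->
  F x (t *: p + (1 - t) *: q).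
Proof. exact: cconvex_conv. Qed.

Let disj x y p : x <> y -> F x p -> ~ F y p.
Proof. by move=> xy Fx Fy; apply: (@S0 p); apply: hom_point_disj Fx Fy. Qed.

Definition parallel_form v (phi : 'rV[R]_c -> 'rV[R]_c.+1) (r : 'rV[R]_c -> R) :=
  [/\ forall x, 0 < r x,
      forall x p, F x p <-> exists t, [/\ 0 <= t, t <= r x & p = phi x + t *: v] &
      forall x y, x <> y -> indep v (phi y - phi x)].

Let line x a b q : F x a -> F x b -> a <> b -> F x q -> exists k, q = a + k *: (b - a).
Proof.
move=> Fa Fb ab Fq.
have ab0 : 0 < dot (a - b) (a - b).
  by apply: dot_gt0; rewrite subr_eq0; apply/eqP.
apply: (@hom_collinear _ _ _ hom ntr usc c3 x a b q (a - b) (dot (a - b) a - 1)) => //.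
- by rewrite -subr_gt0 -dotBr.
- by move=> p /S0.
- by slra.
Qed.

Let line_conv a b : conv_closed [set q : 'rV[R]_c.+1 | exists k, q = a + k *: (b - a)].
Proof.
by move=> _ _ t [k ->] [l ->] _ _; exists (t * k + (1 - t) * l); vec.
Qed.

(* Were [F x] and [F y] contained in one line, the sets [F z] with [z] near [x] on
   the segment from [x] to [y] would be close to [F x] and meet it. *)
Let no_common_line x y a b : x <> y -> F x a -> F x b -> a <> b ->
  ~ F y `<=` [set q | exists k, q = a + k *: (b - a)].
Proof.
move=> xy Fa Fb ab Fy.
pose u := b - a.
have u0 : 0 < dot u u by apply: dot_gt0; rewrite subr_eq0; apply/eqP => ba; apply: ab.
have ub : dot u b = dot u a + dot u u by rewrite -dotDr addrCA subrr addr0.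
have h1 : dot u b - dot u u / 3 < dot u b by slra.
have h2 : - dot u a - dot u u / 3 < dot (- u) a by rewrite dotNl; slra.
have nearb := hom_lsc_dot hom ntr usc c2 Fb h1.
have neara := hom_lsc_dot hom ntr usc c2 Fa h2.
have [d d0 hd] := (ball_nbhs _ _).1 (filterI nearb neara).
have yx0 : y - x != 0 by rewrite subr_eq0; apply/eqP => yx; apply: xy.
have n0 : 0 < `|y - x| by rewrite normr_gt0.
pose t := Num.min 1 (d / (2 * `|y - x|)).
have t0 : 0 < t by rewrite lt_min ltr01 divr_gt0// mulr_gt0.
have t1 : t <= 1 by rewrite ge_min lexx.
pose z := t *: y + (1 - t) *: x.
have zE : z - x = t *: (y - x) by rewrite /z; vec.
have [|[p Fp pb] [q Fq qa]] := hd z.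
  rewrite zE normrZ gtr0_norm//.
  have : t * `|y - x| <= d / 2.
    by rewrite -ler_pdivlMr// ge_min; apply/orP; right; rewrite invfM mulrA.
  slra.
have xz : x <> z.
  move=> xz; have /eqP : z - x = 0 by rewrite -xz subrr.
  by rewrite zE scaler_eq0 (gt_eqF t0) (negbTE yx0).
have Fz : F z `<=` [set q | exists k, q = a + k *: (b - a)].
  apply: (@hom_segment_sub _ _ _ _ hom y x t _ (@line_conv a b) (ltW t0) t1 Fy).
  by move=> r /(line Fa Fb ab).
(* [F z] has points beyond two thirds and before one third of the way from [a] to [b], so it
   contains their midpoint, which is in [F x]. *)
have [k kE] := Fz _ Fp; have [l lE] := Fz _ Fq.
have k23 : 2 / 3 < k.
  move: pb; rewrite kE ub dotDr dotZr -/u => pb.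
  have : (2 / 3) * dot u u < k * dot u u by slra.
  by rewrite ltr_pM2r.
have l13 : l < 1 / 3.
  move: qa; rewrite dotNl lE dotDr dotZr -/u => qa.
  have : l * dot u u < (1 / 3) * dot u u by slra.
  by rewrite ltr_pM2r.
have kl : 0 < k - l by slra.
apply: (disj xz (p := a + (1/2) *: (b - a))).
  rewrite (_ : _ + _ = (1/2) *: b + (1 - 1/2) *: a); last by vec.
  by apply: F_conv => //; slra.
have -> : a + (1/2) *: (b - a) = ((1/2 - l) / (k - l)) *: p + (1 - (1/2 - l) / (k - l)) *: q.
  rewrite kE lE; apply/rowP => i; rewrite !mxE; field; slra.
apply: F_conv => //; first by rewrite divr_ge0//; slra.
by rewrite ler_pdivrMr//; slra.
Qed.

(** Let [x'] be the reflection of [y] in [x]. Every point of [F x'] is joined to [q] by a segment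
    through a point of [F x] other than [q]; with [q] on the line of [F x], all of [F x'] would be
    on it. *)
Let off_line x y a b q k : x <> y -> F x a -> F x b -> a <> b -> F y q ->
  q <> a + k *: (b - a).
Proof.
move=> xy Fa Fb ab Fq qE.
pose x' := 2 *: x - y.
have xx' : x <> x'.
  move=> xx'; apply: xy; apply/rowP => i; move/rowP: xx' => /(_ i).
  by rewrite /x' !mxE; slra.
apply: (no_common_line xx' Fa Fb ab) => p Fp.
have h0 : 0 <= 1/2 :> R by slra.
have h1 : 1/2 <= 1 :> R by slra.
have [s [s0 s1]] := between_points hom ntr usc c2 Fp Fq h0 h1.
have -> : (1/2) *: x' + (1 - 1/2) *: y = x.
  by rewrite /x'; apply/rowP => i; rewrite !mxE; field.
move=> Fr; have [j jE] := line Fa Fb ab Fr.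
have sn0 : s != 0.
  apply/eqP => s0'; apply: (disj xy Fr).
  by rewrite s0' scale0r add0r subr0 scale1r.
exists (s^-1 * (j - (1 - s) * k)).
have -> : p = s^-1 *: (s *: p + (1 - s) *: q) - (s^-1 * (1 - s)) *: q.
  by apply/rowP => i; rewrite !mxE; field.
by rewrite jE qE; apply/rowP => i; rewrite !mxE; field.
Qed.

(** If [F y] were just [q], the segments from [a] and from [b] to a point [r] of [F (2 *: y - x)]
    would both pass through [q], putting [q] on the line of [a] and [b]. *)
Let no_mixture x y a b q : F x a -> F x b -> a <> b -> F y q ->
  exists2 q', F y q' & q' <> q.
Proof.
move=> Fa Fb ab Fq.
have [xy|/eqP xy] := eqVneq x y.
  rewrite -xy; have [aq|/eqP aq] := eqVneq a q; last by exists a.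
  by exists b => // bq; apply: ab; rewrite aq bq.
apply: contrapT => /forall2NP h.
have Fy p : F y p -> p = q by move=> Fp; have [//|/contrapT] := h p.
pose y' := 2 *: y - x.
have yy' : y <> y'.
  move=> yy'; apply: xy; apply/rowP => i; move/rowP: yy' => /(_ i).
  by rewrite /y' !mxE; slra.
have [r Fr _] := hom_outside_core ntr y'.
have h0 : 0 <= 1/2 :> R by slra.
have h1 : 1/2 <= 1 :> R by slra.
have yE : (1/2) *: x + (1 - 1/2) *: y' = y.
  by rewrite /y'; apply/rowP => i; rewrite !mxE; field.
have coef p : F x p -> exists2 s, s != 0 & s *: p + (1 - s) *: r = q.
  move=> Fp; have [s [s0 s1]] := between_points hom ntr usc c2 Fp Fr h0 h1.
  rewrite yE => /Fy sE; exists s => //; apply/eqP => s0'.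
  apply: (disj yy' Fq); rewrite -sE s0'.
  by rewrite scale0r add0r subr0 scale1r.
have [s s0 sE] := coef _ Fa; have [t t0 tE] := coef _ Fb.
have aE : a = r + s^-1 *: (q - r) by rewrite -sE; apply/rowP => i; rewrite !mxE; field.
have bE : b = r + t^-1 *: (q - r) by rewrite -tE; apply/rowP => i; rewrite !mxE; field.
have st : t^-1 - s^-1 != 0.
  by rewrite subr_eq0; apply/eqP => st; apply: ab; rewrite aE bE st.
apply: (@off_line x y a b q ((1 - s^-1) / (t^-1 - s^-1)) xy Fa Fb ab Fq).
have st' : s - t != 0.
  apply: contra st; rewrite !subr_eq0 => /eqP ->; exact: eqxx.
rewrite {1}bE aE; apply/rowP => i; rewrite !mxE; field.
by rewrite s0 t0 mulN1r st'.
Qed.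

Section nondegenerate.
Variables al be : 'rV[R]_c -> 'rV[R]_c.+1.
Hypothesis FE : forall x p, F x p <->
  exists t, [/\ 0 <= t, t <= 1 & p = al x + t *: (be x - al x)].
Hypothesis al_be : forall x, al x <> be x.

Let d x := be x - al x.

Let d0 x : d x != 0.
Proof. by rewrite subr_eq0; apply/eqP => h; apply: (@al_be x). Qed.

Let Fal x : F x (al x).
Proof. by apply/FE; exists 0; rewrite lexx ler01 scale0r addr0. Qed.

Let Fbe x : F x (be x).
Proof. by apply/FE; exists 1; rewrite lexx ler01 scale1r addrCA subrr addr0. Qed.

Let off x y q k : x <> y -> F y q -> q <> al x + k *: d x.
Proof. by move=> xy Fq; exact: (off_line xy (Fal x) (Fbe x) (@al_be x) Fq). Qed.

(* A segment meeting three edges of a nondegenerate tetrahedron, two opposite edges of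
   which are [F x] and [F y], cannot be straight. *)
Let coplanar x y : x <> y -> exists k1 k2 k3 : R,
  ~ (k1 = 0 /\ k2 = 0 /\ k3 = 0) /\
  k1 *: d x + k2 *: d y + k3 *: (al y - al x) = 0.
Proof.
move=> xy; apply: contrapT => h.
have ind k1 k2 k3 : k1 *: d x + k2 *: d y + k3 *: (al y - al x) = 0 ->
    k1 = 0 /\ k2 = 0 /\ k3 = 0.
  by move=> k0; apply: contrapT => nk; apply: h; exists k1, k2, k3.
have h0 : 0 <= 1/2 :> R by slra.
have h1 : 1/2 <= 1 :> R by slra.
have [s1 [s10 s11 F1]] := between_points hom ntr usc c2 (Fal x) (Fal y) h0 h1.
have [s2 [s20 s21 F2]] := between_points hom ntr usc c2 (Fal x) (Fbe y) h0 h1.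
have [s3 [s30 s31 F3]] := between_points hom ntr usc c2 (Fbe x) (Fal y) h0 h1.
set z := _ *: x + _ in F1 F2 F3.
have xz : x <> z.
  move=> xz; apply: xy; apply/rowP => i; move/rowP: xz => /(_ i).
  by rewrite /z !mxE; slra.
have yz : y <> z.
  move=> yz; apply: xy; apply/rowP => i; move/rowP: yz => /(_ i).
  by rewrite /z !mxE; slra.
have s2n : 1 - s2 != 0.
  apply/eqP => s2'; apply: (disj xz (Fal x)); move: F2.
  by rewrite s2' scale0r addr0 (_ : s2 = 1) ?scale1r//; slra.
have s3n : s3 != 0.
  apply/eqP => s3'; apply: (disj yz (Fal y)); move: F3.
  by rewrite s3' scale0r add0r subr0 scale1r.
set r1 := s1 *: _ + _ in F1; set r2 := s2 *: _ + _ in F2; set r3 := s3 *: _ + _ in F3.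
have r12 : r1 <> r2.
  move=> r12; have [|_ [e2 _]] := ind 0 (1 - s2) (s1 - s2).
    by rewrite -[RHS](subrr r2) -{2}r12 /r1 /r2 /d; vec.
  by move/eqP: s2n; rewrite e2.
have [k kE] := line F1 F2 r12 F3.
have [|e1 _] := ind s3 (- (k * (1 - s2))) ((1 - s3) - (1 - s1) - k * (s1 - s2)).
  transitivity (r3 - (r1 + k *: (r2 - r1))); first by rewrite /r1 /r2 /r3 /d; vec.
  by rewrite kE subrr.
by move/eqP: s3n; rewrite e1.
Qed.

Let on_line o x := exists k, o = al x + k *: d x.

Let in_plane o x y w := (exists g h, al w - o = g *: d x + h *: d y) /\
  (exists g h, d w = g *: d x + h *: d y).

Let coplanar_from o x w : on_line o x -> x <> w -> exists k1 k2 k3 : R,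
  ~ (k1 = 0 /\ k2 = 0 /\ k3 = 0) /\
  k1 *: d x + k2 *: d w + k3 *: (al w - o) = 0.
Proof.
move=> [k ->] xw; have [k1 [k2 [k3 [nz E]]]] := coplanar xw.
exists (k1 + k3 * k), k2, k3; split.
  by move=> [e1 [e2 e3]]; apply: nz; split=> //; move: e1; rewrite e3; slra.
by rewrite -[RHS]E; vec.
Qed.

(** The conclusion says that the line of [w] meets that of [x]. Being coplanar, they could otherwise
    only be parallel; coplanarity with the line of [y] would then put the line of [w] into the
    plane. *)
Let parallel_or_in_plane o x y w : on_line o x -> on_line o y ->
  indep (d x) (d y) -> x <> w -> y <> w -> ~ in_plane o x y w ->
  exists g h, al w - o = g *: d x + h *: d w.
Proof.
move=> ox oy xy xw yw npl.
have [k1 [k2 [k3 [nz E]]]] := coplanar_from ox xw.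
have [k30|k30] := eqVneq k3 0; last first.
  exists (- k1 / k3), (- k2 / k3); apply: (scalerI k30).
  have -> : k3 *: (al w - o) = - (k1 *: d x + k2 *: d w).
    by apply/eqP; rewrite -subr_eq0 opprK addrC E.
  by apply/rowP => i; rewrite !mxE; field.
have k20 : k2 != 0.
  apply/eqP => k20; apply: nz; split; last by [].
  move: E; rewrite k20 k30 !scale0r !addr0 => /eqP.
  by rewrite scaler_eq0 (negbTE (d0 x)) orbF => /eqP.
have dw : d w = (- k1 / k2) *: d x.
  apply: (scalerI k20); have -> : k2 *: d w = - (k1 *: d x).
    by apply/eqP; rewrite -subr_eq0 opprK addrC -[X in _ == X]E k30 scale0r addr0.
  by apply/rowP => i; rewrite !mxE; field.
exfalso; apply: npl; split; last by exists (- k1 / k2), 0; rewrite dw; vec.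
have [l1 [l2 [l3 [nzl El]]]] := coplanar_from oy yw.
have l30 : l3 != 0.
  apply/eqP => l30; apply: nzl.
  have [|e2 e1] := xy (l2 * (- k1 / k2)) l1.
    by rewrite -[RHS]El l30 dw; vec.
  split=> //; split=> //; move/eqP: e2; rewrite mulf_eq0 => /orP[/eqP//|/eqP k10].
  by have := d0 w; rewrite dw k10 scale0r eqxx.
exists (- l2 * (- k1 / k2) / l3), (- l1 / l3); apply: (scalerI l30).
have -> : l3 *: (al w - o) = - (l1 *: d y + l2 *: d w).
  by apply/eqP; rewrite -subr_eq0 opprK addrC El.
by rewrite dw; apply/rowP => i; rewrite !mxE; field; apply/andP.
Qed.

(** The line of [w] meets those of [x] and [y]. Two different meeting points would put it into their
    plane, and a single one can only be [o]. *)
Let concurrent_step o x y w : on_line o x -> on_line o y ->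
  indep (d x) (d y) -> x <> w -> y <> w -> ~ in_plane o x y w -> on_line o w.
Proof.
move=> ox oy xy xw yw npl.
have [g [h gh]] := parallel_or_in_plane ox oy xy xw yw npl.
have npl' : ~ in_plane o y x w.
  by move=> [[g1 [h1 E1]] [g2 [h2 E2]]]; apply: npl; split;
    [exists h1, g1; rewrite E1 addrC|exists h2, g2; rewrite E2 addrC].
have [g' [h' gh']] := parallel_or_in_plane oy ox (indepC xy) yw xw npl'.
have [hh|hh] := eqVneq h h'.
  have [|g0 _] := xy g (- g').
    rewrite -[RHS](subrr (al w - o)) {1}gh gh' hh; vec.
  exists (- h); apply/rowP => i; move/rowP: gh => /(_ i).
  by rewrite g0 !mxE; slra.
have hn : h - h' != 0 by rewrite subr_eq0.
have dw : d w = (- g / (h - h')) *: d x + (g' / (h - h')) *: d y.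
  apply: (scalerI hn); have -> : (h - h') *: d w = g' *: d y - g *: d x.
    apply/rowP => i; move/rowP: gh => /(_ i); move/rowP: gh' => /(_ i).
    by rewrite !mxE; slra.
  by apply/rowP => i; rewrite !mxE; field.
exfalso; apply: npl; split; last by exists (- g / (h - h')), (g' / (h - h')).
by exists (g + h * (- g / (h - h'))), (h * (g' / (h - h'))); rewrite gh dw; vec.
Qed.

(* Here [c >= 3] is used: four affinely independent points cannot all be mapped
   into a plane. *)
Let exists_out_of_plane o x y : on_line o x -> on_line o y -> x <> y ->
  exists w, [/\ x <> w, y <> w & ~ in_plane o x y w].
Proof.
move=> ox oy xy; apply: contrapT => h.
have all_in w : x <> w -> y <> w -> in_plane o x y w.
  by move=> xw yw; apply: contrapT => nw; apply: h; exists w.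
pose e := y - x; have e0 : e != 0 by rewrite subr_eq0; apply/eqP => yx; apply: xy.
have [e1 e10 ee1] := orthogonal_vector e c2.
have [e2 [e20 ee2 e1e2]] := orthogonal_vector2 e e1 c3.
have orth_neq (v v' : 'rV[R]_c) : dot v v' = 0 -> v != 0 -> v <> v'.
  by move=> vv' v0 vE; move: vv' (dot_gt0 v0); rewrite -vE => ->; rewrite ltxx.
have ne v : v != 0 -> x <> x + v.
  by move=> v0 /eqP; rewrite -subr_eq0 opprD addNKr oppr_eq0 (negbTE v0).
have ne' v : dot e v = 0 -> y <> x + v.
  move=> ev yE; apply: (orth_neq e v ev e0); apply: (addrI x).
  by rewrite -yE /e addrCA subrr addr0.
pose w (i : (unit + unit) + (unit + unit)) := match i with
  | inl (inl _) => x | inl (inr _) => x + e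
  | inr (inl _) => x + e1 | inr (inr _) => x + e2 end.
have xe : x + e = y by rewrite /e addrCA subrr addr0.
have plane i : exists gh : R * R, al (w i) = o + gh.1 *: d x + gh.2 *: d y.
  case: i => [[]|[]] [] /=.
  - by have [k ->] := ox; exists (- k, 0); rewrite /=; vec.
  - by rewrite xe; have [k ->] := oy; exists (0, - k); rewrite /=; vec.
  - have [[g [h' E]] _] := all_in _ (ne _ e10) (ne' _ ee1).
    by exists (g, h'); rewrite /= -addrA -E addrCA subrr addr0.
  - have [[g [h' E]] _] := all_in _ (ne _ e20) (ne' _ ee2).
    by exists (g, h'); rewrite /= -addrA -E addrCA subrr addr0.
have /choice[gh ghE] := plane.
have [|m [m0 m1 m2]] := @plane_dep R c.+1 _ (al \o w) o (d x) (d y)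
  (fun i => (gh i).1) (fun i => (gh i).2) ghE.
  by rewrite !card_sum !card_unit.
have [||l [_ /S0//]] := @hom_dependence _ _ _ hom _ w (al \o w) m _ _ m0 m1 m2; last first.
  by move=> i; exact: Fal.
move=> k; rewrite !big_sumType /= !(bigD1 tt (P := xpredT))//=.
rewrite !(@big1 _ _ _ _ _ (fun i : unit => i != tt)); try by case.
rewrite !addr0 => k1 kw.
have kE : k (inl (inr tt)) *: e + k (inr (inl tt)) *: e1 + k (inr (inr tt)) *: e2 = 0.
  rewrite -[RHS](subr0 0) -{1}kw -(scale0r x) -k1; vec.
have dotE v := congr1 (dot v) kE.
have := dotE e; have := dotE e1; have := dotE e2.
rewrite !dotDr !dotZr !dot0r ee1 ee2 e1e2 (dotC e1 e) (dotC e2 e) (dotC e2 e1) ee1 ee2 e1e2.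
rewrite !mulr0 !addr0 !add0r => /eqP; rewrite mulf_eq0 dot_eq0 (negbTE e20) orbF => /eqP k2.
move=> /eqP; rewrite mulf_eq0 dot_eq0 (negbTE e10) orbF => /eqP k3.
move=> /eqP; rewrite mulf_eq0 dot_eq0 (negbTE e0) orbF => /eqP k4.
by case=> [[]|[]] [] //; move: k1; rewrite k2 k3 k4 !addr0.
Qed.

(** A line inside the plane of [d x] and [d y] is treated with the plane of [d x] and [d w1]
    instead, [w1] being off the first one: in both planes at once, [al w] would be on the line of
    [x]. *)
Let concurrent_all o x y : on_line o x -> on_line o y -> indep (d x) (d y) ->
  x <> y -> forall w, on_line o w.
Proof.
move=> ox oy dxy xy.
have [w1 [xw1 yw1 npl1]] := exists_out_of_plane ox oy xy.
have ow1 := concurrent_step ox oy dxy xw1 yw1 npl1.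
have nd1 g h : d w1 <> g *: d x + h *: d y.
  move=> dE; apply: npl1; split; last by exists g, h.
  have [k ->] := ow1; exists (- k * g), (- k * h).
  by transitivity (- k *: d w1); [vec|rewrite dE; vec].
have dxw1 : indep (d x) (d w1).
  by apply: indepP (d0 x) _ => k kE; apply: (nd1 k 0); rewrite kE; vec.
move=> w.
have [<-//|/eqP xw] := eqVneq x w.
have [<-//|/eqP yw] := eqVneq y w.
have [<-//|/eqP w1w] := eqVneq w1 w.
have [[[g [h E]] [g' [h' E']]]|npl] := pselect (in_plane o x y w); last first.
  exact: concurrent_step ox oy dxy xw yw npl.
apply: (concurrent_step ox ow1 dxw1 xw w1w) => -[[p [q H]] [p' [q' H']]].
have q0 : q = 0.
  apply/eqP/negPn/negP => q0; apply: (nd1 ((g - p) / q) (h / q)).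
  apply: (scalerI q0); have -> : q *: d w1 = (g *: d x + h *: d y) - p *: d x.
    by rewrite -E H addrAC subrr add0r.
  by apply/rowP => i; rewrite !mxE; field.
have [k oE] := ox.
apply: (@off x w (al w) (k + p) xw (Fal w)).
transitivity (o + (al w - o)); first by rewrite addrCA subrr addr0.
by rewrite H q0 oE; vec.
Qed.

Let concurrent_cone o : (forall x, on_line o x) ->
  exists phi s, cone_form Phi o phi s /\ forall x, 0 < s x.
Proof.
move=> oall.
have no x : ~ F x o.
  move=> Fo; have [e e0 _] := orthogonal_vector x c2.
  have yx : x + e <> x.
    by move=> /eqP; rewrite -subr_eq0 addrC addKr (negbTE e0).
  by have [k] := oall (x + e); apply: off yx Fo.
have h x : exists fs : 'rV[R]_c.+1 * R, [/\ 0 < fs.2, fs.2 < 1, F x fs.1 &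
    (exists2 k, d x = k *: (fs.1 - o) & k != 0) /\
    forall p, F x p <-> exists t, [/\ fs.2 <= t, t <= 1 & p = o + t *: (fs.1 - o)]].
  have [k oE] := oall x.
  (* The parameter [k] of [o] on the line is outside [0, 1], as [o] is not in [F x]. Its sign tells
     which end is the far one; [- k / (1 - k)] or [(k - 1) / k] is the ratio of the distances of the
     ends from [o]. *)
  have [k0|k0] := ltP k 0.
    have k1 : 0 < 1 - k by slra.
    have k1' : 1 - k != 0 by rewrite gt_eqF.
    exists (be x, - k / (1 - k)); split => /=.
    - by rewrite divr_gt0//; slra.
    - by rewrite ltr_pdivrMr//; slra.
    - exact: Fbe.
    split; first exists (1 - k)^-1; rewrite ?invr_eq0//.
      by rewrite oE /d; apply/rowP => i; rewrite !mxE; field.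
    move=> p; rewrite FE; split=> [[t [t0 t1 ->]]|[t [t0 t1 ->]]].
      exists ((t - k) / (1 - k)); split.
      - by rewrite ler_pM2r ?invr_gt0//; slra.
      - by rewrite ler_pdivrMr//; slra.
      - by rewrite oE /d; apply/rowP => i; rewrite !mxE; field.
    exists (t * (1 - k) + k); split.
    - by move: t0; rewrite ler_pdivrMr//; slra.
    - by have := ler_wpM2r (ltW k1) t1; slra.
    - by rewrite oE /d; vec.
  have k1 : 1 < k.
    rewrite ltNge; apply/negP => k1; apply: (no x); apply/FE; exists k; split=> //.
  have kp : 0 < k by slra.
  have kn : k != 0 by rewrite gt_eqF.
  exists (al x, (k - 1) / k); split => /=.
  - by rewrite divr_gt0//; slra.
  - by rewrite ltr_pdivrMr//; slra.
  - exact: Fal.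
  split; first exists (- k^-1); rewrite ?oppr_eq0 ?invr_eq0//.
    by rewrite oE /d; apply/rowP => i; rewrite !mxE; field.
  move=> p; rewrite FE; split=> [[t [t0 t1 ->]]|[t [t0 t1 ->]]].
    exists ((k - t) / k); split.
    - by rewrite ler_pM2r ?invr_gt0//; slra.
    - by rewrite ler_pdivrMr//; slra.
    - by rewrite oE /d; apply/rowP => i; rewrite !mxE; field.
  exists (k - t * k); split.
  - by have := ler_wpM2r (ltW kp) t1; slra.
  - by move: t0; rewrite ler_pdivrMr//; slra.
  - by rewrite oE /d; vec.
have /choice[fs hfs] := h.
exists (fun x => (fs x).1), (fun x => (fs x).2); split; last by move=> x; case: (hfs x).
split.
- by move=> x; case: (hfs x) => /ltW -> ->.
- by move=> x p; case: (hfs x) => _ _ _ [_].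
- by move=> x; exact: S0.
- move=> x y xy; have [_ _ Fx [[k dE k0] _]] := hfs x; have [_ _ Fy _] := hfs y.
  apply: indepP => [|l lE].
    rewrite subr_eq0; apply/eqP => fo; apply: (no x); rewrite -fo.
    exact: Fx.
  have [j oE] := oall x.
  apply: (@off x y _ (j + l / k) xy Fy).
  transitivity (o + ((fs y).1 - o)); first by rewrite addrCA subrr addr0.
  rewrite lE {1}oE scalerDl addrA; congr (_ + _).
  by rewrite dE scalerA divfK.
Qed.

Let parallel_all v : v != 0 -> (forall x, exists k, d x = k *: v) ->
  exists phi r, parallel_form v phi r.
Proof.
move=> v0 dv.
have h x : exists fs : 'rV[R]_c.+1 * R, [/\ 0 < fs.2, F x fs.1 &
    forall p, F x p <-> exists t, [/\ 0 <= t, t <= fs.2 & p = fs.1 + t *: v]].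
  have [k kE] := dv x.
  have k0 : k != 0 by apply/eqP => k0; have := d0 x; rewrite kE k0 scale0r eqxx.
  have [kp|kn|k0'] := ltgtP 0 k; last by move: k0; rewrite -k0' eqxx.
    exists (al x, k); split => //= p; rewrite FE -/(d x) kE.
    split=> [[t [t0 t1 ->]]|[t [t0 t1 ->]]].
      exists (t * k); rewrite scalerA; split=> //; first by rewrite mulr_ge0// ltW.
      by rewrite ger_pMl.
    exists (t / k); rewrite scalerA divfK//; split=> //.
      by rewrite divr_ge0// ltW.
    by rewrite ler_pdivrMr// mul1r.
  exists (be x, - k); split => /=; first by rewrite oppr_gt0.
    exact: Fbe.
  have bE : be x = al x + k *: v by rewrite -kE addrCA subrr addr0.
  move=> p; rewrite FE -/(d x) kE bE; split=> [[t [t0 t1 ->]]|[t [t0 t1 ->]]].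
    exists ((1 - t) * - k); split.
    - by rewrite mulr_ge0//; slra.
    - by rewrite ger_pMl; slra.
    - by vec.
  exists (1 + t / k); split.
  - by have : -1 <= t / k by [rewrite ler_ndivlMr// mulN1r; slra]; slra.
  - by rewrite gerDl mulr_ge0_le0// invr_le0 ltW.
  - by apply/rowP => i; rewrite !mxE; field.
have /choice[fs hfs] := h.
exists (fun x => (fs x).1), (fun x => (fs x).2); split.
- by move=> x; case: (hfs x).
- by move=> x p; case: (hfs x) => _ _.
- move=> x y xy; apply: indepP => // l lE.
  have [_ Fy _] := hfs y; have [_ Fx _] := hfs x.
  have [k kE] := dv x.
  have k0 : k != 0 by apply/eqP => k0; have := d0 x; rewrite kE k0 scale0r eqxx.
  have /FE[t [_ _ tE]] := Fx.
  apply: (@off x y _ (t + l / k) xy Fy).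
  transitivity ((fs x).1 + ((fs y).1 - (fs x).1)); first by rewrite addrCA subrr addr0.
  by rewrite lE tE -/(d x) scalerDl addrA; congr (_ + _); rewrite kE scalerA divfK.
Qed.

Lemma nondegenerate_form :
  (exists o phi s, cone_form Phi o phi s /\ forall x, 0 < s x) \/
  (exists v phi r, parallel_form v phi r).
Proof.
have [|/existsNP[y /forallNP hy]] := pselect (forall y, exists k, d y = k *: d 0).
  by move=> h; right; exists (d 0); exact: parallel_all.
have dxy : indep (d 0) (d y) by apply: indepP => // k; exact: hy.
have xy : 0 <> y by move=> y0; apply: (hy 1); rewrite -y0 scale1r.
have [k1 [k2 [k3 [nz E]]]] := coplanar xy.
have k30 : k3 != 0.
  apply/eqP => k30; apply: nz; have [|-> ->//] := dxy k1 k2.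
  by rewrite -[RHS]E k30 scale0r addr0.
pose o := al 0 - (k1 / k3) *: d 0.
have ox : on_line o 0 by exists (- (k1 / k3)); rewrite scaleNr.
have oy : on_line o y.
  exists (k2 / k3); apply: (scalerI k30); apply/eqP; rewrite -subr_eq0; apply/eqP.
  rewrite -[RHS]oppr0 -[in RHS]E /o; apply/rowP => i; rewrite !mxE; field.
  by [].
by left; exists o; apply: concurrent_cone; exact: concurrent_all ox oy dxy xy.
Qed.

End nondegenerate.

Lemma segment_of_collinear (K : set 'rV[R]_c.+1) a b : compact K -> conv_closed K ->
  K a -> K b -> a <> b -> (forall q, K q -> exists k, q = a + k *: (b - a)) ->
  exists g h, g <> h /\
    forall p, K p <-> exists t, [/\ 0 <= t, t <= 1 & p = g + t *: (h - g)].
Proof.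
move=> kK cK Ka Kb ab Kline.
pose u := b - a.
have u0 : 0 < dot u u by apply: dot_gt0; rewrite subr_eq0; apply/eqP => ba; apply: ab.
have [h Kh hmax] := compact_dot_max u kK (ex_intro _ _ Ka).
have [g Kg gmin] := compact_dot_max (- u) kK (ex_intro _ _ Ka).
have [i iE] := Kline _ Kg; have [j jE] := Kline _ Kh.
have ord q k l : q = a + k *: (b - a) -> dot u q <= dot u a + l * dot u u -> k <= l.
  by move=> ->; rewrite dotDr dotZr -/u lerD2l ler_pM2r.
have gh : g <> h.
  move=> gh.
  have := hmax _ Kb; have := gmin _ Ka; rewrite !dotNl gh lerN2 => h1 h2.
  have := le_trans h2 h1; rewrite -subr_le0 -dotBr -/u leNgt u0.
  by [].
have ij : i < j.
  rewrite lt_neqAle; apply/andP; split; last first.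
    by apply: ord iE _; rewrite -dotZr -dotDr -jE; exact: hmax.
  by apply/eqP => ij; apply: gh; rewrite iE jE ij.
have ji : 0 < j - i by rewrite subr_gt0.
exists g, h; split=> // p; split=> [Kp|[t [t0 t1 ->]]]; last first.
  by rewrite (_ : _ + _ = t *: h + (1 - t) *: g); [exact: cK|vec].
have [k kE] := Kline _ Kp.
have ik : i <= k.
  have := gmin _ Kp; rewrite !dotNl lerN2 iE kE !dotDr !dotZr -/u lerD2l.
  by rewrite ler_pM2r.
have kj : k <= j.
  by have := hmax _ Kp; rewrite jE kE !dotDr !dotZr -/u lerD2l ler_pM2r.
exists ((k - i) / (j - i)); split.
- by rewrite divr_ge0 ?subr_ge0// ltW.
- by rewrite ler_pdivrMr// mul1r lerD2r.
- by rewrite kE iE jE; apply/rowP => n; rewrite !mxE; field; rewrite gt_eqF.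
Qed.

Lemma core_empty_form :
  (exists phi, forall x p, F x p <-> p = phi x) \/
  ((exists o phi s, cone_form Phi o phi s /\ forall x, 0 < s x) \/
   (exists v phi r, parallel_form v phi r)).
Proof.
have [[x [a [b [Fa Fb ab]]]]|ndeg] :=
    pselect (exists x a b, [/\ F x a, F x b & a <> b]); last first.
  left; have /choice[phi Fphi] x : exists p, F x p by exact: hom_point_nonempty.
  exists phi => x p; split=> [Fp|->//].
  by apply: contrapT => pphi; apply: ndeg; exists x, p, (phi x).
right.
have h y : exists gh : 'rV[R]_c.+1 * 'rV[R]_c.+1, gh.1 <> gh.2 /\
    forall p, F y p <-> exists t, [/\ 0 <= t, t <= 1 & p = gh.1 + t *: (gh.2 - gh.1)].
  have [q Fq] := hom_point_nonempty ntr y.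
  have [q' Fq' qq'] := no_mixture Fa Fb ab Fq.
  have [g [h [gh hh]]] := segment_of_collinear (@cconvex_compact _ _ _)
    (@cconvex_conv _ _ _) Fq' Fq qq' (fun p Fp => line Fq' Fq qq' Fp).
  by exists (g, h).
have /choice[gh hgh] := h.
apply: (@nondegenerate_form (fun y => (gh y).1) (fun y => (gh y).2)).
- by move=> y; case: (hgh y).
- by move=> y; case: (hgh y).
Qed.

End core_empty.

(** * Affinity and the images of all sets *)

Section affine_maps.
Context {R : realType}.

Lemma neq_shift n (x e : 'rV[R]_n) : e != 0 -> x <> x + e.
Proof.
by move=> e0 /eqP; rewrite -subr_eq0 opprD addNKr oppr_eq0 (negbTE e0).
Qed.

(* Extrapolating beyond the smaller of two values would give a negative one. *)
Lemma positive_affine_constant n (g : 'rV[R]_n -> R) : (forall x, 0 < g x) ->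
  (forall x y (t : R), x <> y -> 0 <= t -> t <= 1 ->
    g (t *: x + (1 - t) *: y) = t * g x + (1 - t) * g y) ->
  forall x y, g x = g y.
Proof.
move=> g0 ga; suff H x y : g y <= g x by move=> x y; apply/eqP; rewrite eq_le !H.
rewrite leNgt; apply/negP => xy.
have gy := g0 y; have gx := g0 x.
pose t := (g y - g x) / (2 * g y).
have t0 : 0 < t by rewrite divr_gt0 ?mulr_gt0 ?subr_gt0.
have t1 : t <= 1 by rewrite ler_pdivrMr ?mulr_gt0//; slra.
pose z := t^-1 *: (x - (1 - t) *: y).
have xE : x = t *: z + (1 - t) *: y.
  by rewrite /z; apply/rowP => i; rewrite !mxE; field; rewrite gt_eqF.
have zy : z <> y.
  move=> zy; move: xy; rewrite xE zy -scalerDl addrC subrK scale1r.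
  by rewrite ltxx.
have := ga z y t zy (ltW t0) t1; rewrite -xE => gE.
have : 0 < t * g z by rewrite mulr_gt0.
have : t * g y = (g y - g x) / 2 by rewrite /t; field; rewrite gt_eqF.
slra.
Qed.

Lemma affine_map_conv m n (f : 'rV[R]_m -> 'rV[R]_n) x y (t : R) : affine_map f ->
  f (t *: x + (1 - t) *: y) = t *: f x + (1 - t) *: f y.
Proof.
by move=> fa; have := fa (1 - t) x y; rewrite (_ : 1 - (1 - t) = t); [|ring].
Qed.

Lemma affine_mapE m n (f : 'rV[R]_m -> 'rV[R]_n) : affine_map f ->
  exists A, forall x, f x = f 0 + x *m A.
Proof.
move=> fa; pose g x := f x - f 0.
have gZ t x : g (t *: x) = t *: g x.
  have := fa t 0 x; rewrite scaler0 add0r /g => ->; vec.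
have gD x y : g (x + y) = g x + g y.
  have -> : x + y = 2 *: ((1 - 1/2) *: x + (1/2) *: y).
    by apply/rowP => i; rewrite !mxE; field.
  by rewrite gZ /g fa; apply/rowP => i; rewrite !mxE; field.
have g0 : g 0 = 0 by rewrite /g subrr.
exists (\matrix_(i < m) g (delta_mx 0 i)) => x.
transitivity (f 0 + g x); first by rewrite /g addrCA subrr addr0.
congr (_ + _); rewrite {1}[x]row_sum_delta (big_morph g gD g0) mulmx_sum_row.
by apply: eq_bigr => i _; rewrite rowK gZ.
Qed.

(** The linear part has rank [n], so its row space fills the [n]-dimensional orthogonal complement
    of a kernel vector [u]. *)
Lemma affine_image_hyperplane n (f : 'rV[R]_n -> 'rV[R]_n.+1) :
  affine_map f -> injective f ->
  exists u b, u != 0 /\ range f = [set y | dot u y = b].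
Proof.
move=> fa finj; have [A fE] := affine_mapE fa.
have freeA : row_free A.
  apply: inj_row_free => v vA; apply: finj.
  by rewrite fE vA addr0.
have [u u0 uA] := @kernel_vector R n.+1 n A (ltnSn _).
have Au : A *m u^T = 0 by rewrite -[LHS]trmxK trmx_mul trmxK uA trmx0.
exists u, (dot u (f 0)); split=> //; apply/seteqP; split=> [_ [x _ <-]|y /= uy].
  have : x *m A *m u^T = 0 by rewrite -mulmxA Au mulmx0.
  rewrite dot_mx => /rowP/(_ 0); rewrite !mxE eqxx mulr1n => ux.
  by rewrite /= fE dotDr ux addr0.
have AK : (A <= kermx u^T)%MS by apply/sub_kermxP.
have : (y - f 0 <= A)%MS.
  apply: submx_trans (_ : (kermx u^T <= A)%MS).
    by apply/sub_kermxP; rewrite dot_mx dotBr uy subrr; apply/rowP => i; rewrite !mxE mul0rn.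
  rewrite -(geq_leqif (mxrank_leqif_sup AK)) mxrank_ker mxrank_tr rank_rV u0 subn1 /=.
  by move: freeA => /eqP ->.
move=> /submxP[x xE]; exists x => //.
by rewrite fE -xE addrCA subrr addr0.
Qed.

End affine_maps.

Section forms.
Context {R : realType} {c : nat}.
Variable Phi : cconvex R c -> cconvex R c.+1.
Implicit Types (x y z w : 'rV[R]_c) (u v p q o : 'rV[R]_c.+1) (C : cconvex R c).

Local Notation F x := (Phi (cconvex1 x) : set _).
Local Notation S := (Phi cconvex0 : set _).

Hypothesis hom : lattice_hom Phi.
Hypothesis ntr : forall x, ~ F x `<=` S.
Hypothesis usc : usc_at_points Phi.
Hypothesis c3 : (2 < c)%N.

Let c2 : (1 < c)%N. Proof. exact: ltnW. Qed.

(** Convexity of the whole union puts a point of [Phi C] into some [F x]; if [x] is not in [C], the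
    meet of [C] with [x] is empty and the point is in [S]. *)
Lemma hom_union C : conv_closed (\bigcup_x F x) ->
  cconvex_set C !=set0 \/ S = set0 -> Phi C = union_of_points Phi C :> set _.
Proof.
move=> cU CS; apply/seteqP; split=> [p Cp|p [x Cx]]; last exact: hom_point_in.
have [Sp|nSp] := pselect (S p).
  case: CS => [[x Cx]|S0]; last by move: Sp; rewrite S0.
  by exists x => //; apply: hom_core_sub Sp.
have [I [w Cw]] := compact_sub_fhull C.
have [x _ Fx] : (\bigcup_x F x) p.
  apply: (hom_fhull_sub hom cU _ _ (hom_mono hom Cw Cp)).
    by move=> q Sq; exists 0 => //; apply: hom_core_sub Sq.
  by move=> i _ q Fq; exists (w i).
exists x => //; apply: contrapT => nCx; apply: nSp.
have := hom_meet hom Cp Fx; apply: hom_mono => // v [Cv vx].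
by apply: nCx; rewrite -vx.
Qed.

(** * Segments pointing at [o] *)

Section cone.
Variables (o : 'rV[R]_c.+1) (phi : 'rV[R]_c -> 'rV[R]_c.+1) (s : 'rV[R]_c -> R).
Hypothesis cf : cone_form Phi o phi s.

Let s01 x : 0 <= s x < 1. Proof. by case: cf. Qed.
Let s0 x : 0 <= s x. Proof. by case/andP: (s01 x). Qed.
Let s1 x : s x < 1. Proof. by case/andP: (s01 x). Qed.

Let FE x p : F x p <-> exists t, [/\ s x <= t, t <= 1 & p = o + t *: (phi x - o)].
Proof. by case: cf. Qed.

Let nS x : ~ S (phi x). Proof. by case: cf. Qed.

Let ind x y : x <> y -> indep (phi x - o) (phi y - o).
Proof. by case: cf => _ _ _; exact. Qed.

Lemma cone_end x : F x (phi x).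
Proof.
by apply/FE; exists 1; rewrite lexx (ltW (s1 x)) scale1r addrCA subrr addr0.
Qed.

Let cone_near x : F x (o + s x *: (phi x - o)).
Proof. by apply/FE; exists (s x); rewrite lexx (ltW (s1 x)). Qed.

Let in_triangle x y (t : R) p : 0 <= t -> t <= 1 -> F (t *: x + (1 - t) *: y) p ->
  exists g h, [/\ 0 <= g, 0 <= h, g + h <= 1 & p = o + g *: (phi x - o) + h *: (phi y - o)].
Proof.
move=> t0 t1 Fp.
pose K := [set p | exists g h : R, [/\ 0 <= g, 0 <= h, g + h <= 1 &
  p = o + g *: (phi x - o) + h *: (phi y - o)]].
have cK : conv_closed K.
  move=> _ _ k [g [h [g0 h0 gh ->]]] [g' [h' [g'0 h'0 gh' ->]]] k0 k1.
  exists (k * g + (1 - k) * g'), (k * h + (1 - k) * h'); split.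
  - by rewrite addr_ge0// mulr_ge0// subr_ge0.
  - by rewrite addr_ge0// mulr_ge0// subr_ge0.
  - have := ler_wpM2l k0 gh; have : 0 <= 1 - k by rewrite subr_ge0.
    by move=> k2; have := ler_wpM2l k2 gh'; slra.
  - vec.
apply: (hom_segment_sub hom cK t0 t1 _ _ Fp) => q /FE[k [k0 k1 ->]].
- by exists k, 0; split; rewrite ?addr0//; [exact: le_trans (s0 x) k0|vec].
- by exists 0, k; split; rewrite ?add0r//; [exact: le_trans (s0 y) k0|vec].
Qed.

(** The segment from [phi x] to [phi y] meets [F z] at a fraction [l <= 1] of the way from [o] to
    [phi z], and [phi z] is within the triangle of [o], [phi x] and [phi y]; so [l = 1]. *)
Let cone_between x y (t : R) : x <> y -> 0 <= t -> t <= 1 ->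
  exists k : R, [/\ 0 <= k, k <= 1 &
    phi (t *: x + (1 - t) *: y) = k *: phi x + (1 - k) *: phi y].
Proof.
move=> xy t0 t1; set z := _ + _.
have [k [k0 k1 Fr]] := between_points hom ntr usc c2 (cone_end x) (cone_end y) t0 t1.
exists k; split=> //.
have [g [h [g0 h0 gh zE]]] := in_triangle t0 t1 (cone_end z).
rewrite -/z in Fr; have /FE[l [l0 l1 rE]] := Fr.
have [|e1 e2] := @ind x y xy (k - l * g) ((1 - k) - l * h).
  transitivity ((k *: phi x + (1 - k) *: phi y) - (o + l *: (phi z - o))).
    by rewrite zE; vec.
  by rewrite rE subrr.
have lp : 0 <= l by exact: le_trans (s0 z) l0.
have lgh := ler_wpM2l lp gh.
have l1' : l = 1 by apply/eqP; rewrite eq_le l1; slra.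
by rewrite rE l1' scale1r addrCA subrr addr0.
Qed.

Let cone_continuous u x (al : R) : dot u (phi x) < al ->
  \forall y \near x, dot u (phi y) < al.
Proof.
move=> ua; have [X XE] : exists X, X = phi x - o by exists (phi x - o).
have X0 : 0 < dot X X.
  apply: dot_gt0; rewrite XE subr_eq0; apply/eqP => po.
  have [e e0 _] := orthogonal_vector x c2.
  have [|/eqP] := @ind x (x + e) (neq_shift e0) 1 0; last by rewrite oner_eq0.
  by rewrite po subrr scaler0 scale0r addr0.
(* Retreating from [phi x] by a fraction [eta] of the way to [o] keeps [dot u] below [al]. *)
pose eta := Num.min 1 ((al - dot u (phi x)) / (`|dot u X| + 1)).
have d1 : 0 < `|dot u X| + 1 by rewrite ltr_wpDl.
have eta0 : 0 < eta by rewrite lt_min ltr01 divr_gt0// subr_gt0.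
have eta1 : eta <= 1 by rewrite ge_min lexx.
have eta2 : eta * (`|dot u X| + 1) <= al - dot u (phi x).
  by rewrite -ler_pdivlMr// ge_min lexx orbT.
have phiE : phi x = o + X by rewrite XE addrCA subrr addr0.
apply: (@end_continuous _ _ _ hom ntr usc c3 phi u X x (dot X o + (1 - eta) * dot X X)).
- exact: cone_end.
- move=> p /FE[t [t0 t1 ->]]; rewrite -XE !dotDr !dotZr.
  have [te|te] := ltP t (1 - eta); first by left; rewrite ltrD2l ltr_pM2r.
  right; have -> : dot u o = dot u (phi x) - dot u X by rewrite phiE dotDr addrK.
  have h1 : (1 - t) * `|dot u X| <= eta * `|dot u X| by rewrite ler_wpM2r//; slra.
  have h2 : (t - 1) * dot u X <= (1 - t) * `|dot u X|.
    have t2 : 0 <= 1 - t by rewrite subr_ge0.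
    by have := ler_wpM2l t2 (ler_norm (- dot u X)); rewrite normrN; slra.
  slra.
- by rewrite phiE dotDr ltrD2l gtr_pMl//; slra.
- move=> y p /FE[t [t0 t1 ->]]; rewrite dotDr dotZr ltrD2l => h.
  have -> : dot X (phi y) = dot X o + dot X (phi y - o) by rewrite -dotDr addrCA subrr addr0.
  rewrite ltrD2l; apply: (lt_le_trans h).
  have tp : 0 <= t := le_trans (s0 y) t0.
  have [Yp|Yn] := leP 0 (dot X (phi y - o)); first by rewrite ler_piMl.
  have h1 : 0 <= (1 - eta) * dot X X by rewrite mulr_ge0 ?subr_ge0// ltW.
  have h2 := mulr_ge0_le0 tp (ltW Yn).
  by have := le_lt_trans h1 (lt_le_trans h h2); rewrite ltxx.
Qed.

Lemma cone_affine : affine_map phi.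
Proof.
exact: (end_affine hom c3 cone_end nS cone_between cone_continuous).
Qed.

Lemma cone_inj : injective phi.
Proof.
move=> x y xy; apply: contrapT => nxy; have [|/eqP] := @ind x y nxy 1 (-1).
  by rewrite xy; vec.
by rewrite oner_eq0.
Qed.

Lemma cone_apex : ~ range phi o.
Proof.
move=> [x _ xo]; have [e e0 _] := orthogonal_vector x c2.
have [|/eqP] := @ind x (x + e) (neq_shift e0) 1 0; last by rewrite oner_eq0.
by rewrite xo subrr scaler0 scale0r addr0.
Qed.

(* The near ends [o + s x (phi x - o)] also preserve betweenness, which makes
   [1 / s] affine. *)
Lemma cone_constant : (forall x, 0 < s x) -> forall x y, s x = s y.
Proof.
move=> sp x0 y0; apply: invr_inj; move: x0 y0.
apply: positive_affine_constant => [x|x y t xy t0 t1]; first by rewrite invr_gt0.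
set z := _ + _.
have sx := sp x; have sy := sp y; have sz := sp z.
have phiz : phi z = t *: phi x + (1 - t) *: phi y.
  exact: affine_map_conv cone_affine.
pose m := t / s x + (1 - t) / s y.
have m0 : 0 < m.
  have [t0'|tn0] := eqVneq t 0.
    by rewrite /m t0' mul0r add0r subr0 divr_gt0.
  by rewrite ltr_pwDl ?divr_ge0 ?subr_ge0 ?divr_gt0 ?(ltW sy)// lt_neqAle eq_sym tn0.
suff : s z * m = 1 by move=> h; apply: (mulfI (lt0r_neq0 sz)); rewrite h divff// gt_eqF.
(* Upper bound: the segment joining the near ends meets [F z] at a parameter [l] with [l * m = 1],
   and [s z <= l]. *)
apply/eqP; rewrite eq_le; apply/andP; split.
  have [k [k0 k1 Fr]] := between_points hom ntr usc c2 (cone_near x) (cone_near y) t0 t1.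
  rewrite -/z in Fr; have /FE[l [l0 l1 rE]] := Fr.
  have [|e1 e2] := @ind x y xy (k * s x - l * t) ((1 - k) * s y - l * (1 - t)).
    transitivity (k *: (o + s x *: (phi x - o)) + (1 - k) *: (o + s y *: (phi y - o)) -
      (o + l *: (phi z - o))); first by rewrite phiz; vec.
    by rewrite rE subrr.
  have : l * m = 1.
    have -> : l * m = (l * t) / s x + (l * (1 - t)) / s y by rewrite /m; ring.
    have -> : l * t = k * s x by slra.
    have -> : l * (1 - t) = (1 - k) * s y by slra.
    by rewrite !mulfK ?gt_eqF// addrC subrK.
  by move=> <-; rewrite ler_pM2r.
(* Lower bound: the side, away from [o], of the line through the two near ends contains [F x] and
   [F y], hence the near end of [F z]. *)
pose K := [set p | exists g h : R, 1 <= g / s x + h / s y /\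
  p = o + g *: (phi x - o) + h *: (phi y - o)].
have cK : conv_closed K.
  move=> _ _ k [g [h [gh ->]]] [g' [h' [gh' ->]]] k0 k1.
  exists (k * g + (1 - k) * g'), (k * h + (1 - k) * h'); split; last by vec.
  have k2 : 0 <= 1 - k by rewrite subr_ge0.
  have := ler_wpM2l k0 gh; have := ler_wpM2l k2 gh'; rewrite !mulrDl; slra.
have [||g [h [gh zE]]] := hom_segment_sub hom cK t0 t1 _ _ (cone_near z).
- move=> q /FE[k [k0 k1 ->]]; exists k, 0; split; last by vec.
  by rewrite mul0r addr0 ler_pdivlMr// mul1r.
- move=> q /FE[k [k0 k1 ->]]; exists 0, k; split; last by vec.
  by rewrite mul0r add0r ler_pdivlMr// mul1r.
have [|e1 e2] := @ind x y xy (s z * t - g) (s z * (1 - t) - h).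
  transitivity (o + s z *: (phi z - o) - (o + g *: (phi x - o) + h *: (phi y - o))).
    by rewrite phiz; vec.
  by rewrite zE subrr.
have -> : s z * m = (s z * t) / s x + (s z * (1 - t)) / s y by rewrite /m; ring.
have -> : s z * t = g by slra.
by have -> : s z * (1 - t) = h by slra.
Qed.

(** Points with parameters [k] over [x] and [l] over [y] combine to one with parameter
    [m = t k + (1 - t) l], over the point where [x] has weight [t k / m]. For [m = 0] the
    combination is [o]. *)
Lemma cone_union_convex : (forall x y, s x = s y) -> conv_closed (\bigcup_x F x).
Proof.
move=> sc _ _ t [x _ /FE[k [k0 k1 ->]]] [y _ /FE[l [l0 l1 ->]]] t0 t1.
rewrite -(sc x y) in l0.
have kp := le_trans (s0 x) k0; have lp := le_trans (s0 x) l0.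
have u0 : 0 <= 1 - t by rewrite subr_ge0.
pose m := t * k + (1 - t) * l.
have tk := mulr_ge0 t0 kp; have tl := mulr_ge0 u0 lp.
have mE : (1 - t) * l = m - t * k by rewrite /m; ring.
have [m0|m0] := eqVneq m 0.
  exists x => //; apply/FE; exists m.
  have tk0 : t * k = 0 by move: m0; rewrite /m; slra.
  have tl0 : (1 - t) * l = 0 by move: m0; rewrite /m; slra.
  split.
  - have := ler_wpM2l t0 k0; have := ler_wpM2l u0 l0; rewrite tk0 tl0 m0; slra.
  - by rewrite m0.
  - rewrite m0 scale0r addr0.
    have -> : t *: (o + k *: (phi x - o)) + (1 - t) *: (o + l *: (phi y - o)) =
      o + (t * k) *: (phi x - o) + ((1 - t) * l) *: (phi y - o) by vec.
    by rewrite tk0 tl0 !scale0r !addr0.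
have mp : 0 < m by rewrite lt_neqAle eq_sym m0 addr_ge0.
exists ((t * k / m) *: x + (1 - t * k / m) *: y) => //; apply/FE; exists m; split.
- rewrite (sc _ x); have := ler_wpM2l t0 k0; have := ler_wpM2l u0 l0; rewrite /m; slra.
- by have := ler_wpM2l t0 k1; have := ler_wpM2l u0 l1; rewrite /m; slra.
- have phiE : phi ((t * k / m) *: x + (1 - t * k / m) *: y) =
     (t * k / m) *: phi x + (1 - t * k / m) *: phi y.
    exact: affine_map_conv cone_affine.
  rewrite phiE; apply/rowP => i; rewrite !mxE.
  have -> : m * ((t * k / m) * phi x 0 i + (1 - t * k / m) * phi y 0 i - o 0 i) =
    t * k * phi x 0 i + (1 - t) * l * phi y 0 i - m * o 0 i.
    by rewrite mE; field.
  by rewrite /m; ring.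
Qed.

End cone.

(** * Parallel segments *)

Section parallel.
Variables (v : 'rV[R]_c.+1) (phi : 'rV[R]_c -> 'rV[R]_c.+1) (r : 'rV[R]_c -> R).
Hypothesis S0 : forall q, ~ S q.
Hypothesis pf : parallel_form Phi v phi r.

Let r0 x : 0 < r x. Proof. by case: pf. Qed.

Let FE x p : F x p <-> exists t, [/\ 0 <= t, t <= r x & p = phi x + t *: v].
Proof. by case: pf. Qed.

Let ind x y : x <> y -> indep v (phi y - phi x).
Proof. by case: pf => _ _; exact. Qed.

Lemma parallel_end x : F x (phi x).
Proof. by apply/FE; exists 0; rewrite lexx (ltW (r0 x)) scale0r addr0. Qed.

Let parallel_top x : F x (phi x + r x *: v).
Proof. by apply/FE; exists (r x); rewrite lexx (ltW (r0 x)). Qed.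

Let in_trapezoid x y (t : R) p : 0 <= t -> t <= 1 -> F (t *: x + (1 - t) *: y) p ->
  exists g h, [/\ 0 <= h, h <= g * r x + (1 - g) * r y &
    p = phi y + g *: (phi x - phi y) + h *: v].
Proof.
move=> t0 t1 Fp.
pose K := [set p | exists g h, [/\ 0 <= h, h <= g * r x + (1 - g) * r y &
    p = phi y + g *: (phi x - phi y) + h *: v]].
have cK : conv_closed K.
  move=> _ _ k [g [h [h0 gh ->]]] [g' [h' [h'0 gh' ->]]] k0 k1.
  have k2 : 0 <= 1 - k by rewrite subr_ge0.
  exists (k * g + (1 - k) * g'), (k * h + (1 - k) * h'); split; last by vec.
    by rewrite addr_ge0// mulr_ge0.
  by have := ler_wpM2l k0 gh; have := ler_wpM2l k2 gh'; slra.
apply: (hom_segment_sub hom cK t0 t1 _ _ Fp) => q /FE[k [k0 k1 ->]].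
- by exists 1, k; split=> //; [slra|vec].
- by exists 0, k; split=> //; [slra|vec].
Qed.

(** The point where the segment of the ends meets [F z] is [l] above [phi z], which is itself [h]
    above the line of the ends; so [l + h = 0] with both terms nonnegative. *)
Let parallel_between x y (t : R) : x <> y -> 0 <= t -> t <= 1 ->
  exists k : R, [/\ 0 <= k, k <= 1 &
    phi (t *: x + (1 - t) *: y) = k *: phi x + (1 - k) *: phi y].
Proof.
move=> xy t0 t1; set z := _ + _.
have [k [k0 k1 Fr]] := between_points hom ntr usc c2 (parallel_end x) (parallel_end y) t0 t1.
exists k; split=> //.
have [g [h [h0 gh zE]]] := in_trapezoid t0 t1 (parallel_end z).
rewrite -/z in Fr; have /FE[l [l0 l1 rE]] := Fr.
have [|e1 e2] := @ind y x (not_eq_sym xy) (- (l + h)) (k - g).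
  transitivity ((k *: phi x + (1 - k) *: phi y) - (phi z + l *: v)).
    by rewrite zE; vec.
  by rewrite rE subrr.
have l0' : l = 0 by apply/eqP; rewrite eq_le l0 andbT; slra.
by rewrite rE l0' scale0r addr0.
Qed.

Let v0 : v != 0.
Proof.
apply/eqP => v0; have [e e0 _] := orthogonal_vector (0 : 'rV[R]_c) c2.
have [|/eqP] := @ind 0 (0 + e) (neq_shift e0) 1 0; last by rewrite oner_eq0.
by rewrite v0 scaler0 scale0r addr0.
Qed.

Let parallel_continuous u x (al : R) : dot u (phi x) < al ->
  \forall y \near x, dot u (phi y) < al.
Proof.
move=> ua; have V0 := dot_gt0 v0.
pose eta := (al - dot u (phi x)) / (`|dot u v| + 1).
have d1 : 0 < `|dot u v| + 1 by rewrite ltr_wpDl.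
have eta0 : 0 < eta by rewrite divr_gt0// subr_gt0.
have eta2 : eta * (`|dot u v| + 1) = al - dot u (phi x) by rewrite divfK// gt_eqF.
apply: (@end_continuous _ _ _ hom ntr usc c3 phi u (- v) x
  (dot (- v) (phi x) - eta * dot v v)).
- exact: parallel_end.
- move=> p /FE[t [t0 t1 ->]]; rewrite !dotDr !dotZr dotNl (dotNl v v).
  have [te|te] := ltP eta t.
    by left; have : eta * dot v v < t * dot v v by [rewrite ltr_pM2r]; slra.
  right.
  have h1 : t * `|dot u v| <= eta * `|dot u v| by rewrite ler_wpM2r.
  have h2 : t * dot u v <= t * `|dot u v| by rewrite ler_wpM2l// ler_norm.
  slra.
- by have := mulr_gt0 eta0 V0; slra.
- move=> y p /FE[t [t0 t1 ->]]; rewrite !dotNl dotDr dotZr.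
  by have := mulr_ge0 t0 (ltW V0); slra.
Qed.

Lemma parallel_affine : affine_map phi.
Proof.
apply: (@end_affine _ _ _ hom c3 phi parallel_end _ parallel_between parallel_continuous).
by move=> x; exact: S0.
Qed.

Lemma parallel_inj : injective phi.
Proof.
move=> x y xy; apply: contrapT => nxy; have [|_ /eqP] := @ind x y nxy 0 1.
  by rewrite xy; vec.
by rewrite oner_eq0.
Qed.

Lemma parallel_transversal x (k : R) : k != 0 -> ~ range phi (phi x + k *: v).
Proof.
move=> k0 [y _ yE]; have [xy|/eqP xy] := eqVneq x y.
  move: yE; rewrite xy -[LHS]addr0 => /addrI/esym/eqP.
  by rewrite scaler_eq0 (negbTE k0) (negbTE v0).
have [|_ /eqP] := @ind x y xy (- k) 1; last by rewrite oner_eq0.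
by rewrite yE; vec.
Qed.

(** The heights are affine: [in_trapezoid] bounds [r z] above by the interpolated height, and the
    point of [F z] on the segment joining the tops bounds it below. *)
Lemma parallel_constant x y : r x = r y.
Proof.
move: x y; apply: positive_affine_constant => // x y t xy t0 t1.
set z := _ + _.
have phiz : phi z = t *: phi x + (1 - t) *: phi y.
  exact: affine_map_conv parallel_affine.
apply/eqP; rewrite eq_le; apply/andP; split.
  have [g [h [h0 gh zE]]] := in_trapezoid t0 t1 (parallel_top z).
  have [|e1 e2] := @ind y x (not_eq_sym xy) (r z - h) (t - g).
    transitivity (phi z + r z *: v - (phi y + g *: (phi x - phi y) + h *: v)).
      by rewrite phiz; vec.
    by rewrite zE subrr.
  have -> : t = g by slra.
  slra.
have [k [k0 k1 Fr]] := between_points hom ntr usc c2 (parallel_top x) (parallel_top y) t0 t1.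
rewrite -/z in Fr; have /FE[l [l0 l1 rE]] := Fr.
have [|e1 e2] := @ind y x (not_eq_sym xy) (k * r x + (1 - k) * r y - l) (k - t).
  transitivity (k *: (phi x + r x *: v) + (1 - k) *: (phi y + r y *: v) - (phi z + l *: v)).
    by rewrite phiz; vec.
  by rewrite rE subrr.
have <- : k = t by slra.
slra.
Qed.

Lemma parallel_union_convex : conv_closed (\bigcup_x F x).
Proof.
move=> _ _ t [x _ /FE[k [k0 k1 ->]]] [y _ /FE[l [l0 l1 ->]]] t0 t1.
have u0 : 0 <= 1 - t by rewrite subr_ge0.
exists (t *: x + (1 - t) *: y) => //; apply/FE; exists (t * k + (1 - t) * l); split.
- by rewrite addr_ge0// mulr_ge0.
- rewrite (parallel_constant _ x); rewrite (parallel_constant y x) in l1.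
  by have := ler_wpM2l t0 k1; have := ler_wpM2l u0 l1; slra.
- by rewrite (affine_map_conv _ _ _ parallel_affine); vec.
Qed.

End parallel.

Lemma singleton_affine (phi : 'rV[R]_c -> 'rV[R]_c.+1) : (forall q, ~ S q) ->
  (forall x p, F x p <-> p = phi x) -> affine_map phi.
Proof.
move=> S0 FE; have Fphi x : F x (phi x) by apply/FE.
apply: (@end_affine _ _ _ hom c3 phi Fphi) => [x|x y t _ t0 t1|u x al ua].
- exact: S0.
- have [k [k0 k1 /FE Fr]] := between_points hom ntr usc c2 (Fphi x) (Fphi y) t0 t1.
  by exists k.
- have := usc (x := x) (@open_dot_lt _ _ u al); rewrite /= => h.
  have : F x `<=` [set p | dot u p < al] by move=> p /FE ->.
  by move=> /h; apply: filterS => y; apply.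
Qed.

End forms.

(** * The four cases *)

Section sufficiency.
Context {R : realType} {c : nat}.
Variable Phi : cconvex R c -> cconvex R c.+1.
Implicit Types (x y : 'rV[R]_c) (C D : cconvex R c).

Local Notation F x := (Phi (cconvex1 x) : set _).
Local Notation S := (Phi cconvex0 : set _).

Lemma cconvex_emptyP C : C = cconvex0 \/ cconvex_set C !=set0.
Proof.
have [C0|/set0P C0] := eqVneq (cconvex_set C) set0; last by right.
by left; exact: cconvex_inj.
Qed.

(** A common point of [Phi C] and [Phi D] comes from [x] in [C] and [y] in [D], and is in [S] unless
    [x = y]. A point of the image of a join comes from a point between [C] and [D], and the fourth
    hypothesis splits it accordingly. *)
Lemma union_hom : (forall x, S `<=` F x) -> ~ (F 0 `<=` S) ->
  (forall x y, x <> y -> F x `&` F y `<=` S) ->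
  (forall x y (t : R) p, F (t *: x + (1 - t) *: y) p -> exists a b,
    [/\ F x a, F y b & p = t *: a + (1 - t) *: b]) ->
  (forall C, cconvex_set C !=set0 -> Phi C = union_of_points Phi C :> set _) ->
  lattice_hom Phi /\ ~ trivial_map Phi.
Proof.
move=> SF ntr FI FJ FU.
have mem C x p : cconvex_set C x -> F x p -> cconvex_set (Phi C) p.
  by move=> Cx Fp; rewrite FU; [exists x|exists x].
have core C : S `<=` Phi C.
  by case: (cconvex_emptyP C) => [->//|[x Cx]] p /(SF x); exact: mem.
have mono C D : C `<=` D -> Phi C `<=` Phi D.
  case: (cconvex_emptyP C) => [->|C0] CD p; first exact: core.
  by rewrite FU// => -[x /CD Dx Fp]; exact: mem Fp.
split; last first.
  by move=> [K hK]; apply: ntr; rewrite (hK (cconvex1 0)) (hK cconvex0).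
split=> C D; apply/cconvex_inj/seteqP; split.
- by move=> p h; split; move: p h; apply: mono => x [].
- move=> p [/=]; case: (cconvex_emptyP C) => [->|C0]; first by move=> Sp _; exact: core.
  case: (cconvex_emptyP D) => [->|D0]; first by move=> _ Sp; exact: core.
  rewrite (FU _ C0) (FU _ D0) => -[x Cx Fx] [y Dy Fy].
  have [xy|/eqP xy] := eqVneq x y; last by apply: core; exact: FI xy _ _.
  by apply: mem Fx; split=> //; rewrite xy.
- move=> p; case: (cconvex_emptyP C) => [->|C0].
    have -> : Order.join cconvex0 D = D.
      by apply/cconvex_inj; rewrite cconvex_joinE set0U conv_hull_id//; exact: cconvex_convex.
    exact: join_subr.
  case: (cconvex_emptyP D) => [->|D0].
    have -> : Order.join C cconvex0 = C.
      by apply/cconvex_inj; rewrite cconvex_joinE setU0 conv_hull_id//; exact: cconvex_convex.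
    exact: join_subl.
  rewrite FU; last by have [x Cx] := C0; exists x; exact: join_subl.
  move=> [z]; rewrite cconvex_joinE conv_hullU_join//; try exact: cconvex_convex.
  move=> [[[x y] t] /= [[Cx Dy]]]; rewrite in_itv/= => /andP[t0 t1] <- /FJ[a [b [Fa Fb ->]]].
  apply: (@cconvex_conv _ _ (Order.join (Phi C) (Phi D))) => //.
    by apply: (@join_subl _ _ (Phi C)); exact: mem Fa.
  by apply: (@join_subr _ _ _ (Phi D)); exact: mem Fb.
- by apply: join_sub; [exact: cconvex_conv|apply: mono; exact: join_subl|apply: mono;
  exact: join_subr].
Qed.

Lemma segment_hom (phi psi : 'rV[R]_c -> 'rV[R]_c.+1) :
  affine_map phi -> affine_map psi ->
  (forall x, F x = segment (phi x) (psi x)) ->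
  (forall x, S `<=` F x) -> ~ (F 0 `<=` S) ->
  (forall x y (s t : R) p, x <> y -> 0 <= s <= 1 -> p = (1 - s) *: phi x + s *: psi x ->
    p = (1 - t) *: phi y + t *: psi y -> S p) ->
  (forall C, cconvex_set C !=set0 -> Phi C = union_of_points Phi C :> set _) ->
  lattice_hom Phi /\ ~ trivial_map Phi.
Proof.
move=> aphi apsi FE SF ntr sep FU; apply: union_hom => // [x y xy p|x y t p].
  rewrite !FE => -[[s s01 sE] [t _ tE]].
  by apply: (sep x y s t p xy); rewrite ?sE ?tE//; move: s01; rewrite /= in_itv.
rewrite FE => -[s s01 <-].
(* The same parameter [s] serves over [x] and [y], since both ends are affine. *)
exists ((1 - s) *: phi x + s *: psi x), ((1 - s) *: phi y + s *: psi y); split.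
- by rewrite FE; exists s.
- by rewrite FE; exists s.
- by rewrite (affine_map_conv _ _ _ aphi) (affine_map_conv _ _ _ apsi); vec.
Qed.

End sufficiency.

(** * Exclusivity and sufficiency of the four cases *)

Section cases.
Context {R : realType} {c : nat}.
Variables (Phi : cconvex R c -> cconvex R c.+1) (H : set 'rV[R]_c.+1).
Variable phi : 'rV[R]_c -> 'rV[R]_c.+1.
Hypotheses (hypH : hyperplane H) (bijphi : affine_bij phi H) (c1 : (0 < c)%N).

Let Hphi x : H (phi x).
Proof. by case: bijphi => _ [h _ _]; apply: h. Qed.

Let phi_inj x y : phi x = phi y -> x = y.
Proof.
by case: bijphi => _ [_ h _] xy; apply: h => //; rewrite inE.
Qed.

Let two_points : exists2 e : 'rV[R]_c, e != 0 & phi e <> phi 0.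
Proof.
exists (delta_mx 0 (Ordinal c1)).
  by apply/eqP => /rowP/(_ (Ordinal c1)); rewrite !mxE !eqxx => /eqP; rewrite oner_eq0.
by move=> /phi_inj /rowP/(_ (Ordinal c1)); rewrite !mxE !eqxx => /eqP; rewrite oner_eq0.
Qed.

Lemma segment_start (p q : 'rV[R]_c.+1) : segment p q p.
Proof. by exists 0; [rewrite /= in_itv/= lexx ler01|rewrite scale0r addr0 subr0 scale1r]. Qed.

Lemma segment_finish (p q : 'rV[R]_c.+1) : segment p q q.
Proof. by exists 1; [rewrite /= in_itv/= lexx ler01|rewrite subrr scale0r add0r scale1r]. Qed.

Lemma segment_point (p : 'rV[R]_c.+1) : segment p p = [set p].
Proof.
apply/seteqP; split=> [_ [t _ <-]|_ ->]; last exact: segment_start.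
by rewrite /= -scalerDl subrK scale1r.
Qed.

(** Each of [q], [q'] is on the segment from [p] to the other, so [q - p] is [s * t] times itself;
    for [s * t < 1] both collapse to [p]. *)
Lemma segment_inj (p q q' : 'rV[R]_c.+1) : segment p q = segment p q' -> q = q'.
Proof.
move=> E.
have : segment p q' q by rewrite -E; exact: segment_finish.
have : segment p q q' by rewrite E; exact: segment_finish.
move=> [s]; rewrite /= in_itv/= => /andP[s0 s1] sE [t]; rewrite /= in_itv/= => /andP[t0 t1] tE.
have [t1'|t1'] := eqVneq t 1; first by rewrite -tE t1' subrr scale0r add0r scale1r.
have st : s * t < 1.
  by apply: le_lt_trans (_ : s * t <= t) _; [rewrite ler_piMl|rewrite lt_neqAle t1'].
have qp : (1 - s * t) *: (q - p) = 0.
  transitivity (q - ((1 - t) *: p + t *: ((1 - s) *: p + s *: q))); first by vec.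
  by rewrite sE tE subrr.
move: qp => /eqP; rewrite scaler_eq0 subr_eq0 (gt_eqF st)/= subr_eq0 => /eqP qp.
by rewrite -sE qp -scalerDl subrK scale1r.
Qed.

(** The union formula at the empty set distinguishes (i), (iii) and (iv), where it applies, from
    (ii). *)
Let empty_core : Phi cconvex0 = union_of_points Phi cconvex0 :> set _ ->
  cconvex_set (Phi cconvex0) = set0.
Proof. by move=> ->; apply/seteqP; split=> // p [x []]. Qed.

Lemma case_i_sub : case_i Phi phi -> cconvex_set (Phi cconvex0) = set0.
Proof. by move=> h; have [_ /empty_core] := h 0 cconvex0. Qed.

Lemma case_iii_sub : case_iii Phi H phi -> cconvex_set (Phi cconvex0) = set0.
Proof. by move=> [v [_ h]]; have [_ /empty_core] := h 0 cconvex0. Qed.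

Lemma case_iv_sub : case_iv Phi H phi -> cconvex_set (Phi cconvex0) = set0.
Proof. by move=> [ o [g [_ _ h]]]; have [_ /empty_core] := h 0 cconvex0. Qed.

Let not_case_ii : cconvex_set (Phi cconvex0) = set0 -> ~ case_ii Phi H phi.
Proof. by move=> S0 [ o [_ So _]]; move: (erefl o : [set o] o); rewrite -So S0. Qed.

Let not_i_iii : case_i Phi phi -> ~ case_iii Phi H phi.
Proof.
move=> h [v [nv h3]]; apply: nv; have [E _] := h3 0 cconvex0.
have [E1 _ _] := h 0 cconvex0; move: E; rewrite E1 -(segment_point (phi 0)).
by move=> /segment_inj/eqP; rewrite -subr_eq0 opprD addNKr oppr_eq0 => /eqP -> y; rewrite addr0.
Qed.

Let not_i_iv : case_i Phi phi -> ~ case_iv Phi H phi.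
Proof.
move=> h [ o [g [no g01 h4]]]; apply: no; have [E _] := h4 0 cconvex0.
have [E1 _ _] := h 0 cconvex0; move: E; rewrite E1 -(segment_point (phi 0)).
move=> /segment_inj E; suff -> : o = phi 0 by [].
have g1 : 1 - g != 0 by case/andP: g01 => _ g1; rewrite subr_eq0 gt_eqF.
apply: (scalerI g1); have -> : (1 - g) *: o = phi 0 - g *: phi 0 by rewrite {1}E addrAC subrr add0r.
vec.
Qed.

Let not_iii_iv : case_iii Phi H phi -> ~ case_iv Phi H phi.
Proof.
move=> [v [nv h3]] [ o [g [no g01 h4]]].
have g1 : 1 - g != 0 by case/andP: g01 => _ g1; rewrite subr_eq0 gt_eqF.
have vE x : v = (1 - g) *: (o - phi x).
  have [E3 _] := h3 x cconvex0; have [E4 _] := h4 x cconvex0.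
  move: E3; rewrite E4 => /segment_inj E.
  by rewrite -[LHS](addKr (phi x)) -E; vec.
have [e e0 ne] := two_points; apply: ne.
have := vE e; rewrite (vE 0) => /(scalerI g1)/addrI/oppr_inj.
by move=> ->.
Qed.

Lemma exactly_one_cases :
  exactly_one (case_i Phi phi) (case_ii Phi H phi) (case_iii Phi H phi) (case_iv Phi H phi) <->
  [\/ case_i Phi phi, case_ii Phi H phi, case_iii Phi H phi | case_iv Phi H phi].
Proof.
split=> [[[h _ _ _]|[_ h _ _]|[_ _ h _]|[_ _ _ h]]|[h|h|h|h]].
- by constructor 1.
- by constructor 2.
- by constructor 3.
- by constructor 4.
- constructor 1; split=> //; last exact: not_i_iv.
    by apply: not_case_ii; exact: case_i_sub.
  exact: not_i_iii.
- constructor 2; split=> // k; apply: not_case_ii h.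
  + exact: case_i_sub.
  + exact: case_iii_sub.
  + exact: case_iv_sub.
- constructor 3; split=> //; last exact: not_iii_iv.
    by move=> k; exact: not_i_iii k h.
  by apply: not_case_ii; exact: case_iii_sub.
- constructor 4; split=> //.
  + by move=> k; exact: not_i_iv k h.
  + by apply: not_case_ii; exact: case_iv_sub.
  + by move=> k; exact: not_iii_iv k h.
Qed.

Lemma cases_hom :
  [\/ case_i Phi phi, case_ii Phi H phi, case_iii Phi H phi | case_iv Phi H phi] ->
  lattice_hom Phi /\ ~ trivial_map Phi.
Proof.
have [u [b [u0 HE]]] := hypH.
have phib x : dot u (phi x) = b by have := Hphi x; rewrite HE.
have inH y : dot u y = b -> H y by rewrite HE.
have aphi : affine_map phi by case: bijphi.
case.
- move=> h; have S0 := case_i_sub h.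
  apply: (segment_hom aphi aphi).
  + by move=> x; have [-> _ _] := h x cconvex0; rewrite segment_point.
  + by move=> x p; rewrite S0.
  + rewrite S0 => h0; apply: (h0 (phi 0)); have [-> _ _] := h 0 cconvex0.
    by [].
  + move=> x y s t p xy _; rewrite -!scalerDl !subrK !scale1r => -> /phi_inj.
    by move/xy.
  + by move=> C _; have [_ -> _] := h 0 C.
- move=> [ o [no So h]].
  have FE x : cconvex_set (Phi (cconvex1 x)) = segment (phi x) o.
    by have [|-> _] := h x (cconvex1 x); first by exists x.
  apply: (@segment_hom _ _ _ phi (fun=> o) aphi _ FE).
  + by move=> t x y; vec.
  + by move=> x p; rewrite So FE => ->; exact: segment_finish.
  + rewrite So FE => /(_ _ (segment_start _ _)) /= po; apply: no; rewrite -po.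
    exact: Hphi.
  + move=> x y s t p xy _ -> E; rewrite So /=.
    have ob : b - dot u o != 0.
      by rewrite subr_eq0; apply/eqP => ob; apply: no; exact: inH.
    (* [u] is constant on [H] and takes another value at [o], so the level of a point determines its
       parameter. *)
    have st : s = t.
      have := congr1 (dot u) E; rewrite !dotDr !dotZr !phib => E'.
      by apply: (mulIf ob); slra.
    move: E; rewrite st => /addIr; have [->|t1] := eqVneq t 1.
      by rewrite subrr !scale0r !add0r scale1r.
    move=> /(scalerI (_ : 1 - t != 0)) pxy; exfalso; apply: xy; apply: phi_inj.
    by apply: pxy; rewrite subr_eq0 eq_sym.
  + by move=> C C0; have [_ ->] := h 0 C C0.
- move=> h; have S0 := case_iii_sub h; have [v [nv h3]] := h.
  have FE x : cconvex_set (Phi (cconvex1 x)) = segment (phi x) (phi x + v).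
    by have [-> _] := h3 x cconvex0.
  have uv : dot u v != 0.
    apply/eqP => uv; apply: nv => y; rewrite HE => yb.
    by change (dot u (y + v) = b); rewrite dotDr uv addr0.
  apply: (@segment_hom _ _ _ phi (fun x => phi x + v) aphi _ FE).
  + by move=> t x y; rewrite aphi; vec.
  + by move=> x p; rewrite S0.
  + by rewrite S0 FE => /(_ _ (segment_start _ _)).
  + move=> x y s t p xy _ -> E; exfalso.
    have st : s = t.
      have := congr1 (dot u) E; rewrite !dotDr !dotZr !dotDr !phib => E'.
      by apply: (mulIf uv); slra.
    apply: xy; apply: phi_inj; move: E; rewrite st => E.
    by apply/rowP => i; move/rowP: E => /(_ i); rewrite !mxE; slra.
  + by move=> C _; have [_ ->] := h3 0 C.
- move=> h; have S0 := case_iv_sub h; have [ o [g [no /andP[g0 g1] h4]]] := h.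
  have FE x : cconvex_set (Phi (cconvex1 x)) = segment (phi x) (g *: phi x + (1 - g) *: o).
    by have [-> _] := h4 x cconvex0.
  apply: (@segment_hom _ _ _ phi (fun x => g *: phi x + (1 - g) *: o) aphi _ FE).
  + by move=> t x y; rewrite aphi; vec.
  + by move=> x p; rewrite S0.
  + by rewrite S0 FE => /(_ _ (segment_start _ _)).
  + move=> x y s t p xy /andP[s0 s1] -> E; exfalso.
    have ob : (1 - g) * (b - dot u o) != 0.
      apply: mulf_neq0; rewrite subr_eq0; first by rewrite gt_eqF.
      by apply/eqP => ob; apply: no; exact: inH.
    have st : s = t.
      have := congr1 (dot u) E; rewrite !dotDr !dotZr !dotDr !dotZr !phib => E'.
      by apply: (mulIf ob); slra.
    (* This is the coefficient of [phi x] in a point of its segment; it is at least [g]. *)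
    have g' : 1 - s * (1 - g) != 0.
      have sg : s * (1 - g) <= 1 - g by rewrite ler_piMl// subr_ge0 ltW.
      by rewrite gt_eqF//; slra.
    apply: xy; apply: phi_inj; apply: (scalerI g'); move: E; rewrite st => E.
    by apply/rowP => i; move/rowP: E => /(_ i); rewrite !mxE; slra.
  + by move=> C _; have [_ ->] := h4 0 C.
Qed.

End cases.

(** * From homomorphisms to the four cases *)

Section necessity.
Context {R : realType} {c : nat}.
Variable Phi : cconvex R c -> cconvex R c.+1.
Hypotheses (hom : lattice_hom Phi) (ntriv : ~ trivial_map Phi) (c3 : (2 < c)%N).

Local Notation F x := (Phi (cconvex1 x) : set _).
Local Notation S := (Phi cconvex0 : set _).

Let c2 : (1 < c)%N. Proof. exact: ltnW. Qed.
Let ntr x : ~ F x `<=` S. Proof. exact: nontrivial_point. Qed.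
Let usc : usc_at_points Phi. Proof. exact: hom_usc. Qed.

Definition has_case := exists (H : set 'rV[R]_c.+1) (phi : 'rV[R]_c -> 'rV[R]_c.+1),
  [/\ hyperplane H, affine_bij phi H & [\/ case_i Phi phi, case_ii Phi H phi,
    case_iii Phi H phi | case_iv Phi H phi]].

Let range_case (phi : 'rV[R]_c -> 'rV[R]_c.+1) : affine_map phi -> injective phi ->
  [\/ case_i Phi phi, case_ii Phi (range phi) phi,
    case_iii Phi (range phi) phi | case_iv Phi (range phi) phi] -> has_case.
Proof.
move=> aphi iphi h; exists (range phi), phi; split=> //.
  exact: affine_image_hyperplane.
split=> //; split; last exact: subset_refl.
  by move=> x _; exists x.
by move=> x y _ _; exact: iphi.
Qed.

(** Passes from the parameter of [segment], starting at [p], to that of [cone_form], counted from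
    [o]; (iv) uses the value of [s] as [gamma], and (ii) is [s = 0]. *)
Let segmentE (p q o : 'rV[R]_c.+1) (s : R) : 0 <= s -> s < 1 -> q = s *: p + (1 - s) *: o ->
  segment p q = [set r | exists t, [/\ s <= t, t <= 1 & r = o + t *: (p - o)]].
Proof.
move=> s0 s1 ->; have s2 : 0 < 1 - s by rewrite subr_gt0.
apply/seteqP; split=> [_ [t t01 <-]|_ [t [st t1 ->]]].
  move: t01; rewrite /= in_itv/= => /andP[t0 t1].
  exists (1 - t * (1 - s)); split; last by vec.
  - by have : t * (1 - s) <= 1 - s by [rewrite ler_piMl// ltW]; slra.
  - by have := mulr_ge0 t0 (ltW s2); slra.
exists ((1 - t) / (1 - s)).
  rewrite /= in_itv/= divr_ge0 ?subr_ge0 ?(ltW s1)//= ler_pdivrMr// mul1r; slra.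
by apply/rowP => i; rewrite !mxE; field; rewrite gt_eqF.
Qed.

Let case_core_nonempty o : S o -> has_case.
Proof.
move=> So; have [phi cf] := core_cone_form hom ntr usc c3 So.
have aphi := cone_affine hom ntr usc c3 cf.
apply: (range_case aphi (cone_inj cf)); constructor 2; exists o.
have [_ FE nS ind] := cf.
have FE' x : F x = segment (phi x) o.
  rewrite (@segmentE _ _ o 0) ?lexx ?ltr01 ?scale0r ?add0r ?subr0 ?scale1r//.
  by apply/seteqP; split=> p; rewrite FE.
split=> [||x C C0]; first exact: (cone_apex c3 cf).
(* A point of [S] is on the lines through [o] of two different points, which meet only in [o]. *)
- apply/seteqP; split=> [p Sp|_ ->//].
  have [e e0 _] := orthogonal_vector (0 : 'rV[R]_c) c2.
  have /FE[t [_ _ tE]] := hom_core_sub hom (cconvex1 0) Sp.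
  have /FE[k [_ _ kE]] := hom_core_sub hom (cconvex1 (0 + e)) Sp.
  have [|t0 _] := @ind 0 (0 + e) (neq_shift e0) t (- k).
    by rewrite scaleNr; apply/eqP; rewrite subr_eq0; apply/eqP/(addrI o); rewrite -tE -kE.
  by rewrite tE t0 scale0r addr0.
split; first exact: FE'.
by apply: hom_union => //; [exact: (cone_union_convex hom ntr usc c3 cf)|left].
Qed.

Let case_core_empty : (forall q, ~ S q) -> has_case.
Proof.
move=> S0; have S0' : S = set0 by apply/seteqP; split=> // q /S0.
have [[phi FE]|[[ o [phi [s [cf sp]]]]|[v [phi [r pf]]]]] := core_empty_form hom ntr usc c3 S0.
- have FE' x : F x = [set phi x] by apply/seteqP; split=> p; rewrite FE.
  have aphi := singleton_affine hom ntr usc c3 S0 FE.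
  have iphi : injective phi.
    move=> x y xy; apply: contrapT => nxy; apply: (S0 (phi x)).
    by apply: (hom_point_disj hom nxy); apply/FE.
  apply: (range_case aphi iphi); constructor 1 => x C.
  have UE : Phi C = union_of_points Phi C :> set _.
    apply: hom_union => //; last by right.
    move=> p q t [y _ /FE ->] [z _ /FE ->] t0 t1.
    exists (t *: y + (1 - t) *: z) => //; apply/FE.
    by rewrite affine_map_conv.
  split=> //; rewrite UE; apply/seteqP; split=> [p [y Cy /FE ->]|_ [y Cy <-]].
    by exists y.
  by exists y => //; apply/FE.
- have aphi := cone_affine hom ntr usc c3 cf.
  have sc := cone_constant hom ntr usc c3 cf sp.
  apply: (range_case aphi (cone_inj cf)); constructor 4; exists o, (s 0).
  have [s01 FE _ _] := cf; have /andP[s0 s1] := s01 0.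
  split=> [||x C]; first exact: (cone_apex c3 cf); first by rewrite sp s1.
  split; last by apply: hom_union => //; [exact: (cone_union_convex hom ntr usc c3 cf)|right].
  rewrite (@segmentE _ _ o (s 0))//.
  by apply/seteqP; split=> p; rewrite FE (sc x 0).
have aphi := parallel_affine hom ntr usc c3 S0 pf.
have rc := parallel_constant hom ntr usc c3 S0 pf.
have [r0 FE _] := pf; have rn0 : r 0 != 0 by rewrite gt_eqF.
apply: (range_case aphi (parallel_inj pf)); constructor 3; exists (r 0 *: v).
split=> [/(_ (phi 0))|x C].
  by move=> h; apply: (parallel_transversal c3 pf (x := 0) rn0); apply: h; exists 0.
split; last by apply: hom_union => //; [exact: (parallel_union_convex hom ntr usc c3 S0 pf)|right].
apply/seteqP; split=> p.
  move=> /FE[t [t0 t1 ->]]; exists (t / r 0).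
    by rewrite /= in_itv/= divr_ge0 ?(ltW (r0 0))//= ler_pdivrMr// mul1r -(rc x 0).
  by apply/rowP => i; rewrite !mxE; field.
move=> [t]; rewrite /= in_itv/= => /andP[t0 t1] <-; apply/FE.
exists (t * r 0); rewrite (rc x 0); split; last by vec.
- by rewrite mulr_ge0// ltW.
- by rewrite ler_piMl// ltW.
Qed.

Lemma hom_has_case : has_case.
Proof.
have [[ o So]|S0] := pselect (exists o, S o); first exact: case_core_nonempty So.
by apply: case_core_empty => q Sq; apply: S0; exists q.
Qed.

End necessity.

Theorem theorem4p4 (R : realType) (c : nat) (hc : (3 <= c)%N)
    (Phi : cconvex R c -> cconvex R c.+1) :
  (lattice_hom Phi /\ ~ trivial_map Phi)
  <->
  (exists (H : set 'rV[R]_c.+1) (phi : 'rV[R]_c -> 'rV[R]_c.+1),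
     [/\ hyperplane H, affine_bij phi H &
      exactly_one (case_i Phi phi) (case_ii Phi H phi)
                  (case_iii Phi H phi) (case_iv Phi H phi)]).
Proof.
have c1 : (0 < c)%N by apply: leq_trans hc.
split=> [[hom ntriv]|[H [phi [hypH bijphi /(exactly_one_cases _ bijphi c1)]]]].
  have [H [phi [hypH bijphi h]]] := hom_has_case hom ntriv hc.
  by exists H, phi; split=> //; apply/exactly_one_cases.
exact: cases_hom.
Qed.
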